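(* Let $i\in\{0,\dots,p-2\}$ and $j\in\{1,\dots,p-i-1\}$. Then the following statements hold: (1) The module $\mathrm{Rad}(Z(i))|_{\mathfrak e_f}$ has constant $j$-rank and $\deg^j(\mathrm{Rad}(Z(i))|_{\mathfrak e_f})=j\left(\frac{p(p-j)}{2}-i-1\right)$. (2) The module $(Z'(i+2)/\mathrm{Soc}(Z'(i+2)))|_{\mathfrak e_f}$ has constant $j$-rank and $j$-degree $\deg^j((Z'(i+2)/\mathrm{Soc}(Z'(i+2)))|_{\mathfrak e_f})=j\frac{p(p-j)}{2}$. (3) The module $\mathrm{Rad}(Z(i))|_{\mathfrak e_e}$ has constant $j$-rank and $\deg^j(\mathrm{Rad}(Z(i))|_{\mathfrak e_e})=j\frac{p(p-j)}{2}$.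
   Context: $k$ is an algebraically closed field of characteristic $p\ge 3$. Let $\{e,h,f\}$ be the standard basis of $\mathfrak{sl}(2)$: $e=\begin{pmatrix}0&1\\0&0\end{pmatrix}$, $h=\begin{pmatrix}1&0\\0&-1\end{pmatrix}$, $f=\begin{pmatrix}0&0\\1&0\end{pmatrix}$, with its usual $p$-map (the $p$-th power of matrices). Let $\psi:\mathfrak{sl}(2)\to k$ be the linear form with $\psi(h)=1$, $\psi(e)=\psi(f)=0$. The restricted Lie algebra $\mathfrak{sl}(2)_s$ is the direct sum of Lie algebras $\mathfrak{sl}(2)\oplus kc_0$ ($c_0$ central) with $p$-map $(x,\alpha c_0)^{[p]}=(x^{[p]},\psi(x)^pc_0)$. Put $\mathfrak e_e=ke\oplus kc_0$ and $\mathfrak e_f=kf\oplus kc_0$; these are two-dimensional abelian subalgebras on which $[p]=0$. $U_0(\mathfrak g)=U(\mathfrak g)/(\{x^p-x^{[p]} : x\in\mathfrak g\})$ is the restricted enveloping algebra of a restricted Lie algebra $\mathfrak g$. Let $\mathfrak b_s=k(h+c_0)\oplus ke$ and $\mathfrak b_s^-=k(h+c_0)\oplus kf$ ($p$-subalgebras). For $i\in\{0,\dots,p-1\}$ set $Z(i)=U_0(\mathfrak{sl}(2)_s)\otimes_{U_0(\mathfrak b_s)}k_i$ and $Z'(i)=U_0(\mathfrak{sl}(2)_s)\otimes_{U_0(\mathfrak b_s^-)}k_i$, where $k_i$ is the one-dimensional module on which $h+c_0$ acts via $i$ (and $e$, respectively $f$, acts by $0$); also $Z'(p):=Z'(0)$.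 $\mathrm{Rad}$ and $\mathrm{Soc}$ denote the radical and the socle of a $U_0(\mathfrak{sl}(2)_s)$-module, and $M|_{\mathfrak e}$ the restriction of $M$ to $U_0(\mathfrak e)$. Let $\mathfrak e$ be a two-dimensional abelian restricted Lie algebra with $[p]=0$ and $N$ a finite-dimensional $U_0(\mathfrak e)$-module; write $x_N$ for the action of $x\in\mathfrak e$ on $N$. $N$ has constant $j$-rank ($1\le j\le p-1$) if $\mathrm{rk}(x_N^j)$ has the same value $\mathrm{rk}^j(N)$ for all $x\in\mathfrak e\setminus\{0\}$. In that case $\deg^j(N)$ is the degree of the morphism $\mathbb P(\mathfrak e)\to\mathbb P(\bigwedge^{\mathrm{rk}^j(N)}(N))$ obtained by composing $\mathbb P(\mathfrak e)\to\mathrm{Gr}_{\mathrm{rk}^j(N)}(N)$, $[x]\mapsto\mathrm{im}\,x_N^j$, with the Plücker embedding; here the degree of a morphism $\mathbb P(\mathfrak e)\to\mathbb P^m$, $x\mapsto(f_0(x):\cdots:f_m(x))$, given by homogeneous polynomial functions $f_0,\dots,f_m$ on $\mathfrak e$ of common degree $d$ with $\gcd(f_0,\dots,f_m)=1$, is $d$.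
   Formalization: Part (2) is stated for the restriction to e_e instead of e_f; as printed it is false for every i, j: Z'(i+2)/Soc(Z'(i+2)) is isomorphic to Rad(Z(i)), so by (1) its j-degree over e_f is j(p(p-j)/2-i-1), e.g. 2 rather than 3 for p=3, i=0, j=1. *)

(* Defs.v *)
From HB Require Import structures.
From mathcomp Require Import all_boot all_order all_algebra.
From mathcomp Require Import boolp finmap ring.
From mathcomp.multinomials Require Import monalg.

Set Implicit Arguments.
Unset Strict Implicit.
Unset Printing Implicit Defensive.

Import GRing.Theory.
Local Open Scope ring_scope.
Local Open Scope quotient_scope.

Section RingQuotient.
Variables (A : pzRingType) (S : A -> Prop).

Inductive two_sided_span : A -> Prop :=
| tss_in x : S x -> two_sided_span x
| tss_0 : two_sided_span 0
| tss_D x y : two_sided_span x -> two_sided_span y -> two_sided_span (x + y)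
| tss_M a x b : two_sided_span x -> two_sided_span (a * x * b).

Definition ideal_span : {pred A} := fun x => `[< two_sided_span x >].

Lemma ideal_spanP x : reflect (two_sided_span x) (x \in ideal_span).
Proof. exact: asboolP. Qed.

Lemma ideal_span_zmod : zmod_closed ideal_span.
Proof.
split=> [|x y /ideal_spanP hx /ideal_spanP hy]; apply/ideal_spanP.
  exact: tss_0.
apply: tss_D => //; rewrite -mulN1r -[_ * y]mulr1; exact: tss_M.
Qed.

HB.instance Definition _ := GRing.isZmodClosed.Build A ideal_span ideal_span_zmod.

Lemma ideal_spanM a x b : x \in ideal_span -> a * x * b \in ideal_span.
Proof. by move=> /ideal_spanP hx; apply/ideal_spanP/tss_M. Qed.

Definition quot_ring : Type := Quotient.quot ideal_span.
HB.instance Definition _ := Choice.on quot_ring.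
HB.instance Definition _ := GRing.Zmodule.on quot_ring.

Definition quot_pi (x : A) : quot_ring := \pi_(Quotient.quot ideal_span) x.
Definition quot_repr (x : quot_ring) : A := repr (x : Quotient.quot ideal_span).

Lemma quot_reprK : cancel quot_repr quot_pi.
Proof. by move=> x; rewrite /quot_pi reprK. Qed.

Lemma quot_piE x y : (quot_pi x = quot_pi y) <-> x - y \in ideal_span.
Proof.
by rewrite Quotient.idealrBE; split=> [h|/eqP //]; apply/eqP.
Qed.

Lemma quot_piB x y : quot_pi (x - y) = quot_pi x - quot_pi y.
Proof. by rewrite /quot_pi raddfB. Qed.

Lemma quot_piD x y : quot_pi (x + y) = quot_pi x + quot_pi y.
Proof. by rewrite /quot_pi raddfD. Qed.

Definition quot_one : quot_ring := quot_pi 1.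
Definition quot_mul (x y : quot_ring) : quot_ring :=
  quot_pi (quot_repr x * quot_repr y).

Lemma quot_piM x y : quot_pi (x * y) = quot_mul (quot_pi x) (quot_pi y).
Proof.
apply/quot_piE; set x' := quot_repr _; set y' := quot_repr _.
have hx : x - x' \in ideal_span by apply/quot_piE; rewrite quot_reprK.
have hy : y - y' \in ideal_span by apply/quot_piE; rewrite quot_reprK.
have -> : x * y - x' * y' = 1 * (x - x') * y + x' * (y - y') * 1.
  by rewrite mul1r mulr1 mulrBl mulrBr addrA subrK.
by rewrite rpredD // ideal_spanM.
Qed.

Fact quot_mulA : associative quot_mul.
Proof.
move=> x y z; rewrite -[x]quot_reprK -[y]quot_reprK -[z]quot_reprK.
by rewrite -!quot_piM mulrA.
Qed.
Fact quot_mul1 : left_id quot_one quot_mul.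
Proof. by move=> x; rewrite -[x]quot_reprK -quot_piM mul1r. Qed.
Fact quot_mulr1 : right_id quot_one quot_mul.
Proof. by move=> x; rewrite -[x]quot_reprK -quot_piM mulr1. Qed.
Fact quot_mulDl : left_distributive quot_mul +%R.
Proof.
move=> x y z; rewrite -[x]quot_reprK -[y]quot_reprK -[z]quot_reprK.
by rewrite -quot_piD -!quot_piM -quot_piD mulrDl.
Qed.
Fact quot_mulDr : right_distributive quot_mul +%R.
Proof.
move=> x y z; rewrite -[x]quot_reprK -[y]quot_reprK -[z]quot_reprK.
by rewrite -quot_piD -!quot_piM -quot_piD mulrDr.
Qed.

HB.instance Definition _ := GRing.Zmodule_isPzRing.Build quot_ring
  quot_mulA quot_mul1 quot_mulr1 quot_mulDl quot_mulDr.

HB.instance Definition _ :=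
  GRing.isZmodMorphism.Build A quot_ring quot_pi quot_piB.
HB.instance Definition _ :=
  GRing.isMonoidMorphism.Build A quot_ring quot_pi (erefl, quot_piM).

Section Lift.
Variables (B : pzRingType) (h : {rmorphism A -> B}).
Hypothesis hS : forall x, S x -> h x = 0.

Lemma ideal_span_ker x : x \in ideal_span -> h x = 0.
Proof.
move=> /ideal_spanP; elim=> {x} [x /hS //||x y _ hx _ hy|a x b _ hx].
- exact: rmorph0.
- by rewrite rmorphD hx hy addr0.
- by rewrite !rmorphM hx mulr0 mul0r.
Qed.

Definition quot_lift_of (_ : forall x, S x -> h x = 0) (x : quot_ring) : B :=
  h (quot_repr x).
Local Notation quot_lift := (quot_lift_of hS).

Lemma quot_lift_pi x : quot_lift (quot_pi x) = h x.
Proof.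
apply/eqP; rewrite -subr_eq0 -rmorphB; apply/eqP/ideal_span_ker/quot_piE.
exact: quot_reprK.
Qed.

Fact quot_lift_zmod : zmod_morphism quot_lift.
Proof.
move=> x y; rewrite -[x]quot_reprK -[y]quot_reprK -rmorphB.
by rewrite !quot_lift_pi rmorphB.
Qed.
Fact quot_lift_monoid : monoid_morphism quot_lift.
Proof.
split=> [|x y]; first by rewrite -(rmorph1 quot_pi) quot_lift_pi rmorph1.
rewrite -[x]quot_reprK -[y]quot_reprK -rmorphM.
by rewrite !quot_lift_pi rmorphM.
Qed.
HB.instance Definition _ :=
  GRing.isZmodMorphism.Build quot_ring B quot_lift quot_lift_zmod.
HB.instance Definition _ :=
  GRing.isMonoidMorphism.Build quot_ring B quot_lift quot_lift_monoid.
End Lift.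
End RingQuotient.

Section ModuleQuotient.
Variables (R : pzRingType) (M : lmodType R) (N : submodClosed M).

Definition subm_mem : {pred M} := fun x => x \in N.
Fact subm_zmod_closed : zmod_closed subm_mem.
Proof. exact: (GRing.submod_closedB (submodClosedP N)). Qed.
HB.instance Definition _ := GRing.isZmodClosed.Build M subm_mem subm_zmod_closed.

Definition quot_mod : Type := Quotient.quot subm_mem.
HB.instance Definition _ := Choice.on quot_mod.
HB.instance Definition _ := GRing.Zmodule.on quot_mod.

Definition qm_pi (x : M) : quot_mod := \pi_(Quotient.quot subm_mem) x.
Definition qm_repr (x : quot_mod) : M := repr (x : Quotient.quot subm_mem).

Lemma qm_reprK : cancel qm_repr qm_pi.
Proof. by move=> x; rewrite /qm_pi reprK. Qed.

Lemma qm_piE x y : (qm_pi x = qm_pi y) <-> x - y \in N.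
Proof.
rewrite -[x - y \in N]/(x - y \in subm_mem) Quotient.idealrBE.
by split=> [h|/eqP //]; apply/eqP.
Qed.

Lemma qm_piD x y : qm_pi (x + y) = qm_pi x + qm_pi y.
Proof. by rewrite /qm_pi raddfD. Qed.

Definition qm_scale (a : R) (x : quot_mod) : quot_mod := qm_pi (a *: qm_repr x).

Lemma qm_piZ a x : qm_pi (a *: x) = qm_scale a (qm_pi x).
Proof.
apply/qm_piE; rewrite -scalerBr; apply: (rpredZ a); apply/qm_piE.
by rewrite qm_reprK.
Qed.

Fact qm_scaleA a b x : qm_scale a (qm_scale b x) = qm_scale (a * b) x.
Proof. by rewrite -[x]qm_reprK -!qm_piZ scalerA. Qed.
Fact qm_scale1 : left_id 1 qm_scale.
Proof. by move=> x; rewrite -[x]qm_reprK -!qm_piZ scale1r. Qed.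
Fact qm_scaleDr : right_distributive qm_scale +%R.
Proof.
move=> a x y; rewrite -[x]qm_reprK -[y]qm_reprK.
by rewrite -qm_piD -!qm_piZ -qm_piD scalerDr.
Qed.
Fact qm_scaleDl x : {morph qm_scale^~ x : a b / a + b}.
Proof. by move=> a b; rewrite -[x]qm_reprK -!qm_piZ -qm_piD scalerDl. Qed.

HB.instance Definition _ := GRing.Zmodule_isLmodule.Build R quot_mod
  qm_scaleA qm_scale1 qm_scaleDr qm_scaleDl.
End ModuleQuotient.

Definition restr_of (B A : pzRingType) (phi : {rmorphism B -> A})
  (M : lmodType A) : Type := M.

Section Restriction.
Variables (B A : pzRingType) (phi : {rmorphism B -> A}) (M : lmodType A).

Local Notation restr := (restr_of phi M).
HB.instance Definition _ := GRing.Zmodule.on restr.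

Definition restr_scale (b : B) (x : restr) : restr := phi b *: (x : M).

Fact restr_scaleA a b x :
  restr_scale a (restr_scale b x) = restr_scale (a * b) x.
Proof. by rewrite /restr_scale scalerA rmorphM. Qed.
Fact restr_scale1 : left_id 1 restr_scale.
Proof. by move=> x; rewrite /restr_scale rmorph1 scale1r. Qed.
Fact restr_scaleDr : right_distributive restr_scale +%R.
Proof. by move=> a x y; rewrite /restr_scale scalerDr. Qed.
Fact restr_scaleDl x : {morph restr_scale^~ x : a b / a + b}.
Proof. by move=> a b; rewrite /restr_scale rmorphD scalerDl. Qed.

HB.instance Definition _ := GRing.Zmodule_isLmodule.Build B restr
  restr_scaleA restr_scale1 restr_scaleDr restr_scaleDl.

Definition restr_mod : lmodType B := restr.
End Restriction.

(* Finite formal sums of pairs [(a, m)] modulo the congruence generated by    *)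
(* the relations of the tensor product of A and M over B.                     *)
Section Tensor.
Variables (B A : pzRingType) (phi : {rmorphism B -> A}) (M : lmodType B).

Inductive tens_rel : seq (A * M) -> seq (A * M) -> Prop :=
| tens_refl s : tens_rel s s
| tens_sym s t : tens_rel s t -> tens_rel t s
| tens_trans s t u : tens_rel s t -> tens_rel t u -> tens_rel s u
| tens_cat s s' t t' :
    tens_rel s s' -> tens_rel t t' -> tens_rel (s ++ t) (s' ++ t')
| tens_comm s t : tens_rel (s ++ t) (t ++ s)
| tens_0l m : tens_rel [:: (0, m)] [::]
| tens_Dl a a' m : tens_rel [:: (a + a', m)] [:: (a, m); (a', m)]
| tens_Dr a m m' : tens_rel [:: (a, m + m')] [:: (a, m); (a, m')]
| tens_bal a b m : tens_rel [:: (a * phi b, m)] [:: (a, b *: m)].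

Definition tens_eqv : rel (seq (A * M)) := fun s t => `[< tens_rel s t >].

Lemma tens_eqvP s t : reflect (tens_rel s t) (tens_eqv s t).
Proof. exact: asboolP. Qed.

Fact tens_eqv_equiv : equiv_class_of tens_eqv.
Proof.
split=> [s|s t|t s u].
- exact/tens_eqvP/tens_refl.
- by apply/tens_eqvP/tens_eqvP => /tens_sym.
- move=> /tens_eqvP h1 /tens_eqvP h2; apply/tens_eqvP; exact: tens_trans h1 h2.
Qed.
Canonical tens_equiv := EquivRelPack tens_eqv_equiv.

Definition tens : Type := {eq_quot tens_eqv}.
HB.instance Definition _ := Choice.on tens.

Definition tens_pi (s : seq (A * M)) : tens := \pi_({eq_quot tens_eqv}) s.
Definition tens_repr (x : tens) : seq (A * M) :=
  repr (x : {eq_quot tens_eqv}).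

Lemma tens_reprK : cancel tens_repr tens_pi.
Proof. by move=> x; rewrite /tens_pi reprK. Qed.

Lemma tens_piE s t : (tens_pi s = tens_pi t) <-> tens_rel s t.
Proof. by split=> [/eqmodP/tens_eqvP|/tens_eqvP/eqmodP]. Qed.

Definition tens_map (f : A -> A) (s : seq (A * M)) := [seq (f x.1, x.2) | x <- s].

Lemma tens_map_rel f s t : zmod_morphism f ->
    (forall a b, f (a * phi b) = f a * phi b) ->
  tens_rel s t -> tens_rel (tens_map f s) (tens_map f t).
Proof.
move=> fB fM.
have f0 : f 0 = 0 by have := fB 0 0; rewrite !subrr.
have fD a b : f (a + b) = f a + f b.
  by have := fB a (- b); have := fB 0 b; rewrite opprK f0 !sub0r => -> ->; rewrite opprK.
rewrite /tens_map; elim=> {s t} [s|s t _|s t u _ h1 _ h2|s s' t t' _ h1 _ h2|s t|m|a a' m|a m m'|a b m] /=.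
- exact: tens_refl.
- exact: tens_sym.
- exact: tens_trans h1 h2.
- by rewrite !map_cat; apply: tens_cat.
- by rewrite !map_cat; apply: tens_comm.
- by rewrite f0; apply: tens_0l.
- by rewrite fD; apply: tens_Dl.
- exact: tens_Dr.
- by rewrite fM; apply: tens_bal.
Qed.

Definition tens_zero : tens := tens_pi [::].
Definition tens_add (x y : tens) : tens := tens_pi (tens_repr x ++ tens_repr y).
Definition tens_opp (x : tens) : tens := tens_pi (tens_map -%R (tens_repr x)).
Definition tens_scale (a : A) (x : tens) : tens :=
  tens_pi (tens_map ( *%R a) (tens_repr x)).

Lemma tens_rel_repr s : tens_rel (tens_repr (tens_pi s)) s.
Proof. by apply/tens_piE; rewrite tens_reprK. Qed.

Lemma tens_pi_add s t : tens_pi (s ++ t) = tens_add (tens_pi s) (tens_pi t).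
Proof. by apply/tens_piE/tens_sym/tens_cat; apply: tens_rel_repr. Qed.

Lemma tens_pi_opp s : tens_pi (tens_map -%R s) = tens_opp (tens_pi s).
Proof.
apply/tens_piE/tens_sym/tens_map_rel; last exact: tens_rel_repr.
  by move=> a b; rewrite opprB addrC opprK.
by move=> a b; rewrite mulNr.
Qed.

Lemma tens_pi_scale a s :
  tens_pi (tens_map ( *%R a) s) = tens_scale a (tens_pi s).
Proof.
apply/tens_piE/tens_sym/tens_map_rel; last exact: tens_rel_repr.
  by move=> x y; rewrite mulrBr.
by move=> x y; rewrite mulrA.
Qed.

Fact tens_addA : associative tens_add.
Proof.
move=> x y z; rewrite -[x]tens_reprK -[y]tens_reprK -[z]tens_reprK.
by rewrite -!tens_pi_add catA.
Qed.
Fact tens_addC : commutative tens_add.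
Proof.
move=> x y; rewrite -[x]tens_reprK -[y]tens_reprK -!tens_pi_add.
exact/tens_piE/tens_comm.
Qed.
Fact tens_add0 : left_id tens_zero tens_add.
Proof. by move=> x; rewrite -[x]tens_reprK -tens_pi_add. Qed.
Fact tens_addN : left_inverse tens_zero tens_opp tens_add.
Proof.
move=> x; rewrite -[x]tens_reprK; move: (tens_repr x) => {x}.
elim=> [|[a m] s IH]; first by rewrite -tens_pi_opp tens_add0.
rewrite -tens_pi_opp -[(a, m) :: s]/([:: (a, m)] ++ s) /tens_map map_cat.
rewrite [in LHS]tens_pi_add [tens_pi (_ ++ s)]tens_pi_add -tens_addA.
rewrite [tens_add (tens_pi (map _ s)) _]tens_addC -[tens_add (tens_add _ (tens_pi s)) _]tens_addA.
rewrite [tens_add (tens_pi s) _]tens_addC tens_pi_opp IH.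
rewrite [tens_add _ tens_zero]tens_addC tens_add0 -tens_pi_add /=.
apply/tens_piE/(@tens_trans _ [:: (- a + a, m)]).
  exact/tens_sym/tens_Dl.
by rewrite addNr; apply: tens_0l.
Qed.
HB.instance Definition _ :=
  GRing.isZmodule.Build tens tens_addA tens_addC tens_add0 tens_addN.

Lemma tens_piD s t : tens_pi (s ++ t) = tens_pi s + tens_pi t.
Proof. exact: tens_pi_add. Qed.

Fact tens_scaleA a b x : tens_scale a (tens_scale b x) = tens_scale (a * b) x.
Proof.
rewrite -[x]tens_reprK -!tens_pi_scale /tens_map -map_comp; congr tens_pi.
by apply: eq_map => y /=; rewrite mulrA.
Qed.
Fact tens_scale1 : left_id 1 tens_scale.
Proof.
move=> x; rewrite -[x]tens_reprK -tens_pi_scale; congr tens_pi.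
by rewrite -[RHS]map_id; apply: eq_map => -[y m] /=; rewrite mul1r.
Qed.
Fact tens_scaleDr : right_distributive tens_scale +%R.
Proof.
move=> a x y; rewrite -[x]tens_reprK -[y]tens_reprK.
by rewrite -tens_piD -!tens_pi_scale -tens_piD /tens_map map_cat.
Qed.
Fact tens_scaleDl x : {morph tens_scale^~ x : a b / a + b}.
Proof.
move=> a b; rewrite -[x]tens_reprK; move: (tens_repr x) => {x} s.
rewrite -!tens_pi_scale; elim: s => [|[c m] s IH]; first by rewrite -tens_piD.
rewrite /tens_map /= -![_ :: [seq _ | _ <- s]]cat1s !tens_piD IH addrACA.
congr (_ + _); rewrite -tens_piD mulrDl; exact/tens_piE/tens_Dl.
Qed.
HB.instance Definition _ := GRing.Zmodule_isLmodule.Build A tens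
  tens_scaleA tens_scale1 tens_scaleDr tens_scaleDl.
End Tensor.

Section RadSoc.
Variables (R : pzRingType) (M : lmodType R).
Implicit Types N : {pred M}.

Definition proper_submod N := submod_closed N /\ exists x, x \notin N.

Definition maximal_submod N :=
  proper_submod N /\
  forall N', proper_submod N' -> {subset N <= N'} -> {subset N' <= N}.

Definition simple_submod N :=
  [/\ submod_closed N, exists2 x, x \in N & x != 0 &
      forall N', submod_closed N' -> {subset N' <= N} ->
        (forall x, x \in N' -> x = 0) \/ {subset N <= N'}].

Definition Rad : {pred M} :=
  fun x => `[< forall N, maximal_submod N -> x \in N >].

Definition Soc : {pred M} :=
  fun x => `[< exists2 s : seq M, x = \sum_(y <- s) y &
    forall y, y \in s -> exists2 N, simple_submod N & y \in N >].

Fact Rad_submod : submod_closed Rad.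
Proof.
split=> [|a x y /asboolP hx /asboolP hy]; apply/asboolP => N hN.
  by case: hN => -[[]].
by case: (hN) => -[[_ hlin] _] _; apply: hlin; [apply: hx | apply: hy].
Qed.
HB.instance Definition _ := GRing.isSubmodClosed.Build R M Rad Rad_submod.

Fact Soc_submod : submod_closed Soc.
Proof.
split=> [|a x y /asboolP [s -> hs] /asboolP [t -> ht]]; apply/asboolP.
  by exists [::]; rewrite ?big_nil.
exists ([seq a *: z | z <- s] ++ t).
  by rewrite big_cat big_map scaler_sumr.
move=> z; rewrite mem_cat => /orP[/mapP[u us ->]|/ht //].
have [N hN uN] := hs u us; exists N => //.
by case: hN => -[N0 Nlin] _ _; rewrite -[_ *: _]addr0; apply: Nlin.
Qed.
HB.instance Definition _ := GRing.isSubmodClosed.Build R M Soc Soc_submod.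

Definition rad_mod : Type := {x : M | x \in Rad}.
HB.instance Definition _ := SubChoice.on rad_mod.
HB.instance Definition _ := [SubChoice_isSubLmodule of rad_mod by <:].

Definition soc_quot := quot_mod Soc.
HB.instance Definition _ := GRing.Lmodule.on soc_quot.
End RadSoc.

(* The data of a finite-dimensional restricted Lie algebra over k, with       *)
(* [pmap x] standing for x^[p]; the restricted enveloping algebra below only  *)
(* refers to this data, so that the axioms are not recorded.                  *)
Record pLie (k : fieldType) (p : nat) := PLie {
  pl_car :> vectType k;
  br : pl_car -> pl_car -> pl_car;
  pmap : pl_car -> pl_car
}.

(* U(g) is the free algebra on the set g modulo linearity and                 *)
(* xy - yx = [x, y]; U_0(g) is U(g) modulo x^p = x^[p].                        *)
Section RestrictedEnveloping.
Variables (k : fieldType) (p : nat) (g : pLie k p).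

Local Notation free := {malg k[{fmonom g}]}.

Definition free_gen (x : g) : free := << fmu x >>.

Inductive Urel : free -> Prop :=
| Urel_lin a x y :
    Urel (free_gen (a *: x + y) - (a *: free_gen x + free_gen y))
| Urel_br x y :
    Urel (free_gen x * free_gen y - free_gen y * free_gen x
          - free_gen (br x y)).

Definition Ug := quot_ring Urel.
HB.instance Definition _ := GRing.PzRing.on Ug.

Definition Ug_gen (x : g) : Ug := quot_pi Urel (free_gen x).

Inductive U0rel : Ug -> Prop :=
| U0rel_p x : U0rel (Ug_gen x ^+ p - Ug_gen (pmap x)).

Definition U0 := quot_ring U0rel.
HB.instance Definition _ := GRing.PzRing.on U0.

Definition U0_proj : free -> U0 := quot_pi U0rel \o quot_pi Urel.
HB.instance Definition _ := GRing.RMorphism.on U0_proj.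

Definition iota (x : g) : U0 := U0_proj (free_gen x).
Definition scal : k -> U0 := U0_proj \o @malgC {fmonom g} k.
HB.instance Definition _ := GRing.RMorphism.on scal.

Lemma U0_proj_rel x : Urel x -> U0_proj x = 0.
Proof.
move=> hx; rewrite /U0_proj /=.
suff -> : quot_pi Urel x = 0 by rewrite rmorph0.
rewrite -(rmorph0 (quot_pi Urel)); apply/quot_piE; rewrite subr0.
exact/ideal_spanP/tss_in.
Qed.

Lemma iota_lin a x y : iota (a *: x + y) = scal a * iota x + iota y.
Proof.
apply/eqP; rewrite -subr_eq0 /iota /scal /= -rmorphM -rmorphD -rmorphB /=.
by rewrite mul_malgC; apply/eqP/U0_proj_rel/Urel_lin.
Qed.

Lemma iota_br x y : iota (br x y) = iota x * iota y - iota y * iota x.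
Proof.
apply/esym/eqP; rewrite -subr_eq0 /iota -!rmorphM -!rmorphB /=.
exact/eqP/U0_proj_rel/Urel_br.
Qed.

Lemma iota_pmap x : iota (pmap x) = iota x ^+ p.
Proof.
rewrite -[iota _]/(quot_pi U0rel (Ug_gen (pmap x))).
rewrite -[iota x]/(quot_pi U0rel (Ug_gen x)) -rmorphXn.
exact/esym/quot_piE/ideal_spanP/tss_in/U0rel_p.
Qed.

Lemma free_comm (a : k) (x : free) : a%:MP * x = x * a%:MP.
Proof.
rewrite [x]monalgE mulr_sumr mulr_suml; apply: eq_bigr => m _.
rewrite !malgM_def !fgmulUU mul1m mulm1.
by rewrite mulrC.
Qed.

Lemma scal_comm a (u : U0) : scal a * u = u * scal a.
Proof.
rewrite -[u]quot_reprK -[quot_repr u]quot_reprK /scal /=.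
rewrite -[quot_pi U0rel _]/(U0_proj _) -[RHS]rmorphM -[LHS]rmorphM.
by rewrite free_comm.
Qed.

Section Lift.
Variables (A : pzRingType) (s : {rmorphism k -> A}) (f : g -> A).
Hypothesis s_comm : forall a x, s a * f x = f x * s a.
Hypothesis f_lin : forall a x y, f (a *: x + y) = s a * f x + f y.
Hypothesis f_br : forall x y, f (br x y) = f x * f y - f y * f x.
Hypothesis f_pmap : forall x, f (pmap x) = f x ^+ p.

Definition word_eval (m : {fmonom g}) : A := \prod_(x <- fmonom_val m) f x.
Definition free_eval_of (_ : forall a x, s a * f x = f x * s a) (u : free) : A :=
  \sum_(m <- msupp u) s u@_m * word_eval m.
Local Notation free_eval := (free_eval_of s_comm).

Lemma free_evalEw (d : {fset {fmonom g}}) u : (msupp u `<=` d)%fset ->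
  free_eval u = \sum_(m <- d) s u@_m * word_eval m.
Proof.
move=> le; rewrite [LHS](big_fset_incl _ le) => //= x xd /mcoeff_outdom ->.
by rewrite rmorph0 mul0r.
Qed.

Lemma free_evalU c m : free_eval << c *g m >> = s c * word_eval m.
Proof. by rewrite (free_evalEw msuppU_le) big_seq_fset1 mcoeffUU. Qed.

Lemma word_evalM (m m' : {fmonom g}) : word_eval (mmul m m') = word_eval m * word_eval m'.
Proof. by rewrite /word_eval fmM big_cat. Qed.

Lemma s_comm_word a m : s a * word_eval m = word_eval m * s a.
Proof.
rewrite /word_eval; elim: (fmonom_val m) => [|x l IH].
  by rewrite big_nil mulr1 mul1r.
by rewrite big_cons mulrA s_comm -mulrA IH mulrA.
Qed.

Fact free_eval_zmod : zmod_morphism free_eval.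
Proof.
move=> u v; pose d := (msupp u `|` msupp v)%fset.
rewrite (@free_evalEw d u) ?fsubsetUl // (@free_evalEw d v) ?fsubsetUr //.
rewrite (@free_evalEw d) ?msuppB_le // -sumrB; apply: eq_bigr => m _.
by rewrite mcoeffB rmorphB mulrBl.
Qed.
HB.instance Definition _ :=
  GRing.isZmodMorphism.Build free A free_eval free_eval_zmod.

Fact free_eval_monoid : monoid_morphism free_eval.
Proof.
split=> [|u v].
  by rewrite -[1]/(<< 1 *g _ >>) free_evalU rmorph1 mul1r /word_eval fm1 big_nil.
rewrite malgME raddf_sum mulr_suml /=; apply: eq_bigr => m _.
rewrite raddf_sum mulr_sumr /=; apply: eq_bigr => m' _.
rewrite free_evalU rmorphM word_evalM -!mulrA; congr (_ * _).
by rewrite mulrA s_comm_word mulrA.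
Qed.
HB.instance Definition _ :=
  GRing.isMonoidMorphism.Build free A free_eval free_eval_monoid.

Lemma free_eval_gen x : free_eval (free_gen x) = f x.
Proof. by rewrite free_evalU rmorph1 mul1r /word_eval fmU big_seq1. Qed.

Lemma free_evalC a : free_eval a%:MP = s a.
Proof. by rewrite /malgC free_evalU /word_eval fm1 big_nil mulr1. Qed.

Lemma free_eval_scale a u : free_eval (a *: u) = s a * free_eval u.
Proof.
by rewrite -mul_malgC rmorphM /= free_evalC.
Qed.

Lemma free_eval_Urel x : Urel x -> free_eval x = 0.
Proof.
case=> [a y z|y z].
  rewrite rmorphB rmorphD /= free_eval_scale !free_eval_gen f_lin.
  by rewrite subrr.
by rewrite !rmorphB !rmorphM /= !free_eval_gen f_br subrr.
Qed.

Definition Ug_eval : {rmorphism Ug -> A} := quot_lift_of free_eval_Urel.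

Lemma Ug_eval_U0rel x : U0rel x -> Ug_eval x = 0.
Proof.
have genE y : Ug_eval (Ug_gen y) = f y.
  by apply: etrans (quot_lift_pi _ _) _; apply: free_eval_gen.
by case=> y; rewrite rmorphB rmorphXn !genE f_pmap subrr.
Qed.

Definition U0_lift : {rmorphism U0 -> A} := quot_lift_of Ug_eval_U0rel.

Lemma U0_lift_iota x : U0_lift (iota x) = f x.
Proof.
apply: etrans (quot_lift_pi _ _) _; apply: etrans (quot_lift_pi _ _) _.
exact: free_eval_gen.
Qed.

Lemma U0_lift_scal a : U0_lift (scal a) = s a.
Proof.
apply: etrans (quot_lift_pi _ _) _; apply: etrans (quot_lift_pi _ _) _.
exact: free_evalC.
Qed.
End Lift.
End RestrictedEnveloping.

Arguments iota {k p g} x.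
Arguments scal {k p} g a.

Section Subalgebra.
Variables (k : fieldType) (p : nat) (g : pLie k p) (V : {vspace g}).

Definition psubalgebra :=
  (forall x y, x \in V -> y \in V -> br x y \in V) /\
  (forall x, x \in V -> pmap x \in V).

(* [vsproj V] is the identity on V, so for a p-subalgebra V these are the     *)
(* restrictions to V of the operations of g.                                  *)
Definition sub_pLie : pLie k p :=
  PLie p (fun x y : subvs_of V => vsproj V (br (vsval x) (vsval y)))
         (fun x : subvs_of V => vsproj V (pmap (vsval x))).

Hypothesis hV : psubalgebra.

Definition sub_iota (x : sub_pLie) : U0 g := iota (vsval x).

Fact sub_iota_comm a x : scal g a * sub_iota x = sub_iota x * scal g a.
Proof. exact: scal_comm. Qed.
Fact sub_iota_lin a x y :
  sub_iota (a *: x + y) = scal g a * sub_iota x + sub_iota y.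
Proof. by rewrite /sub_iota linearP iota_lin. Qed.
Fact sub_iota_br x y :
  sub_iota (br x y) = sub_iota x * sub_iota y - sub_iota y * sub_iota x.
Proof. by rewrite /sub_iota vsprojK ?iota_br // hV.1 ?subvsP. Qed.
Fact sub_iota_pmap x : sub_iota (pmap x) = sub_iota x ^+ p.
Proof. by rewrite /sub_iota vsprojK ?iota_pmap // hV.2 ?subvsP. Qed.

Definition U0_incl : {rmorphism U0 sub_pLie -> U0 g} :=
  U0_lift sub_iota_comm sub_iota_lin sub_iota_br sub_iota_pmap.
End Subalgebra.

Section Sl2.
Variables (k : fieldType) (p : nat).

Definition gl2 : pLie k p :=
  @PLie k p 'M[k]_2 (fun A B => A *m B - B *m A) (fun A => A ^+ p).

Definition traceless : {vspace gl2} :=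
  lker (linfun (@mxtrace k 2 : 'M[k]_2 -> k^o)).

Lemma tracelessP (A : gl2) : (A \in traceless) = (\tr (A : 'M[k]_2) == 0).
Proof. by rewrite memv_ker lfunE. Qed.

(* For p odd this is a p-subalgebra of gl2, see [traceless_psub]. *)
Definition sl2 : pLie k p := sub_pLie traceless.

Definition mxe : 'M[k]_2 := delta_mx 0 1.
Definition mxh : 'M[k]_2 := delta_mx 0 0 - delta_mx 1 1.
Definition mxf : 'M[k]_2 := delta_mx 1 0.

Definition sl2_of (A : 'M[k]_2) : sl2 := vsproj traceless (A : gl2).
Definition mx_of (x : sl2) : 'M[k]_2 := vsval x.

Definition psi (x : sl2) : k := mx_of x 0 0.

(* [(x, a)] stands for x + a c_0. *)
Definition sl2s : pLie k p :=
  @PLie k p (sl2 * k^o)%type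
    (fun x y => (br x.1 y.1, 0)) (fun x => (pmap x.1, psi x.1 ^+ p)).

Definition sl2s_of (A : 'M[k]_2) : sl2s := (sl2_of A, 0).
Definition elt_e : sl2s := sl2s_of mxe.
Definition elt_h : sl2s := sl2s_of mxh.
Definition elt_f : sl2s := sl2s_of mxf.
Definition elt_c0 : sl2s := (0, 1).

Definition e_e : {vspace sl2s} := <<[:: elt_e; elt_c0]>>%VS.
Definition e_f : {vspace sl2s} := <<[:: elt_f; elt_c0]>>%VS.
Definition b_s : {vspace sl2s} := <<[:: (elt_h + elt_c0)%R; elt_e]>>%VS.
Definition b_sm : {vspace sl2s} := <<[:: (elt_h + elt_c0)%R; elt_f]>>%VS.

Lemma ord2P (P : 'I_2 -> Prop) : P 0 -> P 1 -> forall i, P i.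
Proof.
move=> h0 h1 [[|[|//]] hi].
- by have -> : Ordinal hi = 0 by apply: val_inj.
- by have -> : Ordinal hi = 1 by apply: val_inj.
Qed.

Lemma mx2P (A B : 'M[k]_2) : A 0 0 = B 0 0 -> A 0 1 = B 0 1 ->
  A 1 0 = B 1 0 -> A 1 1 = B 1 1 -> A = B.
Proof.
by move=> h1 h2 h3 h4; apply/matrixP; do 2![apply: ord2P].
Qed.

Lemma mul2E (A B : 'M[k]_2) i j : (A *m B) i j = A i 0 * B 0 j + A i 1 * B 1 j.
Proof.
rewrite mxE big_ord_recl big_ord1; congr (_ + A i _ * B _ j); exact: val_inj.
Qed.

Lemma tr2E (A : 'M[k]_2) : \tr A = A 0 0 + A 1 1.
Proof.
rewrite /mxtrace big_ord_recl big_ord1; congr (_ + A _ _); exact: val_inj.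
Qed.

Lemma tr_mxe : \tr mxe = 0. Proof. by rewrite tr2E !mxE /= addr0. Qed.
Lemma tr_mxf : \tr mxf = 0. Proof. by rewrite tr2E !mxE /= addr0. Qed.
Lemma tr_mxh : \tr mxh = 0.
Proof. by rewrite tr2E !mxE /= subr0 sub0r subrr. Qed.

Lemma sl2_ofK A : \tr A = 0 -> mx_of (sl2_of A) = A.
Proof. by move=> hA; apply: vsprojK; rewrite tracelessP hA. Qed.

Lemma tr_mx_of x : \tr (mx_of x) = 0.
Proof. by apply/eqP; rewrite -tracelessP subvsP. Qed.

Lemma mx_of_lin a x y : mx_of (a *: x + y) = a *: mx_of x + mx_of y.
Proof. exact: (linearP (vsval (U := traceless))). Qed.

Lemma mx_of_inj : injective mx_of.
Proof. exact: val_inj. Qed.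

Lemma psi_e : psi (sl2_of mxe) = 0.
Proof. by rewrite /psi sl2_ofK ?tr_mxe // mxE. Qed.
Lemma psi_f : psi (sl2_of mxf) = 0.
Proof. by rewrite /psi sl2_ofK ?tr_mxf // mxE. Qed.
Lemma psi_h : psi (sl2_of mxh) = 1.
Proof. by rewrite /psi sl2_ofK ?tr_mxh // !mxE /= subr0. Qed.

Hypotheses (p_odd : odd p) (p3 : (2 < p)%N).

Lemma traceless_exp (A : 'M[k]_2) : \tr A = 0 ->
  A ^+ p = (A 0 0 ^+ 2 + A 0 1 * A 1 0) ^+ p./2 *: A.
Proof.
move=> hA; have h11 : A 1 1 = - A 0 0.
  by apply/eqP; rewrite -addr_eq0 addrC -tr2E hA.
set c := _ + _.
have sq : A *m A = c%:M.
  apply: mx2P; rewrite mul2E mxE ?h11 ?eqxx ?mulr1n /= ?mulr0n.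
  - by rewrite /c expr2.
  - by rewrite mulrN mulrC addrN.
  - by rewrite mulNr mulrC addrN.
  - by rewrite /c mulrNN expr2 addrC [A 1 0 * _]mulrC.
rewrite -{1}(odd_double_half p) p_odd add1n exprSr -mul2n exprM expr2.
by rewrite -[A * A]/(A *m A) sq -rmorphXn -[_ * A]/(_ *m A) mul_scalar_mx.
Qed.

Lemma traceless_psub : psubalgebra traceless.
Proof.
split=> [A B|A]; rewrite !tracelessP.
  by rewrite /= raddfB /= mxtrace_mulC subrr.
by move=> /eqP hA; rewrite /= traceless_exp // mxtraceZ hA mulr0.
Qed.

Lemma mx_of_br x y :
  mx_of (br x y) = mx_of x *m mx_of y - mx_of y *m mx_of x.
Proof.
by apply: vsprojK; apply: traceless_psub.1; apply: subvsP.
Qed.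

Lemma mx_of_pmap x : mx_of (pmap x) = mx_of x ^+ p.
Proof. by apply: vsprojK; apply: traceless_psub.2; apply: subvsP. Qed.

Lemma sl2_pmapE (x : sl2) :
  pmap x = (mx_of x 0 0 ^+ 2 + mx_of x 0 1 * mx_of x 1 0) ^+ p./2 *: x.
Proof.
by apply: mx_of_inj; rewrite mx_of_pmap traceless_exp ?tr_mx_of.
Qed.

Lemma span2P (u v x : sl2s) : x \in <<[:: u; v]>>%VS ->
  exists a b, x = a *: u + b *: v.
Proof.
rewrite span_cons span_seq1 => /memv_addP[y /vlineP[a ->] [z /vlineP[b ->] ->]].
by exists a, b.
Qed.

Lemma span2_mem (u v : sl2s) a b : a *: u + b *: v \in <<[:: u; v]>>%VS.
Proof. by rewrite rpredD // rpredZ // memv_span // !inE eqxx ?orbT. Qed.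

Lemma sl2_ofZD (a b : k) A B : \tr A = 0 -> \tr B = 0 ->
  mx_of (a *: sl2_of A + b *: sl2_of B) = a *: A + b *: B.
Proof.
move=> hA hB; rewrite mx_of_lin sl2_ofK //; congr (_ + _).
by rewrite -[_ *: sl2_of B]addr0 mx_of_lin sl2_ofK // [mx_of 0]linear0 addr0.
Qed.

Lemma sl2_ofZ (a : k) A : \tr A = 0 -> mx_of (a *: sl2_of A) = a *: A.
Proof.
by move=> hA; rewrite -[a *: _]addr0 mx_of_lin sl2_ofK // [mx_of 0]linear0 addr0.
Qed.

Lemma sl2s_eq (x y : sl2s) : mx_of x.1 = mx_of y.1 -> x.2 = y.2 -> x = y.
Proof. by case: x y => [x a] [y b] /= /mx_of_inj -> ->. Qed.

Lemma nil_c0E (A : 'M[k]_2) a b : \tr A = 0 ->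
  a *: sl2s_of A + b *: elt_c0 = (a *: sl2_of A, b).
Proof.
move=> hA; apply: sl2s_eq => /=.
  by rewrite scaler0 addr0.
by rewrite scaler0 add0r; apply: mulr1.
Qed.

Lemma nil_c0_psub (A : 'M[k]_2) : \tr A = 0 -> A 0 0 = 0 -> A 0 1 * A 1 0 = 0 ->
  psubalgebra <<[:: sl2s_of A; elt_c0]>>%VS.
Proof.
move=> hA h00 h01; split=> [x y|x] /span2P[a [b ->]] => [/span2P[a' [b' ->]]|].
  rewrite !nil_c0E // -[br _ _]/(br (a *: sl2_of A) (a' *: sl2_of A), 0).
  rewrite [br _ _](_ : _ = 0) ?mem0v //; apply: mx_of_inj.
  rewrite mx_of_br !sl2_ofZ // -!scalemxAl -!scalemxAr !scalerA mulrC subrr.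
  exact/esym/linear0.
rewrite nil_c0E // -[pmap _]/(pmap (a *: sl2_of A), psi (a *: sl2_of A) ^+ p).
rewrite sl2_pmapE /psi !sl2_ofZ // !mxE h00 mulr0 mulrACA h01 mulr0 !expr0n /=.
have hp : (0 < p)%N by case: (p) p_odd.
have hp2 : (0 < p./2)%N by rewrite half_gt0 ltnW.
by rewrite addr0 expr0n [p == 0]eqn0Ngt hp [_ == 0]eqn0Ngt hp2 scale0r mem0v.
Qed.

Lemma e_e_psub : psubalgebra e_e.
Proof.
by apply: nil_c0_psub; rewrite ?tr_mxe // !mxE //= mulr0.
Qed.

Lemma e_f_psub : psubalgebra e_f.
Proof.
by apply: nil_c0_psub; rewrite ?tr_mxf // !mxE //= mul0r.
Qed.

Lemma borelE (A : 'M[k]_2) a b :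
  a *: (elt_h + elt_c0) + b *: sl2s_of A = (a *: sl2_of mxh + b *: sl2_of A, a).
Proof.
apply: sl2s_eq => /=; first by rewrite addr0.
by rewrite scaler0 addr0 add0r; apply: mulr1.
Qed.

Lemma psi_borel (A : 'M[k]_2) a b : \tr A = 0 -> A 0 0 = 0 ->
  psi (a *: sl2_of mxh + b *: sl2_of A) = a.
Proof.
move=> hA h00; rewrite /psi sl2_ofZD ?tr_mxh // !mxE h00 /=.
by rewrite subr0 mulr0 addr0 mulr1.
Qed.

Lemma borel_psub (A : 'M[k]_2) c : \tr A = 0 -> A 0 0 = 0 ->
    A 0 1 * A 1 0 = 0 -> mxh *m A - A *m mxh = c *: A ->
  psubalgebra <<[:: (elt_h + elt_c0)%R; sl2s_of A]>>%VS.
Proof.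
move=> hA h00 h01 hc; split=> [x y|x] /span2P[a [b ->]] => [/span2P[a' [b' ->]]|].
  rewrite !borelE -[br _ _]/(br (a *: sl2_of mxh + b *: sl2_of A)
    (a' *: sl2_of mxh + b' *: sl2_of A), 0).
  suff -> : br (a *: sl2_of mxh + b *: sl2_of A)
    (a' *: sl2_of mxh + b' *: sl2_of A)
    = 0 *: sl2_of mxh + (c * (a * b' - a' * b)) *: sl2_of A.
    by rewrite -borelE span2_mem.
  apply: mx_of_inj; rewrite mx_of_br !sl2_ofZD ?tr_mxh // scale0r add0r.
  rewrite mulrC -scalerA -hc; move: mxh => H.
  rewrite !mulmxDl !mulmxDr -!scalemxAl -!scalemxAr !scalerA scalerBr !scalerBl.
  rewrite [a' * a]mulrC [b' * b]mulrC [b' * a]mulrC [b * a']mulrC.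
  move: ((a * a') *: _) ((b * b') *: _) => P Q.
  move: ((a * b') *: (H *m A)) ((a' * b) *: (A *m H)) => T1 T2.
  move: ((a * b') *: _) ((a' * b) *: _) => T3 T4.
  rewrite !opprD !opprK. 
  rewrite [LHS](AC ((2*2)*(2*2)) (((1*5)*(4*8))*((2*6)*(3*7)))) /= !subrr !add0r.
  by rewrite [T2 - T3]addrC.
rewrite borelE -[pmap _]/(pmap (a *: sl2_of mxh + b *: sl2_of A),
  psi (a *: sl2_of mxh + b *: sl2_of A) ^+ p).
rewrite psi_borel // sl2_pmapE !sl2_ofZD ?tr_mxh // !mxE h00 /=.
rewrite subr0 mulr1 !mulr0 !mulr0n !subr0 !mulr0 !add0r !addr0.
rewrite mulrACA h01 mulr0 addr0.
have -> : a ^+ p = (a ^+ 2) ^+ p./2 * a.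
  by rewrite -{1}(odd_double_half p) p_odd add1n exprSr -mul2n exprM.
rewrite scalerDr !scalerA -borelE; exact: span2_mem.
Qed.

Lemma b_s_psub : psubalgebra b_s.
Proof.
apply: (@borel_psub _ 2%:R); rewrite ?tr_mxe // ?mxE //= ?mulr0 //.
by apply: mx2P; rewrite !mxE !big_ord_recl !big_ord0 !mxE /=; ring.
Qed.

Lemma b_sm_psub : psubalgebra b_sm.
Proof.
apply: (@borel_psub _ (- 2%:R)); rewrite ?tr_mxf // ?mxE //= ?mul0r //.
by apply: mx2P; rewrite !mxE !big_ord_recl !big_ord0 !mxE /=; ring.
Qed.

Lemma b_s_psi x : x \in b_s -> psi x.1 = x.2.
Proof.
by move=> /span2P[a [b ->]]; rewrite borelE psi_borel ?tr_mxe // mxE.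
Qed.

Lemma b_sm_psi x : x \in b_sm -> psi x.1 = x.2.
Proof.
by move=> /span2P[a [b ->]]; rewrite borelE psi_borel ?tr_mxf // mxE.
Qed.
End Sl2.

(* The one-dimensional module on which h + c_0 acts via i and e (or f) by 0:  *)
(* on [b_s] and [b_sm] the c_0-component of an element is also its coordinate *)
(* along h + c_0.                                                             *)
Section OneDim.
Variables (k : fieldType) (p : nat) (V : {vspace sl2s k p}).
Hypotheses (hp : p \in [pchar k]) (hV : psubalgebra V).
Hypothesis psiV : forall x : sl2s k p, x \in V -> psi x.1 = x.2.
Variable i : nat.

Definition weight (x : sub_pLie V) : k := i%:R * (vsval x).2.

Fact weight_comm a x : a * weight x = weight x * a.
Proof. exact: mulrC. Qed.
Fact weight_lin a x y : weight (a *: x + y) = a * weight x + weight y.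
Proof.
rewrite /weight linearP mulrDr; congr (_ + _); exact: mulrCA.
Qed.
Fact weight_br x y : weight (br x y) = weight x * weight y - weight y * weight x.
Proof.
by rewrite /weight vsprojK ?hV.1 ?subvsP //= mulr0 [X in X - _]mulrC subrr.
Qed.
Fact weight_pmap x : weight (pmap x) = weight x ^+ p.
Proof.
rewrite /weight vsprojK ?hV.2 ?subvsP //= psiV ?subvsP // exprMn.
by rewrite -(pFrobenius_autE hp i%:R) pFrobenius_aut_nat.
Qed.

Definition weight_hom : {rmorphism U0 (sub_pLie V) -> k} :=
  @U0_lift k p (sub_pLie V) k idfun weight
    weight_comm weight_lin weight_br weight_pmap.

Definition one_dim : lmodType (U0 (sub_pLie V)) := restr_mod weight_hom k^o.
End OneDim.

Lemma pchar_odd (k : fieldType) p : p \in [pchar k] -> (3 <= p)%N -> odd p.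
Proof.
by move=> /pcharf_prime /even_prime[->|].
Qed.

Section VermaModules.
Variables (k : fieldType) (p : nat).
Hypotheses (hp : p \in [pchar k]) (p3 : (3 <= p)%N).

Let p_odd := pchar_odd hp p3.

Definition Z (i : nat) : lmodType (U0 (sl2s k p)) :=
  tens (U0_incl (b_s_psub k p_odd))
       (one_dim hp (b_s_psub k p_odd) (@b_s_psi k p) i).

(* The weight is read in k, so that [Z' p] is [Z' 0]. *)
Definition Z' (i : nat) : lmodType (U0 (sl2s k p)) :=
  tens (U0_incl (b_sm_psub k p_odd))
       (one_dim hp (b_sm_psub k p_odd) (@b_sm_psi k p) i).

(* The vector f^(p-1) (x) 1 of [Z i] has weight i + 2, is killed by f and      *)
(* generates [Rad (Z i)], which is thereby isomorphic to                      *)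
(* [soc_quot (Z' (i + 2))]. Accordingly both have j-degree j p (p - j) / 2    *)
(* over [e_e], and j (p (p - j) / 2 - i - 1) over [e_f].                       *)
Definition res_e (M : lmodType (U0 (sl2s k p))) :
  lmodType (U0 (sub_pLie (e_e k p))) := restr_mod (U0_incl (e_e_psub k p_odd p3)) M.

Definition res_f (M : lmodType (U0 (sl2s k p))) :
  lmodType (U0 (sub_pLie (e_f k p))) := restr_mod (U0_incl (e_f_psub k p_odd p3)) M.
End VermaModules.

From mathcomp.multinomials Require Import mpoly.

Section JRank.
Variables (k : fieldType) (p : nat) (g : pLie k p) (N : lmodType (U0 g)).
Implicit Types (x : g) (v : N).

Definition lincomb n (b : 'I_n -> N) (a : 'rV[k]_n) : N :=
  \sum_i scal g (a 0 i) *: b i.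

Definition kbasis (P : N -> Prop) n (b : 'I_n -> N) :=
  [/\ forall i, P (b i),
      forall v, P v -> exists a, v = lincomb b a &
      forall a, lincomb b a = 0 -> a = 0].

Definition im_pow (x : g) (j : nat) (v : N) := exists w, v = iota x ^+ j *: w.

Definition has_rank (x : g) (j r : nat) :=
  exists b : 'I_r -> N, kbasis (im_pow x j) b.

Definition constant_jrank_eq (j r : nat) := forall x, x != 0 -> has_rank x j r.

Definition constant_jrank (j : nat) := exists r, constant_jrank_eq j r.

Definition increasing r n (T : r.-tuple 'I_n) :=
  sorted ltn [seq val i | i <- T].

(* The Pluecker coordinate, indexed by the columns T, of the row space of W. *)
Definition minor r n (W : 'M[k]_(r, n)) (T : r.-tuple 'I_n) : k :=
  \det (\matrix_(a < r, c < r) W a (tnth T c)).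

(* Polynomial functions on g are polynomials in the coordinates with respect *)
(* to a basis of g; the coordinates on the r-th exterior power of N are       *)
(* indexed by the increasing r-tuples of basis vectors b of N.                *)
Definition jdegree (j d : nat) :=
  exists r n (b : 'I_n -> N) (F : r.-tuple 'I_n -> mpoly.mpoly (\dim {:g}) k),
  [/\ constant_jrank_eq j r,
      kbasis (fun=> True) b,
      forall T, increasing T -> F T \is d.-homog,
      forall D, (forall T, increasing T -> exists Q, F T = D * Q) ->
        exists2 c : k, c != 0 & D = c%:MP &
      forall x, x != 0 ->
        exists2 W : 'M[k]_(r, n),
          kbasis (im_pow x j) (fun a => lincomb b (row a W)) &
          exists2 c : k, c != 0 &
            forall T, increasing T ->
              (F T).@[fun i => coord (vbasis {:g}) i x] = c * minor W T].
End JRank.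

(* Main.v *)
(* For v the generator, Z(i) has the basis f^a c_0^b v with 0 <= a, b < p;
   linear independence follows from an explicit module on which f^(p-1)
   c_0^(p-1) v does not vanish. Rad Z(i) is spanned by the monomials with a > i
   or b > 0, and Soc Z(i) by those with a > i and b = p - 1. Exchanging e and f
   and changing the signs of h and c_0 turns Z'(i + 2) into Z(p - 2 - i).

   On each of the three modules the two generators of the elementary subalgebra
   act as shifts of a basis indexed by a subset S of the p x p square; for
   Rad Z(i) over e_e this basis is e^a c_0^b f^(p-1) v. So the j-th power of
   x X + y Y has a matrix whose entries, and by homogeneity also whose minors,
   are monomials in x and y. The binomial coefficients 'C(p, n), 0 < n < p,
   vanish in k; through Vandermonde's identity this expresses the rows that
   would be shifted out of the square by the others, so that the rank is
   r = p (p - j) - (i + 1) at every point. For y != 0 (x != 0) the r rows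
   K_c (K_f) whose shift by j in b (in a) stays in S form a basis of the image.
   The minors over K_c, divided by their common monomial factor, contain
   nonzero multiples of x^d and y^d, hence are coprime, and d equals j r plus
   the sum of b over K_c minus the sum of b over K_f. *)

From HB Require Import structures.
Require Import Defs.
From mathcomp Require Import all_boot all_order all_algebra ring zify.
From mathcomp Require Import boolp perm.
From mathcomp.multinomials Require monalg.
From mathcomp.multinomials Require Import mpoly.

Set Implicit Arguments.
Unset Strict Implicit.
Unset Printing Implicit Defensive.

Import GRing.Theory.
Local Open Scope ring_scope.

(** * Powers in associative algebras containing sl(2) *)

(** Mapping $U_0(\mathfrak{sl}(2)_s)$ to matrices requires x^p to equal the image of x^[p] for every
    x, not only for basis elements. For x = a h + b e + g f and p = 2m + 1 this is the identity x^p
    = (a^2 + b g)^m x + a^p c. It follows by adding one root vector at a time with a polynomial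
    parameter: Q^p - d^m Q, where d is the value of the quadratic form a^2 + b g at Q, has zero
    derivative and degree at most p, so only its constant term and its p-th coefficient remain. The
    model is a highest weight module over k[c]/(c^p) on which h has the eigenvalues i - 2n - c;
    their p-th powers are i - 2n, which is the relation h^p = h + c. All that depends on i comes
    from e f^a v = a (i + 1 - a - c_0) f^(a-1) v: for 0 < a < p the scalar part vanishes exactly at
    a = i + 1. This one gap gives the shapes of the radical, of the socle and of the basis generated
    from f^(p-1) v by e. *)

Definition ad (A : pzRingType) (x y : A) : A := x * y - y * x.

Section Ad.
Variable A : pzRingType.
Implicit Types x y z : A.

Definition central z := forall x, z * x = x * z.

Lemma ad_linDr x y z : ad x (y + z) = ad x y + ad x z.
Proof. by rewrite /ad mulrDr mulrDl opprD addrACA. Qed.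

Lemma ad_linNr x y : ad x (- y) = - ad x y.
Proof. by rewrite /ad mulrN mulNr opprB opprK addrC. Qed.

Lemma ad_anti x y : ad x y = - ad y x.
Proof. by rewrite /ad opprB. Qed.

Lemma ad_linDl x y z : ad (y + z) x = ad y x + ad z x.
Proof. by rewrite ad_anti ad_linDr opprD -!(ad_anti _ x). Qed.

Lemma adxx x : ad x x = 0.
Proof. exact: subrr. Qed.

Lemma ad_Mr c x y : central c -> ad x (c * y) = c * ad x y.
Proof. by move=> cC; rewrite /ad mulrBr !mulrA -cC. Qed.

Lemma ad_Ml c x y : central c -> ad (c * x) y = c * ad x y.
Proof. by move=> cC; rewrite ad_anti ad_Mr // -mulrN -ad_anti. Qed.

Lemma centralM c d : central c -> central d -> central (c * d).
Proof. by move=> cC dC x; rewrite -mulrA dC mulrA cC mulrA. Qed.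

Lemma centralX c n : central c -> central (c ^+ n).
Proof.
move=> cC; elim: n => [|n IH]; first by move=> x; rewrite mul1r mulr1.
by rewrite exprS; apply: centralM.
Qed.

Lemma central_nat n : central n%:R.
Proof. by move=> x; rewrite -[_ * x]commr_nat. Qed.

Lemma centralD c d : central c -> central d -> central (c + d).
Proof. by move=> cC dC x; rewrite mulrDl mulrDr cC dC. Qed.

Lemma ad_central x y : central x -> ad x y = 0.
Proof. by move=> xC; rewrite /ad xC subrr. Qed.
End Ad.

(* Moving Q to the right past ad(Q)^m(Q') gives the binomial coefficients. *)
Lemma deriv_exp_ad (A : nzRingType) (Q : {poly A}) n :
  (Q ^+ n)^`() = \sum_(m < n) iter m (ad Q) Q^`() * Q ^+ (n - m.+1) *+ 'C(n, m.+1).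
Proof.
elim: n => [|n IH]; first by rewrite big_ord0 derivC.
set y := Q^`() in IH *.
rewrite exprS derivM IH -/y mulr_sumr.
under eq_bigr => m _.
  have -> : Q * (iter m (ad Q) y * Q ^+ (n - m.+1) *+ 'C(n, m.+1)) =
     iter m (ad Q) y * Q ^+ (n - m) *+ 'C(n, m.+1) +
     iter m.+1 (ad Q) y * Q ^+ (n - m.+1) *+ 'C(n, m.+1).
    rewrite mulrnAr mulrA -mulrnDl; congr (_ *+ _).
    have -> : Q * iter m (ad Q) y = iter m (ad Q) y * Q + iter m.+1 (ad Q) y.
      by rewrite iterS {3}/ad addrCA subrr addr0.
    by rewrite mulrDl -(mulrA _ Q) -exprS subnSK.
  over.
rewrite big_split /= addrA.
have -> : \sum_(i < n) iter i (ad Q) y * Q ^+ (n - i) *+ 'C(n, i.+1)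
   = \sum_(i < n.+1) iter i (ad Q) y * Q ^+ (n - i) *+ 'C(n, i.+1).
  by rewrite big_ord_recr /= bin_small // mulr0n addr0.
rewrite -[X in _ = X]/(\sum_(m < n.+1) iter m (ad Q) y * Q ^+ (n - m) *+ _).
under [RHS]eq_bigr do rewrite binS mulrnDr.
rewrite big_split /= addrAC addrC; congr (_ + _).
by rewrite big_ord_recl /= subn0 bin0.
Qed.

(** Jacobson's formula: the binomial coefficients 'C(p, m + 1) with m + 1 < p vanish, which leaves
    the summand with the highest power of ad Q. *)
Lemma deriv_expp_ad (A : nzRingType) p (hp : p \in [pchar A]) (Q : {poly A}) :
  (Q ^+ p)^`() = iter p.-1 (ad Q) Q^`().
Proof.
case: p hp => [/pcharf_prime //|q] hp.
rewrite deriv_exp_ad big_ord_recr big1 /= => [|m _]; last first.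
  rewrite -mulr_natr -(rmorph_nat polyC) (bin_lt_pcharf_0 hp) ?polyC0 ?mulr0 //.
  by rewrite /= ltnS ltn_ord.
by rewrite subnn mulr1 binn add0r.
Qed.

Section PowerDerivative.
Variables (A : nzRingType) (p m : nat).
Hypotheses (hp : p \in [pchar A]) (pE : p = m.*2.+1) (m0 : (0 < m)%N).

(** The inverse of 2 is m + 1, since 2 (m + 1) = p + 1. *)
Lemma half_natr (x : A) : 2%:R * x = 0 -> x = 0.
Proof.
move=> h; have : m.+1%:R * (2%:R * x) = 0 by rewrite h mulr0.
by rewrite mulrA -natrM muln2 doubleS -addn1 -pE natrD (pcharf0 hp) add0r mul1r.
Qed.

Lemma expr4_half : 4%:R ^+ m = 1 :> A.
Proof.
apply/eqP; rewrite -subr_eq0; apply/eqP/half_natr.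
rewrite mulrBr mulr1 -natrX (_ : (4 ^ m)%N = (2 ^ m.*2)%N); last first.
  by rewrite -mul2n expnM.
rewrite -natrM -expnS -pE natrX; apply/eqP; rewrite subr_eq0; apply/eqP.
by rewrite -[LHS](pFrobenius_autE hp) pFrobenius_aut_nat.
Qed.

(** Twice the left side is 4^m + 2 m = 1 + (p - 1). This cancels the t-terms in [jacobson_deriv]. *)
Lemma expr4_pred : (2 * 4 ^ m.-1 + m)%:R = 0 :> A.
Proof.
apply: half_natr; rewrite -natrM mulnDr mulnA -expnS prednK // natrD natrX.
by rewrite expr4_half mul2n -(natrD _ 1%N) add1n -pE (pcharf0 hp).
Qed.

(** The last hypothesis holds for Q in sl(2) with polynomial coefficients, d its quadratic form and
    t the derivative of d. Since ad Q kills Q, each further pair of ad Q only multiplies by 4 d, so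
    ad(Q)^(p-1) Q' = 4^(m-1) d^(m-1) (4 d Q' - 2 t Q). Its first term is d^m Q'; the second,
    together with the term - m d^(m-1) t Q coming from d^m, vanishes by [expr4_pred]. *)
Lemma jacobson_deriv (Q d t : {poly A}) : central d -> central t ->
    d^`() = t ->
    ad Q (ad Q Q^`()) = 4%:R * (d * Q^`()) - 2%:R * (t * Q) ->
  (Q ^+ p - d ^+ m * Q)^`() = 0.
Proof.
set y := Q^`(); move=> dC tC dt hadd.
have iterE l : iter l.*2.+2 (ad Q) y =
   4%:R ^+ l * d ^+ l * (4%:R * (d * y) - 2%:R * (t * Q)).
  elim: l => [|l IH]; first by rewrite !mul1r /= hadd.
  rewrite doubleS [LHS]iterS [X in ad Q X]iterS IH.
  have cc : central (4%:R ^+ l * d ^+ l : {poly A}).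
    by apply: centralM; apply: centralX => //; apply: central_nat.
  rewrite !ad_Mr //.
  have h : ad Q (ad Q (4%:R * (d * y) - 2%:R * (t * Q))) =
     4%:R * d * (4%:R * (d * y) - 2%:R * (t * Q)).
    have -> : ad Q (4%:R * (d * y) - 2%:R * (t * Q)) = 4%:R * (d * ad Q y).
      rewrite ad_linDr ad_linNr !ad_Mr ?adxx ?mulr0 ?subr0 //; exact: central_nat.
    by rewrite !ad_Mr ?hadd ?mulrA //; exact: central_nat.
  move: (4%:R * (d * y) - _) h => z ->.
  rewrite mulrA; congr (_ * _); rewrite !exprSr !mulrA; congr (_ * _).
  by rewrite -!mulrA; congr (_ * _); rewrite central_nat.
have dX n : (d ^+ n.+1)^`() = n.+1%:R * (d ^+ n * t).
  elim: n => [|n IH]; first by rewrite !mul1r.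
  rewrite exprSr derivM IH dt -!mulrA tC (mulrA _ d) -exprSr.
  by rewrite [n.+2%:R]mulrSr mulrDl mul1r.
rewrite derivB derivM (deriv_expp_ad hp) -/y.
have [n mE] : exists n, m = n.+1 by exists m.-1; rewrite prednK.
have e4 : 4%:R ^+ n.+1 = 1 :> {poly A}.
  by rewrite -(rmorph_nat polyC) -rmorphXn /= -mE expr4_half.
have -> : p.-1 = n.*2.+2 by rewrite pE mE.
rewrite iterE mE dX mulrBr.
have -> : 4%:R ^+ n * d ^+ n * (4%:R * (d * y)) = d ^+ n.+1 * y.
  rewrite -mulrA (mulrA (d ^+ n)) -(central_nat 4) !mulrA -exprSr e4 mul1r.
  by rewrite -exprSr.
rewrite (addrC _ (d ^+ _ * y)) opprD addrACA subrr add0r -opprD.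
apply/eqP; rewrite oppr_eq0; apply/eqP.
have -> : 4%:R ^+ n * d ^+ n * (2%:R * (t * Q)) = (4 ^ n * 2)%:R * (d ^+ n * t * Q).
  by rewrite natrM natrX -!mulrA; congr (_ * _); rewrite !mulrA (central_nat 2).
rewrite -(mulrA n.+1%:R) -mulrDl -natrD mulnC.
by have := expr4_pred; rewrite mE /= -(rmorph_nat polyC) => ->; rewrite mul0r.
Qed.
End PowerDerivative.

Section PowerFormula.
Variables (A : nzRingType) (p m : nat).
Hypotheses (hp : p \in [pchar A]) (pE : p = m.*2.+1) (m0 : (0 < m)%N).

Lemma coef_exp_linear (x y : A) n :
  ((x%:P + y%:P * 'X) ^+ n)`_n = y ^+ n /\
  forall i, (n < i)%N -> ((x%:P + y%:P * 'X) ^+ n)`_i = 0.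
Proof.
elim: n => [|n [IH1 IH2]].
  by split=> [|[|i]] //; rewrite !expr0 coef1.
rewrite exprSr mulrDr mulrA; split=> [|[|i] ni //].
  by rewrite coefD coefMC coefMX coefMC /= IH1 IH2 // mul0r add0r exprSr.
by rewrite coefD coefMC coefMX coefMC /= !IH2 ?(ltnW ni) // !mul0r addr0.
Qed.

(** As d is linear in the parameter, d^m Q has degree at most m + 1 < p, and G below has degree at
    most p. Its derivative is zero, hence G = G(0) + y^p X^p, and the claim is the value at X =
    1. *)
Lemma jacobson_step (d0 d1 x y : A) : central d0 -> central d1 ->
    let Q := x%:P + y%:P * 'X in
    let d := d0%:P + d1%:P * 'X in
    ad Q (ad Q y%:P) = 4%:R * (d * y%:P) - 2%:R * (d1%:P * Q) ->
  (x + y) ^+ p - (d0 + d1) ^+ m * (x + y) = x ^+ p - d0 ^+ m * x + y ^+ p.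
Proof.
move=> d0C d1C Q d hadd.
have cP (c : A) : central c -> central c%:P.
  move=> cC q; apply/polyP=> i; rewrite coefCM coefMC; exact: cC.
have cX (c : A) : central c -> central (c%:P * 'X).
  move=> /cP cC; apply: centralM => // q; exact/esym/commr_polyX.
have dC : central d by apply: centralD; [apply: cP | apply: cX].
have Q' : Q^`() = y%:P.
  by rewrite derivD derivC add0r derivM derivC mul0r add0r derivX mulr1.
have d' : d^`() = d1%:P.
  by rewrite derivD derivC add0r derivM derivC mul0r add0r derivX mulr1.
have := @jacobson_deriv A p m hp pE m0 Q d d1%:P dC (cP _ d1C) d'.
rewrite Q' => /(_ hadd); set G := _ - _ => G'.
have G0 : G.[0] = x ^+ p - d0 ^+ m * x.
  have c0 q : comm_poly q (0 : A) by rewrite /comm_poly mulr0 mul0r.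
  rewrite hornerD hornerN horner_exp_comm // hornerM_comm // horner_exp_comm //.
  by rewrite !hornerD !hornerM_comm // !hornerX !hornerC !mulr0 !addr0.
have G1 : G.[1] = (x + y) ^+ p - (d0 + d1) ^+ m * (x + y).
  have c1 q : comm_poly q (1 : A) by rewrite /comm_poly mulr1 mul1r.
  rewrite hornerD hornerN horner_exp_comm // hornerM_comm // horner_exp_comm //.
  by rewrite !hornerD !hornerM_comm // !hornerX !hornerC !mulr1.
have dQ i : (m.+1 < i)%N -> (d ^+ m * Q)`_i = 0.
  case: i => // i im; rewrite mulrDr mulrA coefD coefMC coefMX coefMC /=.
  have [_ dm] := coef_exp_linear d0 d1 m.
  by rewrite !dm ?mul0r ?addr0 // ltnW.
have mp : (m.+1 < p)%N by rewrite pE ltnS -addnn -addn1 leq_add2l.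
have [Qp Qi] := coef_exp_linear x y p.
have Gp : G`_p = y ^+ p by rewrite coefB Qp dQ // subr0.
have p_pr := pcharf_prime hp; have p0 := prime_gt0 p_pr.
have Gi i : (0 < i < p)%N -> G`_i = 0.
  case: i => // i /= ip; have := congr1 (fun q : {poly A} => q`_i) G'.
  rewrite coef_deriv coef0 => Gi0.
  (* The coefficient is killed by p and by i + 1, hence by their gcd, which is 1. *)
  have [a _ /dvdnP[b E]] := Bezoutl i.+1 p0.
  have cop : gcdn p i.+1 = 1%N.
    by apply/eqP; rewrite -/(coprime _ _) prime_coprime // gtnNdvd.
  have : G`_i.+1 *+ (gcdn p i.+1 + a * i.+1) = 0.
    by rewrite E -mulr_natr natrM (pcharf0 hp) !mulr0.
  by rewrite cop mulrnDr mulnC mulrnA Gi0 mul0rn addr0.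
have sG : (size G <= p.+1)%N.
  by apply/leq_sizeP => i pi; rewrite coefB Qi // dQ ?subr0 // (ltn_trans mp).
rewrite -G1 (horner_coef_wide _ sG) big_ord_recr /= expr1n mulr1 Gp; congr (_ + _).
rewrite -G0 horner_coef0 -(big_mkord xpredT (fun i => G`_i * 1 ^+ i)) big_ltn //.
rewrite big_nat big1 ?mulr1 ?addr0 // => i /Gi ->; exact: mul0r.
Qed.

Lemma ad_linear_poly (x y z : A) :
  ad (x%:P + y%:P * 'X) z%:P = (ad x z)%:P + (ad y z)%:P * 'X.
Proof.
have cX : 'X * z%:P = z%:P * 'X by exact/esym/commr_polyX.
by rewrite ad_linDl /ad !polyCB !polyCM mulrBl -!mulrA cX.
Qed.

Lemma central_expMl (a x : A) n : central a -> (a * x) ^+ n = a ^+ n * x ^+ n.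
Proof. by move=> aC; apply: exprMn_comm; apply: aC. Qed.

Section Sl2Power.
Variables (e f h c a b g : A).
Hypotheses (aC : central a) (bC : central b) (gC : central g).
Hypotheses (he : ad h e = 2%:R * e) (hf : ad h f = - (2%:R * f)) (ef : ad e f = h).
Hypotheses (e0 : e ^+ p = 0) (f0 : f ^+ p = 0) (h0 : h ^+ p = h + c).

(** The form a^2 + b g is linear in b and in g separately, so the root vectors can be added one at a
    time: b e leaves the form at a^2, and g f then raises it to a^2 + b g. The start is (a h)^p =
    a^p (h + c). *)
Lemma sl2_power : (a * h + b * e + g * f) ^+ p =
  (a ^+ 2 + b * g) ^+ m * (a * h + b * e + g * f) + a ^+ p * c.
Proof.
have c2 := @central_nat A 2; have a2C : central (a ^+ 2) by exact: centralX.
have bgC : central (b * g) by exact: centralM.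
have m2 (x y : A) : x * (2%:R * y) = 2%:R * (x * y) by rewrite mulrA -c2 mulrA.
have m4 (x : A) : 2%:R * (2%:R * x) = 4%:R * x by rewrite mulrA -natrM.
have n2 : 2%:R = 2%:R%:P :> {poly A} by rewrite -(rmorph_nat polyC).
have n4 : 4%:R = 4%:R%:P :> {poly A} by rewrite -(rmorph_nat polyC).
have s1 := @jacobson_step (a ^+ 2) 0 (a * h) (b * e) a2C.
have s2 := @jacobson_step (a ^+ 2) (b * g) (a * h + b * e) (g * f) a2C bgC.
have {}s1 : (a * h + b * e) ^+ p - (a ^+ 2) ^+ m * (a * h + b * e) = a ^+ p * c.
  rewrite -[in (a ^+ 2) ^+ m](addr0 (a ^+ 2)) s1.
  - rewrite (central_expMl h p aC) (central_expMl e p bC) e0 h0 mulr0 addr0.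
    rewrite mulrA -exprM mul2n -exprSr -pE.
    by rewrite mulrDr addrAC subrr add0r.
  - by move=> x; rewrite mul0r mulr0.
  have xy : ad (a * h) (b * e) = 2%:R * (a * (b * e)).
    by rewrite ad_Ml // ad_Mr // he !m2.
  rewrite ad_linear_poly xy adxx mul0r addr0 ad_linear_poly.
  rewrite !(ad_Mr _ _ aC, ad_Mr _ _ c2) xy adxx !mulr0 !mul0r !mulr0 subr0 !addr0.
  by rewrite n4 -!polyCM expr2 -mulrA m2 m4.
have xy : ad (a * h + b * e) (g * f) = - (2%:R * (a * (g * f))) + b * g * h.
  by rewrite ad_linDl !ad_Ml // !ad_Mr // hf ef !mulrN !m2 (mulrA b).
have yh : ad (g * f) h = 2%:R * (g * f).
  by rewrite ad_Ml // ad_anti hf opprK m2.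
have xh : ad (a * h + b * e) h = - (2%:R * (b * e)).
  by rewrite ad_linDl !ad_Ml // adxx mulr0 add0r ad_anti he mulrN m2.
apply/eqP; rewrite [X in _ == X]addrC -subr_eq; apply/eqP; rewrite s2.
  by rewrite s1 (central_expMl f p gC) f0 mulr0 addr0.
rewrite ad_linear_poly xy adxx mul0r addr0 ad_linear_poly.
have cX (z : A) : 'X * z%:P = z%:P * 'X by exact/esym/commr_polyX.
have n42 (z : A) : 4%:R * z - 2%:R * z = 2%:R * z.
  by rewrite -mulrBl -natrB.
have dy (u v w : A) : (u%:P + v%:P * 'X) * w%:P = (u * w)%:P + (v * w)%:P * 'X.
  by rewrite mulrDl -mulrA cX mulrA !polyCM.
have dz (u v w : A) : w%:P * (u%:P + v%:P * 'X) = (w * u)%:P + (w * v)%:P * 'X.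
  by rewrite mulrDr mulrA !polyCM.
rewrite n4 n2 dy !dz opprD addrACA -mulrBl -!polyCB n42; congr (_%:P + _%:P * _); last first.
  by rewrite ad_linDr ad_linNr !(ad_Mr _ _ c2, ad_Mr _ _ aC, ad_Mr _ _ bgC)
     adxx yh !mulr0 oppr0 add0r m2.
rewrite ad_linDr ad_linNr !(ad_Mr _ _ c2, ad_Mr _ _ aC, ad_Mr _ _ bgC) xy xh.
rewrite mulrN m2 !mulrDr !mulrN !m2 m4 opprD opprK (mulrA a a) -expr2 -addrA; congr (_ + _).
rewrite opprD !mulrA; congr (- (_ * _) - _).
by rewrite -!mulrA; congr (_ * _); rewrite !mulrA -(aC _) !mulrA.
Qed.
End Sl2Power.
End PowerFormula.

(** * Representations of $U_0(\mathfrak{sl}(2)_s)$ from four operators *)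

Section Sl2sRepresentation.
Variables (k : fieldType) (p : nat) (A : nzRingType) (s : {rmorphism k -> A}).
Hypotheses (hp : p \in [pchar k]) (p3 : (3 <= p)%N).
Hypothesis sC : forall a, central (s a).
Variables e f h c : A.
Hypotheses (he : ad h e = 2%:R * e) (hf : ad h f = - (2%:R * f)) (ef : ad e f = h).
Hypotheses (e0 : e ^+ p = 0) (f0 : f ^+ p = 0) (c0 : c ^+ p = 0).
Hypotheses (h0 : h ^+ p = h + c).
Hypotheses (ce : ad c e = 0) (cf : ad c f = 0) (ch : ad c h = 0).

Let a_ (x : sl2s k p) := s (mx_of x.1 0 0).
Let b_ (x : sl2s k p) := s (mx_of x.1 0 1).
Let g_ (x : sl2s k p) := s (mx_of x.1 1 0).
Let d_ (x : sl2s k p) := s (x.2 : k).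

Definition sl2s_rep (x : sl2s k p) : A := a_ x * h + b_ x * e + g_ x * f + d_ x * c.

Lemma sl2s_rep_comm a x : s a * sl2s_rep x = sl2s_rep x * s a.
Proof. by rewrite sC. Qed.

Lemma sl2s_rep_lin a x y : sl2s_rep (a *: x + y) = s a * sl2s_rep x + sl2s_rep y.
Proof.
rewrite /sl2s_rep /a_ /b_ /g_ /d_ -![(a *: x + y).1]/(a *: x.1 + y.1) mx_of_lin !mxE.
rewrite -[(a *: x + y).2]/(a * (x.2 : k) + y.2) !rmorphD !rmorphM !mulrDl !mulrDr !mulrA.
by rewrite (addrACA _ _ (s a * _ * e)) (addrACA _ _ (s a * _ * f)) (addrACA _ _ (s a * _ * c)).
Qed.

Let mx11 (x : sl2 k p) : mx_of x 1 1 = - mx_of x 0 0.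
Proof. by apply/eqP; rewrite -addr_eq0 addrC -tr2E; apply/eqP/tr_mx_of. Qed.

Lemma sl2s_rep_br x y :
  sl2s_rep (br x y) = sl2s_rep x * sl2s_rep y - sl2s_rep y * sl2s_rep x.
Proof.
have p_odd := pchar_odd hp p3; have p_gt2 : (2 < p)%N by [].
rewrite /sl2s_rep /a_ /b_ /g_ /d_ -![(br x y).1]/(br x.1 y.1) -[(br x y).2]/(0 : k).
have brE (X Y : 'M[k]_2) i j : (X *m Y - Y *m X) i j =
    X i 0 * Y 0 j + X i 1 * Y 1 j - (Y i 0 * X 0 j + Y i 1 * X 1 j).
  by rewrite mxE [X in _ + X]mxE !mul2E.
rewrite mx_of_br // rmorph0 mul0r addr0 !brE !mx11.
move: (mx_of x.1 0 0) (mx_of x.1 0 1) (mx_of x.1 1 0) (x.2 : k) => xa xb xg xd.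
move: (mx_of y.1 0 0) (mx_of y.1 0 1) (mx_of y.1 1 0) (y.2 : k) => ya yb yg yd.
rewrite -[RHS]/(ad _ _) !ad_linDl !ad_linDr.
rewrite !(ad_Mr _ _ (@sC _), ad_Ml _ _ (@sC _)).
rewrite !adxx he hf ef ce cf ch !(ad_anti _ c) !(ad_anti e h) !(ad_anti f h) (ad_anti f e).
rewrite he hf ef ce cf ch !mulr0 !oppr0 !mulr0 !addr0 !add0r.
have sM a b z : s a * (s b * z) = s (a * b) * z by rewrite mulrA -rmorphM.
have sN a z : s a * - z = s (- a) * z by rewrite mulrN rmorphN mulNr.
have s2 a z : s a * (2%:R * z) = s (a * 2%:R) * z.
  by rewrite mulrA rmorphM rmorph_nat.
rewrite !opprK !(sN, s2) !sM.
rewrite [RHS](AC ((1*1)*(1*1)*(1*1)) ((4*6)*(1*3)*(2*5))) /= -!mulrDl -!rmorphD.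
by congr (s _ * _ + s _ * _ + s _ * _); ring.
Qed.

(** The c-part commutes with the rest and has p-th power 0; the term a^p c of [sl2_power] is the
    component psi(x)^p c_0 of the p-map. *)
Lemma sl2s_rep_pmap x : sl2s_rep (Defs.pmap x) = sl2s_rep x ^+ p.
Proof.
have p_odd := pchar_odd hp p3; have p_gt2 : (2 < p)%N by [].
have hpA : p \in [pchar A] by apply: (rmorph_pchar s).
have pE : p = (p./2).*2.+1 by rewrite -[LHS](odd_double_half p) p_odd.
have m0 : (0 < p./2)%N by rewrite half_gt0 ltnW.
have cx : GRing.comm (a_ x * h + b_ x * e + g_ x * f) (d_ x * c).
  apply/eqP; rewrite -subr_eq0 -[X in X == 0]/(ad _ _) !ad_linDl.
  rewrite !(ad_Mr _ _ (@sC _), ad_Ml _ _ (@sC _)) (ad_anti h c) (ad_anti e c).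
  by rewrite (ad_anti f c) ch ce cf oppr0 !mulr0 !addr0.
rewrite -(pFrobenius_autE hpA) pFrobenius_autD_comm // !pFrobenius_autE.
rewrite (central_expMl c p (@sC _)) c0 mulr0 addr0.
rewrite (sl2_power hpA pE m0 (@sC _) (@sC _) (@sC _) he hf ef e0 f0 h0).
rewrite /sl2s_rep /a_ /b_ /g_ /d_ -[(Defs.pmap x).1]/(Defs.pmap x.1) -[(Defs.pmap x).2]/(psi x.1 ^+ p).
have mxZ a (y : sl2 k p) : mx_of (a *: y) = a *: mx_of y.
  by rewrite -[a *: y]addr0 mx_of_lin [mx_of 0]linear0 addr0.
rewrite sl2_pmapE // mxZ !mxE !rmorphM !rmorphXn rmorphD rmorphXn rmorphM.
by rewrite !mulrDr !mulrA.
Qed.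

Definition U0_rep : {rmorphism U0 (sl2s k p) -> A} :=
  U0_lift sl2s_rep_comm sl2s_rep_lin sl2s_rep_br sl2s_rep_pmap.

End Sl2sRepresentation.

(** * A highest weight module over k[c]/(c^p) *)

Section MatrixModel.
Variables (R : comNzRingType) (q : nat) (c : R) (i : nat).
Local Notation p := q.+1.
Hypotheses (hp : p \in [pchar R]) (p3 : (3 <= p)%N) (cp : c ^+ p = 0).
Local Notation A := 'M[R]_p.

Definition mod_f : A := \matrix_(r, s) (r == s.+1 :> nat)%:R.
Definition mod_e : A :=
  \matrix_(r, s) ((s == r.+1 :> nat)%:R * (s%:R * (i%:R + 1 - s%:R - c))).
Definition mod_h : A :=
  \matrix_(r, s) ((s == r :> nat)%:R * (i%:R - s%:R *+ 2 - c)).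
(** Vectors are kept inside the matrix ring, as matrices supported in the first column, so that
    applying an operator to a vector is a product in one ring. For n > q the matrix is 0, which
    truncates the module. *)
Definition mod_v n : A := \matrix_(r, s) ((r == n :> nat) && (s == 0%N :> nat))%:R.

Lemma mod_v0 n : (q < n)%N -> mod_v n = 0.
Proof.
move=> qn; apply/matrixP=> r s; rewrite !mxE; case: eqP => // rn.
by have := ltn_ord r; rewrite ltnS leqNgt rn qn.
Qed.

Lemma mul_mod_v (M : A) (n : 'I_p) r s :
  (M * mod_v n) r s = M r n * (s == 0%N :> nat)%:R.
Proof.
rewrite -[_ * _]/(_ *m _) mxE (bigD1 n) //= mxE eqxx big1 ?addr0 // => t tn.
by rewrite mxE -[_ == _ :> nat]/(t == n) (negPf tn) mulr0.
Qed.

Lemma mod_ext (M N : A) : (forall n, M * mod_v n = N * mod_v n) -> M = N.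
Proof.
move=> MN; apply/matrixP=> r s; have := congr1 (fun X : A => X r ord0) (MN s).
by rewrite !mul_mod_v eqxx !mulr1.
Qed.

Lemma mod_fE n : mod_f * mod_v n = mod_v n.+1.
Proof.
case: (ltnP n p) => [np|pn]; last by rewrite !mod_v0 ?mulr0 // ltnW.
apply/matrixP=> r s; rewrite (mul_mod_v _ (Ordinal np)) !mxE /=.
by case: eqP => _; case: eqP => _; rewrite ?mul0r ?mul1r.
Qed.

Lemma mod_hE n : mod_h * mod_v n = (i%:R - n%:R *+ 2 - c) *: mod_v n.
Proof.
case: (ltnP n p) => [np|pn]; last by rewrite !mod_v0 ?mulr0 ?scaler0.
apply/matrixP=> r s; rewrite (mul_mod_v _ (Ordinal np)) !mxE /= eq_sym.
by case: eqP => _ /=; case: eqP => _; rewrite ?mulr0 ?mul0r ?mulr1 ?mul1r.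
Qed.

Lemma mod_eE n : mod_e * mod_v n = (n%:R * (i%:R + 1 - n%:R - c)) *: mod_v n.-1.
Proof.
case: (ltnP n p) => [np|pn]; last first.
  rewrite (mod_v0 pn) mulr0; case: (leqP p n.-1) => [/mod_v0 -> | h].
    by rewrite scaler0.
  (* The boundary case: v_p is 0 although v_(p-1) is not, and the coefficient of v_(p-1) contains
     the factor p. *)
  have -> : n = p by apply/eqP; rewrite eqn_leq pn andbT; case: (n) h.
  by rewrite (pcharf0 hp) mul0r scale0r.
apply/matrixP=> r s; rewrite (mul_mod_v _ (Ordinal np)) !mxE /=.
case: n np => [|n] np /=; first by rewrite !mul0r.
by rewrite eqSS eq_sym; case: eqP => _ /=; case: eqP => _; rewrite ?mulr0 ?mul0r ?mulr1 ?mul1r.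
Qed.

Lemma mod_relations :
  [/\ ad mod_h mod_e = 2%:R * mod_e, ad mod_h mod_f = - (2%:R * mod_f)
    & ad mod_e mod_f = mod_h].
Proof.
have S (a : R) (M N : A) : M * (a *: N) = a *: (M * N) by rewrite -scalerAr.
have D (M N L : A) : (M - N) * L = M * L - N * L by rewrite mulrBl.
have two (M : A) : 2%:R * M = 2%:R *: M by rewrite mulr_natl scaler_nat.
split; apply: mod_ext => n; rewrite ?mulNr D -!mulrA !(mod_eE, mod_fE, mod_hE, S,
  two) ?scalerA -?scalerBl ?scalerA -?scaleNr.
- case: n => [|n] /=; first by rewrite !(mul0r, mulr0, scale0r, subrr, scaler0).
  congr (_ *: _); rewrite -natr1; ring.
- congr (_ *: _); rewrite -natr1; ring.
case: n => [|n] /=; first by rewrite mul0r oppr0 scale0r addr0; congr (_ *: _); ring.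
by rewrite -scalerDl; congr (_ *: _); rewrite -!natr1; ring.
Qed.

Lemma mod_f_iter n m : mod_f ^+ n * mod_v m = mod_v (n + m).
Proof. by elim: n => [|n IH]; rewrite ?mul1r // exprS -mulrA IH mod_fE. Qed.

Lemma mod_f_pow : mod_f ^+ p = 0.
Proof. by apply: mod_ext => n; rewrite mod_f_iter mul0r mod_v0 // leq_addr. Qed.

Lemma mod_e_pow : mod_e ^+ p = 0.
Proof.
have E n m : (m < n)%N -> mod_e ^+ n * mod_v m = 0.
  elim: n m => // n IH m mn; rewrite exprSr -mulrA mod_eE -scalerAr.
  case: m mn => [|m] mn; first by rewrite mul0r scale0r.
  by rewrite IH ?scaler0.
apply: mod_ext => n; rewrite mul0r; case: (ltnP n p) => [/E //|pn].
by rewrite mod_v0 ?mulr0.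
Qed.

Lemma mod_h_pow : mod_h ^+ p = mod_h + c%:M.
Proof.
apply: mod_ext => n; have E m : mod_h ^+ m * mod_v n = (i%:R - n%:R *+ 2 - c) ^+ m *: mod_v n.
  elim: m => [|m IH]; first by rewrite mul1r scale1r.
  by rewrite exprSr -mulrA mod_hE -scalerAr IH scalerA -exprS.
rewrite E mulrDl mod_hE -[c%:M * _]/(_ *m _) mul_scalar_mx -scalerDl subrK.
congr (_ *: _); rewrite -(pFrobenius_autE hp) !pFrobenius_autB_comm; try exact: mulrC.
by rewrite -mulrnA !pFrobenius_aut_nat pFrobenius_autE cp subr0.
Qed.

End MatrixModel.

(* Mapping Z(i) to this algebra shows that f^(p-1) c_0^(p-1) does not kill its
   generator, hence that the p^2 monomials f^a c_0^b are independent there. *)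
Lemma highest_weight_model (k : fieldType) (p : nat) (i : nat) :
    p \in [pchar k] -> (3 <= p)%N ->
  exists (A : nzRingType) (s : {rmorphism k -> A}) (e f h c v : A),
  [/\ forall a, central (s a), ad h e = 2%:R * e, ad h f = - (2%:R * f) &
      ad e f = h] /\
  [/\ e ^+ p = 0, f ^+ p = 0, c ^+ p = 0, h ^+ p = h + c & central c] /\
  [/\ e * v = 0, (h + c) * v = s i%:R * v & f ^+ p.-1 * (c ^+ p.-1 * v) <> 0].
Proof.
case: p => [/pcharf_prime //|q] hp p3.
pose P : {poly k} := 'X^(q.+1).
have sP : size (mk_monic P) = q.+2 by rewrite mk_monic_Xn size_polyXn.
pose c : {poly %/ P} := in_qpoly P 'X.
have hpR : q.+1 \in [pchar {poly %/ P}] by rewrite pchar_qpoly.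
have cp : c ^+ q.+1 = 0.
  rewrite /c -rmorphXn; apply: val_inj => /=.
  by rewrite mk_monic_Xn /= Pdiv.RingMonic.rmodpp // monicXn.
have cq : c ^+ q <> 0.
  rewrite /c -rmorphXn => /(congr1 val) /=.
  rewrite Pdiv.CommonRing.rmodp_small ?sP ?size_polyXn // => /eqP.
  by rewrite -size_poly_eq0 size_polyXn.
pose s : {rmorphism k -> 'M[{poly %/ P}]_q.+1} := @scalar_mx _ q.+1 \o in_qpoly P \o polyC.
have [he hf ef] := mod_relations c i hpR.
have cC a : central (a%:M : 'M[{poly %/ P}]_q.+1).
  by move=> x; rewrite -[LHS]/(_ *m _) -[RHS]/(_ *m _) scalar_mxC.
exists 'M[{poly %/ P}]_q.+1, s, (mod_e q c i), (mod_f _ q), (mod_h q c i), c%:M, (mod_v _ q 0).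
split; first by split=> // a; apply: cC.
split; first split.
- exact: mod_e_pow.
- exact: mod_f_pow.
- by rewrite -rmorphXn cp rmorph0.
- exact: mod_h_pow.
- exact: cC.
split.
- by rewrite mod_eE // mul0r scale0r.
- rewrite mulrDl mod_hE // -[c%:M * _]/(_ *m _) mul_scalar_mx -scalerDl.
  by rewrite mul0rn subr0 subrK !rmorph_nat mulr_natl scaler_nat.
rewrite -rmorphXn -[_%:M * _]/(_ *m _) /= mul_scalar_mx -scalerAr mod_f_iter addn0.
move=> /matrixP/(_ ord_max ord0); rewrite !mxE /= !eqxx mulr1; exact: cq.
Qed.

(** * Relations in the restricted enveloping algebra *)

Section U0Induction.
Import monalg.
Variables (k : fieldType) (p : nat) (g : pLie k p).

(** An element is the class of a noncommutative polynomial, that is, of a sum of scalar multiples of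
    words in the generators; the inner induction is on the word. *)
Lemma U0_ind (P : U0 g -> Prop) :
    (forall a, P (scal g a)) -> (forall x, P (Defs.iota x)) ->
    (forall u v, P u -> P v -> P (u + v)) ->
    (forall u v, P u -> P v -> P (u * v)) ->
  forall u, P u.
Proof.
move=> Ps Pi PD PM u.
rewrite -[u]quot_reprK -[quot_repr u]quot_reprK.
move: (quot_repr (quot_repr u)) => {}u; rewrite -[X in P X]/(U0_proj u).
have P0 : P 0 by rewrite -(rmorph0 (scal g)); apply: Ps.
have P1 : P 1 by rewrite -(rmorph1 (scal g)); apply: Ps.
rewrite [u]monalgE raddf_sum; elim/big_rec: _ => // m x _ Px.
apply: (PD); last exact: Px.
move: (mcoeff _ _) => a; rewrite -[_ (mkmalgU m a)]/(U0_proj (mkmalgU m a)).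
have -> : << a *g m >> = malgC a * << m >> :> {malg k[{fmonom g}]}.
  by rewrite malgM_def fgmulUU mul1m mulr1.
rewrite rmorphM; apply: (PM); first exact: Ps.
case: m => l; elim: l => [|y l IH]; first by rewrite -fmoneE rmorph1.
have -> : << FMonom (y :: l) >> = << fmu y >> * << FMonom l >> :> {malg k[{fmonom g}]}.
  rewrite malgM_def fgmulUU mulr1; congr (mkmalgU _ _).
  by apply/eqP; rewrite fmP fmM fmU.
by rewrite rmorphM; apply: (PM); [apply: Pi | apply: IH].
Qed.

Lemma U0_iotaD (x y : g) : Defs.iota (x + y) = Defs.iota x + Defs.iota y.
Proof. by rewrite -{1}[x]scale1r iota_lin rmorph1 mul1r. Qed.

Lemma U0_iota0 : Defs.iota (0 : g) = 0.
Proof. by apply: (addrI (Defs.iota (0 : g))); rewrite -U0_iotaD !addr0. Qed.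

Lemma U0_iotaZ a (x : g) : Defs.iota (a *: x) = scal g a * Defs.iota x.
Proof. by rewrite -[a *: x]addr0 iota_lin U0_iota0 addr0. Qed.

End U0Induction.

Section Sl2sRelations.
Variables (k : fieldType) (p : nat).
Hypotheses (hp : p \in [pchar k]) (p3 : (3 <= p)%N).
Local Notation g := (sl2s k p).
Local Notation s := (scal g).
Local Notation E := (Defs.iota (elt_e k p)).
Local Notation H := (Defs.iota (elt_h k p)).
Local Notation F := (Defs.iota (elt_f k p)).
Local Notation C := (Defs.iota (elt_c0 k p)).

Let p_odd := pchar_odd hp p3.

Lemma sl2s_decomp (x : g) :
  x = (mx_of x.1 0 0 : k) *: elt_h k p + ((mx_of x.1 0 1 : k) *: elt_e k p +
     ((mx_of x.1 1 0 : k) *: elt_f k p + (x.2 : k) *: elt_c0 k p)).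
Proof.
have p_gt2 : (2 < p)%N by [].
apply: sl2s_eq => /=; last by rewrite !scaler0 !add0r; apply/esym/mulr1.
rewrite -[vsval (sl2_of p (mxh k))]/(mx_of _) -[vsval (sl2_of p (mxe k))]/(mx_of _).
rewrite -[vsval (sl2_of p (mxf k))]/(mx_of _) !sl2_ofK ?tr_mxe ?tr_mxh ?tr_mxf //.
rewrite scaler0 addr0.
have h11 : mx_of x.1 1 1 = - mx_of x.1 0 0.
  by apply/eqP; rewrite -addr_eq0 addrC -tr2E; apply/eqP/tr_mx_of.
by apply: mx2P; rewrite !mxE /= ?h11; ring.
Qed.

Lemma iota_sl2s (x : g) : exists a b c d, Defs.iota x = s a * H + (s b * E + (s c * F + s d * C)).
Proof.
exists (mx_of x.1 0 0), (mx_of x.1 0 1), (mx_of x.1 1 0), (x.2 : k).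
by rewrite {1}[x]sl2s_decomp !U0_iotaD !U0_iotaZ.
Qed.

Lemma sl2s_ind (P : U0 g -> Prop) :
    (forall a, P (s a)) -> P E -> P F -> P H -> P C ->
    (forall u v, P u -> P v -> P (u + v)) ->
    (forall u v, P u -> P v -> P (u * v)) ->
  forall u, P u.
Proof.
move=> Ps PE PF PH PC PD PM; apply: (U0_ind Ps _ PD PM) => x.
have [a [b [c [d ->]]]] := iota_sl2s x.
exact: (PD _ _ (PM _ _ (Ps a) PH) (PD _ _ (PM _ _ (Ps b) PE)
  (PD _ _ (PM _ _ (Ps c) PF) (PM _ _ (Ps d) PC)))).
Qed.

Lemma br_sl2s_of A B : \tr A = 0 -> \tr B = 0 ->
  br (sl2s_of p A) (sl2s_of p B) = sl2s_of p (A *m B - B *m A) :> g.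
Proof.
move=> hA hB; have p_gt2 : (2 < p)%N by [].
apply: sl2s_eq => //=; rewrite mx_of_br // !sl2_ofK //.
by rewrite raddfB /= mxtrace_mulC subrr.
Qed.

Lemma U0_ad_sl2s_of A B L : \tr A = 0 -> \tr B = 0 -> A *m B - B *m A = L ->
  ad (Defs.iota (sl2s_of p A)) (Defs.iota (sl2s_of p B)) = Defs.iota (sl2s_of p L : g).
Proof. by move=> hA hB <-; rewrite /ad -iota_br (br_sl2s_of hA hB). Qed.

Lemma sl2s_ofZ a A : \tr A = 0 -> sl2s_of p (a *: A) = a *: sl2s_of p A :> g.
Proof.
move=> hA; apply: sl2s_eq; last by rewrite /= scaler0.
rewrite -[(a *: sl2s_of p A).1]/(a *: sl2_of p A) -[(sl2s_of p _).1]/(sl2_of p _).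
by rewrite sl2_ofZ // sl2_ofK // linearZ /= hA mulr0.
Qed.

Lemma U0_he : ad H E = 2%:R * E.
Proof.
rewrite (@U0_ad_sl2s_of _ _ (2%:R *: mxe k)) ?tr_mxh ?tr_mxe //.
  by rewrite sl2s_ofZ ?tr_mxe // U0_iotaZ rmorph_nat.
by apply: mx2P; rewrite !mxE !big_ord_recl !big_ord0 !mxE /=; ring.
Qed.

Lemma U0_hf : ad H F = - (2%:R * F).
Proof.
rewrite (@U0_ad_sl2s_of _ _ (- 2%:R *: mxf k)) ?tr_mxh ?tr_mxf //.
  by rewrite sl2s_ofZ ?tr_mxf // U0_iotaZ rmorphN rmorph_nat mulNr.
by apply: mx2P; rewrite !mxE !big_ord_recl !big_ord0 !mxE /=; ring.
Qed.

Lemma U0_ef : ad E F = H.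
Proof.
rewrite (@U0_ad_sl2s_of _ _ (mxh k)) ?tr_mxe ?tr_mxf //.
by apply: mx2P; rewrite !mxE !big_ord_recl !big_ord0 !mxE /=; ring.
Qed.

Lemma U0_c_central : central C.
Proof.
have cx x : C * Defs.iota x = Defs.iota x * C.
  apply/eqP; rewrite -subr_eq0 -iota_br.
  suff -> : br (elt_c0 k p) x = 0 by rewrite U0_iota0.
  have p_gt2 : (2 < p)%N by [].
  have z0 : mx_of (0 : sl2 k p) = 0 by exact: linear0.
  apply: sl2s_eq; last by [].
  rewrite -[(br _ x).1]/(br 0 x.1) -[(0 : g).1]/(0 : sl2 k p) mx_of_br // z0.
  by rewrite mul0mx mulmx0 subrr.
move=> u; elim/U0_ind: u => [a|x|u v hu hv|u v hu hv].
- exact: (esym (scal_comm a C)).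
- exact: cx.
- exact: (commrD hu hv).
exact: (commrM hu hv).
Qed.

Lemma U0_nil_pow A : \tr A = 0 -> A 0 0 = 0 -> A 0 1 * A 1 0 = 0 ->
  Defs.iota (sl2s_of p A : g) ^+ p = 0.
Proof.
move=> hA h00 h01; have p_gt2 : (2 < p)%N by [].
rewrite -iota_pmap -[RHS](U0_iota0 g); congr (Defs.iota _).
have p0 : (0 < p)%N by apply: leq_trans p3.
have p20 : (0 < p./2)%N by rewrite half_gt0 ltnW.
apply: sl2s_eq; last by rewrite /= /psi sl2_ofK // h00 expr0n eqn0Ngt p0.
rewrite -[(Defs.pmap (sl2s_of p A : g)).1]/(Defs.pmap (sl2_of p A)) -[(0 : g).1]/(0 : sl2 k p).
rewrite sl2_pmapE // sl2_ofK // h01 h00 expr0n addr0 expr0n eqn0Ngt p20.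
by rewrite scale0r.
Qed.

Lemma U0_e_pow : E ^+ p = 0.
Proof. by apply: U0_nil_pow; rewrite ?tr_mxe // !mxE //= mulr0. Qed.

Lemma U0_f_pow : F ^+ p = 0.
Proof. by apply: U0_nil_pow; rewrite ?tr_mxf // !mxE //= mul0r. Qed.

Lemma U0_c_pow : C ^+ p = 0.
Proof.
rewrite -iota_pmap -[RHS](U0_iota0 g); congr (Defs.iota _).
have p0 : (0 < p)%N by apply: leq_trans p3.
have p20 : (0 < p./2)%N by rewrite half_gt0 ltnW.
have z0 : mx_of (0 : sl2 k p) = 0 by exact: linear0.
apply: sl2s_eq; last by rewrite /= /psi z0 mxE expr0n eqn0Ngt p0.
rewrite -[(Defs.pmap (elt_c0 k p)).1]/(Defs.pmap (0 : sl2 k p)) -[(0 : g).1]/(0 : sl2 k p).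
by rewrite sl2_pmapE // scaler0.
Qed.

End Sl2sRelations.

(** * Radical and socle of Verma modules *)

Section KSpan.
Variables (k : fieldType) (U : pzRingType) (s : {rmorphism k -> U}) (M : lmodType U).
Implicit Types (G : M -> Prop) (x y : M).

(** The field k acts on M only through s, so the k-span is generated by hand. *)
Inductive kspan G : M -> Prop :=
| kspan_0 : kspan G 0
| kspan_add a x y : G x -> kspan G y -> kspan G (s a *: x + y).

Lemma kspan_in G x : G x -> kspan G x.
Proof.
by move=> Gx; rewrite -[x]addr0 -[x]scale1r -(rmorph1 s); apply: kspan_add => //; apply: kspan_0.
Qed.

Lemma kspanD G x y : kspan G x -> kspan G y -> kspan G (x + y).
Proof.
move=> hx hy; elim: hx => [|a z t Gz _ IH]; first by rewrite add0r.
by rewrite -addrA; apply: kspan_add.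
Qed.

Lemma kspan_act u G G' : (forall a, s a * u = u * s a) ->
  (forall x, G x -> kspan G' (u *: x)) -> forall x, kspan G x -> kspan G' (u *: x).
Proof.
move=> su hu x; elim=> {x} [|a x y Gx _ IH]; first by rewrite scaler0; apply: kspan_0.
rewrite scalerDr scalerA -su -scalerA; apply: kspanD => //.
elim: (hu x Gx) => [|b z t Gz _ IHz]; first by rewrite scaler0; apply: kspan_0.
by rewrite scalerDr scalerA -rmorphM; apply: kspan_add.
Qed.

Lemma kspanZ a G x : kspan G x -> kspan G (s a *: x).
Proof.
apply: kspan_act => [b|z Gz]; first by rewrite -!rmorphM mulrC.
rewrite -[_ *: _]addr0; apply: kspan_add => //; exact: kspan_0.
Qed.

Lemma kspan_sub G G' : (forall x, G x -> kspan G' x) -> forall x, kspan G x -> kspan G' x.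
Proof.
move=> h x; elim=> [|a y z Gy _ IH]; first exact: kspan_0.
by apply: kspanD => //; apply/kspanZ/h.
Qed.

Lemma kspanN G x : kspan G x -> kspan G (- x).
Proof. by move=> /(kspanZ (-1)); rewrite rmorphN1 scaleN1r. Qed.

Lemma kspanB G x y : kspan G x -> kspan G y -> kspan G (x - y).
Proof. by move=> hx /kspanN; apply: kspanD. Qed.

Lemma kspan_submod G (W : {pred M}) : submod_closed W -> (forall x, G x -> x \in W) ->
  forall x, kspan G x -> x \in W.
Proof.
move=> [W0 WD] GW x; elim=> {x} [//|a x y /GW xW _ yW]; exact: WD.
Qed.

End KSpan.

(* The elements E, F, T, C stand for e, f, h + c_0, c_0 acting on Z(i), or for
   f, e, -(h + c_0), -c_0 acting on Z'(p - i). *)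
Record verma (k : fieldType) (p : nat) (U : pzRingType) (s : {rmorphism k -> U})
    (E F T C : U) (M : lmodType U) (v0 : M) (i : nat) : Prop := Verma {
  verma_s : forall a, central (s a);
  verma_C : central C;
  verma_tf : ad T F = - (2%:R * F);
  verma_ef : ad E F = T - C;
  verma_fp : F ^+ p = 0;
  verma_cp : C ^+ p = 0;
  verma_ind : forall P : U -> Prop, (forall a, P (s a)) -> P E -> P F -> P T -> P C ->
    (forall u v, P u -> P v -> P (u + v)) -> (forall u v, P u -> P v -> P (u * v)) ->
    forall u, P u;
  verma_e0 : E *: v0 = 0;
  verma_t0 : T *: v0 = s i%:R *: v0;
  verma_gen : forall m : M, exists u, m = u *: v0;
  verma_top : F ^+ p.-1 *: (C ^+ p.-1 *: v0) <> 0
}.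

Section VermaTheory.
Variables (k : fieldType) (p : nat) (U : pzRingType) (s : {rmorphism k -> U}).
Variables (E F T C : U) (M : lmodType U) (v0 : M) (i : nat).
Hypotheses (hp : p \in [pchar k]) (hi : (i <= p - 2)%N) (p3 : (3 <= p)%N).
Hypothesis V : verma p s E F T C v0 i.

Let sC := verma_s V.
Let CC := verma_C V.
Let p0 : (0 < p)%N. Proof. exact: leq_trans p3. Qed.

Definition vm a b : M := F ^+ a *: (C ^+ b *: v0).

Lemma vm_f a b : F *: vm a b = vm a.+1 b.
Proof. by rewrite /vm scalerA -exprS. Qed.

Lemma vm_c a b : C *: vm a b = vm a b.+1.
Proof. by rewrite /vm scalerA CC -scalerA [C *: _]scalerA -exprS. Qed.

Lemma vm_fc a b l n : (F ^+ l * C ^+ n) *: vm a b = vm (l + a) (n + b).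
Proof.
rewrite -scalerA; have -> : C ^+ n *: vm a b = vm a (n + b).
  by elim: n => [|n IH]; rewrite ?scale1r // exprS -scalerA IH vm_c.
by rewrite /vm scalerA -exprD.
Qed.

Lemma vm_out a b : ~~ ((a < p) && (b < p))%N -> vm a b = 0.
Proof.
rewrite negb_and -!leqNgt /vm => /orP[/subnKC <-|/subnKC <-].
  by rewrite exprD (verma_fp V) mul0r scale0r.
by rewrite exprD (verma_cp V) mul0r scale0r scaler0.
Qed.

Lemma vm_t a b : T *: vm a b = s (i%:R - a%:R *+ 2) *: vm a b.
Proof.
elim: a => [|a IH].
  rewrite /vm !scale1r scalerA -(centralX b CC) -scalerA (verma_t0 V).
  by rewrite mul0rn subr0 !scalerA sC.
have tf : T * F = F * T - 2%:R * F by rewrite -(verma_tf V) /ad addrCA subrr addr0.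
rewrite -vm_f scalerA tf scalerBl -scalerA IH -scalerA scalerA -sC -scalerA.
rewrite -(rmorph_nat s) -scalerBl -rmorphB; congr (s _ *: _).
by rewrite -natr1; ring.
Qed.

(** On the generator T - C acts as i - C, so this is the usual coefficient a (i - C + 1 - a) of E
    F^a, with C moved into the second index. *)
Lemma vm_e a b : E *: vm a b =
  s (a%:R * (i%:R + 1 - a%:R)) *: vm a.-1 b - s a%:R *: vm a.-1 b.+1.
Proof.
elim: a => [|a IH].
  rewrite mul0r rmorph0 !scale0r subr0 /vm scale1r scalerA -(centralX b CC) -scalerA.
  by rewrite (verma_e0 V) scaler0.
have ef : E * F = F * E + (T - C) by rewrite -(verma_ef V) /ad addrCA subrr addr0.
rewrite -vm_f scalerA ef scalerDl -scalerA IH scalerBl vm_t vm_c scalerBr.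
rewrite !scalerA -!sC -!scalerA !vm_f /=.
have -> : s (a%:R * (i%:R + 1 - a%:R)) *: vm a.-1.+1 b = s (a%:R * (i%:R + 1 - a%:R)) *: vm a b.
  by case: a {IH} => // ; rewrite mul0r rmorph0 !scale0r.
have -> : s a%:R *: vm a.-1.+1 b.+1 = s a%:R *: vm a b.+1.
  by case: a {IH} => // ; rewrite rmorph0 !scale0r.
rewrite addrACA -opprD -scalerDl -rmorphD -[X in _ - (_ + X)]scale1r -(rmorph1 s).
rewrite -scalerDl -rmorphD [a%:R + 1]natr1; congr (s _ *: _ - _).
by rewrite -natr1; ring.
Qed.

Lemma vm_eZ c a b : E *: (s c *: vm a b) =
  s (c * (a%:R * (i%:R + 1 - a%:R))) *: vm a.-1 b - s (c * a%:R) *: vm a.-1 b.+1.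
Proof.
by rewrite scalerA -sC -scalerA vm_e scalerBr (scalerA (s c)) (scalerA (s c)) -!rmorphM.
Qed.

Definition vcomb (x : nat -> nat -> k) := \sum_(a < p) \sum_(b < p) s (x a b) *: vm a b.

Lemma vcomb_act x l n : (F ^+ l * C ^+ n) *: vcomb x =
  \sum_(a < p) \sum_(b < p) s (x a b) *: vm (l + a) (n + b).
Proof.
rewrite scaler_sumr; apply: eq_bigr => a _; rewrite scaler_sumr; apply: eq_bigr => b _.
by rewrite scalerA -sC -scalerA vm_fc.
Qed.

(** The operator pushes every monomial with first index above a or second index above b out of the
    square; those that stay, other than (a, b) itself, have smaller total degree, where x is assumed
    to vanish. *)
Lemma vcomb_low x a b : (a < p)%N -> (b < p)%N ->
    (forall c d, (c < p)%N -> (d < p)%N -> (c + d < a + b)%N -> x c d = 0) ->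
  (F ^+ (p.-1 - a) * C ^+ (p.-1 - b)) *: vcomb x = s (x a b) *: vm p.-1 p.-1.
Proof.
move=> ap bp low; rewrite vcomb_act.
have pa : (p.-1 - a + a = p.-1)%N by rewrite subnK // -ltnS prednK.
have pb : (p.-1 - b + b = p.-1)%N by rewrite subnK // -ltnS prednK.
rewrite (bigD1 (Ordinal ap)) //= (bigD1 (Ordinal bp)) //=.
have zero (c d : 'I_p) : (c != a :> nat) || (d != b :> nat) ->
    s (x c d) *: vm (p.-1 - a + c) (p.-1 - b + d) = 0.
  move=> cd; have [ca|ac] := leqP c a; last first.
    by rewrite vm_out ?scaler0 // negb_and -!leqNgt; apply/orP; left; lia.
  have [db|bd] := leqP d b; last first.
    by rewrite vm_out ?scaler0 // negb_and -!leqNgt; apply/orP; right; lia.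
  rewrite low ?rmorph0 ?scale0r //.
  by case/orP: cd => /eqP; lia.
rewrite big1 => [|d db]; last by apply: (zero (Ordinal ap) d); rewrite [X in _ || X]db orbT.
rewrite big1 => [|c ca]; last by rewrite big1 // => d _; apply: zero; rewrite [X in X || _]ca.
by rewrite !addr0 pa pb.
Qed.

Lemma vm_scale_eq0 x : s x *: vm p.-1 p.-1 = 0 -> x = 0.
Proof.
move=> top0; apply/eqP; apply: contra_notT (verma_top V) => xn0.
rewrite -[LHS]scale1r -(rmorph1 s) -(mulVf xn0) rmorphM -scalerA.
by rewrite [X in _ *: X]top0 scaler0.
Qed.

Lemma vcomb_indep x : vcomb x = 0 -> forall a b, (a < p)%N -> (b < p)%N -> x a b = 0.
Proof.
move=> x0; suff h n a b : (a + b = n)%N -> (a < p)%N -> (b < p)%N -> x a b = 0.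
  by move=> a b; apply: h.
elim/ltn_ind: n a b => n IH a b abn ap bp; apply: vm_scale_eq0.
rewrite -vcomb_low ?x0 ?scaler0 // => c d cp dp cd.
by apply: (IH (c + d)%N) => //; rewrite -abn.
Qed.

Definition vgen (P : nat -> nat -> bool) : M -> Prop := fun x => exists a b, P a b /\ x = vm a b.

Lemma vgen_in (P : nat -> nat -> bool) a b : P a b -> kspan s (vgen P) (vm a b).
Proof. by move=> Pab; apply: kspan_in; exists a, b. Qed.

Lemma vcombD x y : vcomb (fun a b => x a b + y a b) = vcomb x + vcomb y.
Proof.
rewrite -big_split; apply: eq_bigr => a _; rewrite -big_split; apply: eq_bigr => b _.
by rewrite rmorphD scalerDl.
Qed.

Lemma vcombN x : vcomb (fun a b => - x a b) = - vcomb x.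
Proof.
rewrite -sumrN; apply: eq_bigr => a _; rewrite -sumrN; apply: eq_bigr => b _.
by rewrite rmorphN scaleNr.
Qed.

Lemma kspan_vcomb (P : nat -> nat -> bool) v : kspan s (vgen P) v ->
  exists x, (forall a b, ~~ P a b -> x a b = 0) /\ v = vcomb x.
Proof.
elim=> [|c _ y [a [b [Pab ->]]] _ [x [xP ->]]].
  exists (fun _ _ => 0); split=> //; rewrite /vcomb big1 // => a _.
  by rewrite big1 // => b _; rewrite rmorph0 scale0r.
have [ab|ab] := boolP ((a < p)%N && (b < p)%N); last first.
  by exists x; rewrite vm_out // scaler0 add0r.
have /andP[ap bp] := ab.
exists (fun a' b' => (if (a' == a) && (b' == b) then c else 0) + x a' b'); split.
  move=> a' b' P'; rewrite xP // addr0; case: andP => // -[/eqP aa /eqP bb].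
  by rewrite aa bb Pab in P'.
rewrite vcombD; congr (_ + _); rewrite /vcomb (bigD1 (Ordinal ap)) //=.
rewrite (bigD1 (Ordinal bp)) //= !eqxx /= !big1 ?addr0 // => [a' aa|b' bb].
  rewrite big1 // => b' _; rewrite -[_ == a :> nat]/(a' == Ordinal ap) (negPf aa).
  by rewrite rmorph0 scale0r.
by rewrite -[_ == b :> nat]/(b' == Ordinal bp) (negPf bb) rmorph0 scale0r.
Qed.

Lemma kspan_vgen_closed (P : nat -> nat -> bool) :
    (forall a b, P a b -> P a.+1 b) -> (forall a b, P a b -> P a b.+1) ->
    (forall a b, P a b -> kspan s (vgen P) (E *: vm a b)) ->
  forall u v, kspan s (vgen P) v -> kspan s (vgen P) (u *: v).
Proof.
move=> PF PC PE u; elim/(verma_ind V): u => [a|||||u v hu hv|u v hu hv] x hx.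
- exact: kspanZ.
- apply: kspan_act hx => [a|_ [a [b [Pab ->]]]]; [exact: sC | exact: PE].
- apply: kspan_act hx => [a|_ [a [b [/PF Pab ->]]]]; first exact: sC.
  by rewrite vm_f; apply: vgen_in.
- apply: kspan_act hx => [a|_ [a [b [Pab ->]]]]; first exact: sC.
  by rewrite vm_t; apply/kspanZ/vgen_in.
- apply: kspan_act hx => [a|_ [a [b [/PC Pab ->]]]]; first exact: sC.
  by rewrite vm_c; apply: vgen_in.
- by rewrite scalerDl; apply: kspanD; [apply: hu | apply: hv].
by rewrite -scalerA; apply/hu/hv.
Qed.

Lemma vm_span v : kspan s (vgen (fun _ _ => true)) v.
Proof.
have [u ->] := verma_gen V v; apply: kspan_vgen_closed => // [a b _|].
  by rewrite vm_e; apply: kspanB; apply/kspanZ/vgen_in.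
by rewrite -[v0]scale1r -[v0 in 1 *: v0]scale1r; exact: (@vgen_in _ 0%N 0%N).
Qed.

(** Both index sets are upward closed and extend beyond the square, where the monomials are 0; so F
    and C preserve them and only E has to be examined. *)
Definition in_rad a b := (i < a)%N || (0 < b)%N.
Definition in_soc a b := (i < a)%N && (p.-1 <= b)%N.

Lemma rad_closed u v : kspan s (vgen in_rad) v -> kspan s (vgen in_rad) (u *: v).
Proof.
apply: kspan_vgen_closed => [a b|a b|a b]; rewrite /in_rad.
- by case/orP => [/ltnW ia|->]; rewrite ?ltnS ?ia ?orbT.
- by rewrite orbT.
rewrite vm_e => h; apply: kspanB; last by apply/kspanZ/vgen_in; rewrite orbT.
have [b0|b0] := ltnP 0 b; first by apply/kspanZ/vgen_in; rewrite b0 orbT.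
have ia : (i < a)%N by move: h; rewrite /in_rad; lia.
(* The step from a = i + 1 to i would leave the set, but its coefficient a (i + 1 - a) is 0. *)
have [->|ia'] := eqVneq a i.+1.
  by rewrite -natr1 subrr mulr0 rmorph0 scale0r; apply: kspan_0.
by apply/kspanZ/vgen_in; apply/orP; left; lia.
Qed.

Lemma soc_closed u v : kspan s (vgen in_soc) v -> kspan s (vgen in_soc) (u *: v).
Proof.
apply: kspan_vgen_closed => [a b|a b|a b]; rewrite /in_soc.
- by case/andP => /ltnW ia ->; rewrite ltnS ia.
- by case/andP => -> /leqW ->.
case/andP=> ia pb; rewrite vm_e [vm _ b.+1]vm_out ?scaler0 ?subr0; last by lia.
have [->|ia'] := eqVneq a i.+1.
  by rewrite -natr1 subrr mulr0 rmorph0 scale0r; apply: kspan_0.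
by apply/kspanZ/vgen_in; apply/andP; split=> //; lia.
Qed.

Lemma kspan_disjoint (P Q : nat -> nat -> bool) v :
    (forall a b, (a < p)%N -> (b < p)%N -> P a b -> ~~ Q a b) ->
  kspan s (vgen P) v -> kspan s (vgen Q) v -> v = 0.
Proof.
move=> PQ /kspan_vcomb[x [xP vx]] /kspan_vcomb[y [yQ vy]].
have xy a b : (a < p)%N -> (b < p)%N -> x a b - y a b = 0.
  apply: (@vcomb_indep (fun a b => x a b - y a b)).
  by rewrite (vcombD x) vcombN -vx -vy subrr.
rewrite vx /vcomb big1 // => a _; rewrite big1 // => b _.
have [Pab|/xP ->] := boolP (P a b); last by rewrite rmorph0 scale0r.
have /eqP := xy a b (ltn_ord a) (ltn_ord b); rewrite subr_eq0 => /eqP ->.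
by rewrite yQ ?rmorph0 ?scale0r // PQ.
Qed.

Lemma vm_neq0 a b : (a < p)%N -> (b < p)%N -> vm a b <> 0.
Proof.
move=> ap bp ab0; apply: (verma_top V).
have := vm_fc a b (p.-1 - a) (p.-1 - b); rewrite ab0 scaler0 => /esym.
by rewrite !subnK // -ltnS prednK.
Qed.

Lemma vm00 : vm 0 0 = v0.
Proof. by rewrite /vm !scale1r. Qed.

Lemma v0_notin_rad : ~ kspan s (vgen in_rad) v0.
Proof.
move=> h; apply: (@vm_neq0 0 0) => //; rewrite vm00.
apply: (@kspan_disjoint (fun a b => (a == 0)%N && (b == 0)%N) in_rad) h.
  by move=> a b _ _ /andP[/eqP -> /eqP ->].
by rewrite -vm00; apply: vgen_in.
Qed.

Lemma submod_full (W : {pred M}) : submod_closed W -> v0 \in W -> forall v, v \in W.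
Proof.
move=> [W0 WD] v0W v; have [u ->] := verma_gen V v.
by rewrite -[_ *: _]addr0; apply: WD.
Qed.

(** Nakayama's lemma: F^a C^b (v_0 + n) is the monomial (a, b) plus monomials of larger total
    degree, so every monomial lies in W by descending induction from degree 2 p, where all of them
    are 0. *)
Lemma submod_nakayama (W : {pred M}) n : submod_closed W ->
  kspan s (vgen in_rad) n -> v0 + n \in W -> v0 \in W.
Proof.
move=> WC hn wW; have [W0 WD] := WC.
suff h d a b : (2 * p <= a + b + d)%N -> vm a b \in W.
  by rewrite -vm00; apply: (h (2 * p)%N).
elim: d a b => [|d IH] a b abd; first by rewrite vm_out //; lia.
have -> : vm a b = (F ^+ a * C ^+ b) *: (v0 + n) + (-1 *: ((F ^+ a * C ^+ b) *: n) + 0).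
  by rewrite -vm00 scalerDr vm_fc !addn0 scaleN1r addr0 addrK.
apply: (WD) => //; apply: (WD) => //.
apply: (@kspan_submod _ _ _ _ (vgen (fun a' b' => a + b < a' + b')%N) _ WC).
  by move=> _ [a' [b' [h ->]]]; apply: IH; lia.
apply: kspan_act hn => [c|_ [a' [b' [h ->]]]]; first exact: sC.
by rewrite vm_fc; apply: vgen_in; move: h; rewrite /in_rad; lia.
Qed.

Lemma natk_neq0 n : (0 < n < p)%N -> n%:R != 0 :> k.
Proof. by move=> /andP[n0 np]; rewrite -(dvdn_pcharf hp) gtnNdvd. Qed.

Lemma rad_split v : exists y : nat -> k,
  kspan s (vgen in_rad) (v - \sum_(a < i.+1) s (y a) *: vm a 0).
Proof.
elim: (vm_span v) => [|c _ w [a [b [_ ->]]] _ [y hy]].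
  exists (fun=> 0); rewrite big1 ?subrr; first exact: kspan_0.
  by move=> a _; rewrite rmorph0 scale0r.
have [hab|hab] := boolP (in_rad a b).
  by exists y; rewrite -addrA; apply: kspanD => //; apply/kspanZ/vgen_in.
have [ia b0] : (a < i.+1)%N /\ b = 0%N by move: hab; rewrite /in_rad; lia.
exists (fun a' => (if a' == a then c else 0) + y a').
under eq_bigr do rewrite rmorphD scalerDl.
rewrite big_split (bigD1 (Ordinal ia)) //= eqxx big1 ?addr0 ?b0 => [|a' aa].
  by rewrite opprD addrACA subrr add0r.
by rewrite -[_ == a :> nat]/(a' == Ordinal ia) (negPf aa) rmorph0 scale0r.
Qed.

(** This is the simplicity of the quotient by the radical, spanned by the classes of F^a v_0 with a
    <= i: E lowers a with the coefficient a (i + 1 - a), nonzero for 0 < a <= i, until only a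
    multiple of v_0 is left. The C-terms of E fall into the radical. *)
Lemma submod_above_rad (W : {pred M}) n (y : nat -> k) w : submod_closed W ->
    (forall x, kspan s (vgen in_rad) x -> x \in W) -> (n <= i)%N ->
    kspan s (vgen in_rad) w -> \sum_(a < n.+1) s (y a) *: vm a 0 + w \in W ->
  v0 \in W \/ forall a, (a <= n)%N -> y a = 0.
Proof.
move=> WC NW; have [W0 WD] := WC; elim: n y w => [|n IH] y w ni hw.
  rewrite big_ord1 /= => yW; have [y0|y0] := eqVneq (y 0%N) 0.
    by right=> a; rewrite leqn0 => /eqP ->.
  left; rewrite -vm00; have -> : vm 0 0 = s (y 0%N)^-1 *: (s (y 0%N) *: vm 0 0 + w)
     + (-1 *: (s (y 0%N)^-1 *: w) + 0).
    by rewrite addr0 scaleN1r scalerDr addrK scalerA -rmorphM mulVf // rmorph1 scale1r.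
  by apply: (WD) => //; apply: (WD) => //; apply/NW/kspanZ.
move=> yW.
pose y' a := y a.+1 * (a.+1%:R * (i%:R + 1 - a.+1%:R)).
pose w' := E *: w - \sum_(a < n.+1) s (y a.+1 * a.+1%:R) *: vm a 1.
have hw' : kspan s (vgen in_rad) w'.
  apply: kspanB; first exact: rad_closed.
  elim/big_rec: _ => [|a z _]; first exact: kspan_0.
  by apply: kspanD; apply/kspanZ/vgen_in; rewrite /in_rad orbT.
have : \sum_(a < n.+1) s (y' a) *: vm a 0 + w' \in W.
  rewrite [X in X \in W](_ : _ = E *: (\sum_(a < n.+2) s (y a) *: vm a 0 + w)).
    by rewrite -[_ *: _]addr0; apply: (WD).
  rewrite scalerDr addrCA addrC; congr (_ + _); rewrite scaler_sumr.
  under [RHS]eq_bigr do rewrite vm_eZ.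
  rewrite sumrB [X in _ = X - _]big_ord_recl [X in _ = _ - X]big_ord_recl.
  by rewrite !mul0r !mulr0 rmorph0 !scale0r !add0r.
case/(IH _ _ (ltnW ni) hw') => [|y'0]; [by left | ].
have yS a : (a <= n)%N -> y a.+1 = 0.
  move=> an; have /eqP := y'0 a an; rewrite !mulf_eq0 => /orP[/eqP //|].
  have -> : i%:R + 1 - a.+1%:R = (i - a)%:R :> k.
    by rewrite natrB ?(leq_trans an (ltnW ni)) // -natr1; ring.
  rewrite !(negPf (natk_neq0 _)) //; lia.
move: yW; rewrite big_ord_recl big1 ?addr0 => [yW|a _]; last first.
  by rewrite /= yS ?rmorph0 ?scale0r // -ltnS.
have [y0|y0] := eqVneq (y 0%N) 0.
  by right=> -[_ //|a an]; apply: yS.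
left; have -> : v0 = s (y 0%N)^-1 *: (s (y 0%N) *: vm 0 0 + w)
   + (-1 *: (s (y 0%N)^-1 *: w) + 0).
  rewrite addr0 scaleN1r scalerDr addrK scalerA -rmorphM mulVf // rmorph1 scale1r.
  by rewrite vm00.
by apply: (WD) => //; apply: (WD) => //; apply/NW/kspanZ.
Qed.

Definition rad_pred : {pred M} := fun v => `[< kspan s (vgen in_rad) v >].
Definition soc_pred : {pred M} := fun v => `[< kspan s (vgen in_soc) v >].

Lemma rad_predP v : reflect (kspan s (vgen in_rad) v) (v \in rad_pred).
Proof. exact: asboolP. Qed.

Lemma soc_predP v : reflect (kspan s (vgen in_soc) v) (v \in soc_pred).
Proof. exact: asboolP. Qed.

Lemma rad_pred_submod : submod_closed rad_pred.
Proof.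
split=> [|u x y /rad_predP hx /rad_predP hy]; apply/rad_predP; first exact: kspan_0.
by apply: kspanD => //; apply: rad_closed.
Qed.

Lemma soc_pred_submod : submod_closed soc_pred.
Proof.
split=> [|u x y /soc_predP hx /soc_predP hy]; apply/soc_predP; first exact: kspan_0.
by apply: kspanD => //; apply: soc_closed.
Qed.

Lemma rad_pred_maximal : maximal_submod rad_pred.
Proof.
split.
  split; first exact: rad_pred_submod.
  by exists v0; apply/rad_predP/v0_notin_rad.
move=> W [WC [x xW]] NW v vW; apply/rad_predP; have [y hy] := rad_split v.
set z := v - _ in hy; have vE : \sum_(a < i.+1) s (y a) *: vm a 0 + z = v.
  by rewrite addrC subrK.
have NW' t : kspan s (vgen in_rad) t -> t \in W by move=> ht; apply/NW/rad_predP.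
have hW : \sum_(a < i.+1) s (y a) *: vm a 0 + z \in W by rewrite vE.
have [v0W|y0] := submod_above_rad WC NW' (leqnn i) hy hW.
  by rewrite (submod_full WC v0W) in xW.
rewrite -vE big1 ?add0r // => a _; by rewrite y0 ?rmorph0 ?scale0r // -ltnS.
Qed.

(** If W is maximal, then W + [rad_pred] does not contain v_0 by [submod_nakayama]; so it is proper,
    and W already contains [rad_pred]. *)
Lemma Rad_verma : @Rad U M =i rad_pred.
Proof.
move=> v; apply/idP/idP.
  by move=> /asboolP/(_ _ rad_pred_maximal).
move=> vN; apply/asboolP => W [[WC [x xW]] Wmax].
have [W0 WD] := WC; have [N0 ND] := rad_pred_submod.
pose W' : {pred M} := fun t => `[< exists w n, [/\ w \in W, n \in rad_pred & t = w + n] >].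
have W'C : submod_closed W'.
  split=> [|u t t' /asboolP[w [n [wW nN ->]]] /asboolP[w' [n' [wW' nN' ->]]]].
    by apply/asboolP; exists 0, 0; rewrite addr0.
  apply/asboolP; exists (u *: w + w'), (u *: n + n').
  by rewrite scalerDr addrACA; split=> //; [apply: WD | apply: ND].
have W'1 : v0 \notin W'.
  apply/asboolP => -[w [n [wW /rad_predP nN v0E]]].
  have : v0 - n \in W by rewrite v0E addrK.
  move=> /(submod_nakayama WC (kspanN nN)) /(submod_full WC)/(_ x).
  by rewrite (negPf xW).
apply: (Wmax W').
- by split=> //; exists v0.
- move=> w wW; apply/asboolP; exists w, 0; by rewrite addr0.
by apply/asboolP; exists 0, v; rewrite add0r.
Qed.

(** For a nonzero coefficient of least total degree a + b, multiplication by F^(p-1-a) C^(p-1-b)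
    leaves a nonzero multiple of the top monomial. *)
Lemma submod_top (W : {pred M}) v : submod_closed W -> v \in W -> v != 0 ->
  vm p.-1 p.-1 \in W.
Proof.
move=> [W0 WD] vW v0'; have [x [_ vE]] := kspan_vcomb (vm_span v).
have [//|topW] := boolP (vm p.-1 p.-1 \in W); case/negP: v0'.
suff h n a b : (a + b = n)%N -> (a < p)%N -> (b < p)%N -> x a b = 0.
  by rewrite vE /vcomb big1 // => a _; rewrite big1 // => b _;
    rewrite (h (a + b)%N) ?rmorph0 ?scale0r.
elim/ltn_ind: n a b => n IH a b abn ap bp; apply/eqP; apply: contraNT topW => xn0.
have := @vcomb_low x a b ap bp; rewrite -vE => E'.
have -> : vm p.-1 p.-1 = s (x a b)^-1 *: ((F ^+ (p.-1 - a) * C ^+ (p.-1 - b)) *: v) + 0.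
  rewrite E' ?addr0 => [|c d cp dp cd]; last by apply: (IH (c + d)%N) => //; rewrite -abn.
  by rewrite scalerA -rmorphM mulVf // rmorph1 scale1r.
by apply: (WD) => //; rewrite -[_ *: v]addr0; apply: (WD).
Qed.

(** From the top monomial E descends through the F^a C^(p-1) v_0 to a = i + 1: the coefficient a (i
    + 1 - a) is nonzero for i + 1 < a < p, and the C-term vanishes as C^p = 0. *)
Lemma soc_sub (W : {pred M}) v : submod_closed W -> v \in W -> v != 0 ->
  {subset soc_pred <= W}.
Proof.
move=> WC vW v0' x /soc_predP; have [W0 WD] := WC.
apply: kspan_submod => // _ [a [b [/andP[ia pb] ->]]].
have [ab|ab] := boolP ((a < p) && (b < p))%N; last by rewrite vm_out.
have -> : b = p.-1 by lia.
have [l al] : exists l, (a + l = p.-1)%N by exists (p.-1 - a)%N; lia.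
elim: l a al ia {ab pb} => [|l IH] a al ia.
  by rewrite -al addn0; have := submod_top WC vW v0'; rewrite -al addn0.
have xn0 : a.+1%:R * (i%:R + 1 - a.+1%:R) != 0 :> k.
  have -> : i%:R + 1 - a.+1%:R = - (a - i)%:R :> k.
    by rewrite natrB ?(ltnW ia) // -natr1; ring.
  by rewrite mulrN oppr_eq0 mulf_neq0 // natk_neq0 //; lia.
have := IH a.+1; rewrite addSnnS => /(_ al (ltnW ia)) h.
have -> : vm a p.-1 = s (a.+1%:R * (i%:R + 1 - a.+1%:R))^-1 *: (E *: vm a.+1 p.-1) + 0.
  rewrite vm_e [vm _ p.-1.+1]vm_out ?scaler0 ?subr0 ?addr0; last by lia.
  by rewrite (scalerA (s _^-1)) -rmorphM mulVf // rmorph1 scale1r.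
by apply: (WD) => //; rewrite -[_ *: vm _ _]addr0; apply: (WD).
Qed.

Lemma soc_pred_simple : simple_submod soc_pred.
Proof.
split; first exact: soc_pred_submod.
  exists (vm p.-1 p.-1); last by apply/eqP/vm_neq0; rewrite prednK.
  by apply/soc_predP/vgen_in/andP; split=> //; lia.
move=> W WC _; have [h|h] := pselect (forall x, x \in W -> x = 0); first by left.
right; have [x /not_implyP[xW /eqP x0]] := (existsNP _).2 h; exact: soc_sub xW x0.
Qed.

(** A simple submodule contains [soc_pred] by [soc_sub], hence equals it. *)
Lemma Soc_verma : @Soc U M =i soc_pred.
Proof.
have [S0 SD] := soc_pred_submod.
move=> v; apply/idP/idP => [/asboolP[t -> ht]|vS].
  rewrite big_seq; elim/big_rec: _ => // x y /ht[N [NC [z zN z0] Nmin] xN] yS.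
  rewrite -[x]scale1r; apply: SD => //.
  case: (Nmin _ soc_pred_submod (soc_sub NC zN z0)); last by apply.
  move=> S_0; have [_ [t0 t0S]] := soc_pred_simple.
  by rewrite (S_0 _ t0S) eqxx.
apply/asboolP; exists [:: v]; first by rewrite big_seq1.
by move=> y; rewrite inE => /eqP ->; exists soc_pred => //; exact: soc_pred_simple.
Qed.

(** * The basis of the radical adapted to e *)

Definition vtop a b : M := (E ^+ a * C ^+ b) *: vm p.-1 0.

(* The image of in_rad under (a, b) |-> (p - 1 - a, p - 1 - b). *)
Definition in_dual a b :=
  [&& a < p, b < p & ~~ ((p.-1 - i <= a) && (p.-1 <= b))]%N.

Definition vtop_gen (P : nat -> nat -> bool) : M -> Prop :=
  fun x => exists a b, P a b /\ x = vtop a b.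

Lemma e_pow_top a : kspan s (vgen (fun a' b' => (a' == p.-1 - a)%N)) (E ^+ a *: vm p.-1 0).
Proof.
elim: a => [|a IH]; first by rewrite scale1r; apply: vgen_in; rewrite subn0.
rewrite exprS -scalerA; apply: kspan_act IH => [c|_ [a' [b' [/eqP -> ->]]]]; first exact: sC.
by rewrite vm_e; apply: kspanB; apply/kspanZ/vgen_in; rewrite subnS.
Qed.

(** On the step from F^(i+1) to F^i the coefficient without C vanishes, so from there on every term
    carries a factor C. *)
Lemma e_pow_top_c a : (p.-1 - i <= a)%N ->
  kspan s (vgen (fun a' b' => (0 < b')%N)) (E ^+ a *: vm p.-1 0).
Proof.
move=> /subnK <-; elim: (a - _)%N => [|l IH].
  have -> : (0 + (p.-1 - i) = (p.-1 - i.+1).+1)%N by lia.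
  rewrite exprS -scalerA; apply: kspan_act (e_pow_top _) => [c|_ [a' [b' [/eqP -> ->]]]].
    exact: sC.
  have -> : (p.-1 - (p.-1 - i.+1) = i.+1)%N by lia.
  rewrite vm_e -natr1 subrr mulr0 rmorph0 scale0r sub0r.
  exact/kspanN/kspanZ/vgen_in.
rewrite addSn exprS -scalerA; apply: kspan_act IH => [c|_ [a' [b' [b0 ->]]]]; first exact: sC.
by rewrite vm_e; apply: kspanB; apply/kspanZ/vgen_in.
Qed.

(** Outside [in_dual] either C^p = 0 applies, or E has gone below level 0, or the factor C of
    [e_pow_top_c] joins C^(p-1) to give C^p. *)
Lemma vtop_out a b : ~~ in_dual a b -> vtop a b = 0.
Proof.
rewrite /vtop -(centralX b CC) -scalerA => hab.
have kill (P : nat -> nat -> bool) x u : (forall c, s c * u = u * s c) ->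
    (forall a b, P a b -> u *: vm a b = 0) -> kspan s (vgen P) x -> u *: x = 0.
  move=> su hu; elim=> [|c _ z [a' [b' [hP ->]]] _ IH]; first exact: scaler0.
  by rewrite scalerDr IH addr0 scalerA -su -scalerA hu // scaler0.
have [bp|bp] := leqP p b.
  by rewrite -(subnKC bp) exprD (verma_cp V) mul0r scale0r.
have [ap|ap] := leqP p a.
  have a1 : a = a.-1.+1 by lia.
  rewrite a1 exprS -scalerA (kill _ _ _ (@sC^~ E) _ (e_pow_top _)) ?scaler0 // => a' b' /eqP ->.
  have -> : (p.-1 - a.-1 = 0)%N by lia.
  by rewrite vm_e mul0r rmorph0 !scale0r subr0.
have hc : (p.-1 - i <= a)%N by move: hab; rewrite /in_dual; lia.
have hb : (p.-1 <= b)%N by move: hab; rewrite /in_dual; lia.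
apply: (kill _ _ _ (fun c => sC c (C ^+ b)) _ (e_pow_top_c hc)) => a' b' b0.
rewrite -[C ^+ b]mul1r -(expr0 F) vm_fc vm_out //; lia.
Qed.

(** The step [lower] recovers F^(a-1) C^b from E F^a C^b by descending induction on b, as the
    coefficient is nonzero for a different from i + 1. At a = i + 1 only the C-term survives, so
    level i is reached from b = 1 on, exactly as in [in_rad]. *)
Lemma vtop_span x : kspan s (vgen in_rad) x -> kspan s (vtop_gen in_dual) x.
Proof.
have in_all y : kspan s (vtop_gen (fun _ _ => true)) y -> kspan s (vtop_gen in_dual) y.
  apply: kspan_sub => _ [a [b [_ ->]]]; have [h|/vtop_out ->] := boolP (in_dual a b).
    by apply: kspan_in; exists a, b.
  exact: kspan_0.
move=> hx; apply: in_all; move: hx; set K := kspan s (vtop_gen _).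
have KE y : K y -> K (E *: y).
  apply: kspan_act => [a|_ [a [b [_ ->]]]]; first exact: sC.
  by apply: kspan_in; exists a.+1, b; rewrite /vtop scalerA mulrA -exprS.
have lower a b0 : (0 < a < p)%N -> a != i.+1 ->
    (forall b, (b0 <= b)%N -> K (vm a b)) -> forall b, (b0 <= b)%N -> K (vm a.-1 b).
  move=> /andP[a0 ap] ai Ka.
  have xn0 : a%:R * (i%:R + 1 - a%:R) != 0 :> k.
    rewrite mulf_neq0 ?natk_neq0 ?a0 // natr1; have [h|h] := leqP a i.
      by rewrite -natrB ?(leqW h) // natk_neq0 //; lia.
    by rewrite -opprB oppr_eq0 -natrB // natk_neq0 //; lia.
  suff h d b : (p <= b + d)%N -> (b0 <= b)%N -> K (vm a.-1 b) by move=> b; apply: (h p); lia.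
  elim: d b => [|d IH] b pb b0b; first by rewrite vm_out; [apply: kspan_0 | lia].
  have -> : vm a.-1 b = s (a%:R * (i%:R + 1 - a%:R))^-1 *:
      (E *: vm a b + s a%:R *: vm a.-1 b.+1).
    by rewrite vm_e subrK (scalerA (s _^-1)) -rmorphM mulVf // rmorph1 scale1r.
  apply/kspanZ/kspanD; first exact/KE/Ka.
  by apply/kspanZ/IH; lia.
have K1 a b : (i < a)%N -> K (vm a b).
  move=> ia; have [pa|ap] := leqP p a; first by rewrite vm_out; [apply: kspan_0 | lia].
  have [l al] : exists l, (a + l = p.-1)%N by exists (p.-1 - a)%N; lia.
  elim: l a al b ia ap => [|l IH] a al b ia ap.
    apply: kspan_in; exists 0%N, b; split=> //; rewrite /vtop !expr0 mul1r.
    by rewrite -[C ^+ b]mul1r -(expr0 F) vm_fc -al !addn0.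
  by apply: (lower a.+1 0%N) => // [||b' _]; [lia | lia | apply: IH; lia].
have K2 a b : (a <= i)%N -> (0 < b)%N -> K (vm a b).
  move=> ai; have [l al] : exists l, (a + l = i)%N by exists (i - a)%N; lia.
  elim: l a al ai b => [|l IH] a al ai b b0.
    have [b' bE] : exists b', b = b'.+1 by exists b.-1; lia.
    have -> : vm a b = s (- i.+1%:R)^-1 *: (E *: vm i.+1 b').
      rewrite vm_e -al addn0 -natr1 subrr mulr0 rmorph0 scale0r sub0r -scaleNr -rmorphN natr1.
      rewrite (scalerA (s _^-1)) -rmorphM mulVf ?rmorph1 ?scale1r ?bE //.
      by rewrite oppr_eq0 natk_neq0 //; lia.
    by apply/kspanZ/KE/K1.
  by apply: (lower a.+1 1%N) => // [||b' b0']; [lia | lia | apply: IH; lia].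
apply: kspan_sub => _ [a [b [hab ->]]]; have [h|h] := leqP a i; last exact: K1.
by apply: K2 => //; move: hab; rewrite /in_rad; lia.
Qed.

Lemma vtop_rad a b : kspan s (vgen in_rad) (vtop a b).
Proof.
apply: rad_closed; apply: vgen_in; rewrite /in_rad; lia.
Qed.

Lemma vtop_act a b l n : (E ^+ l * C ^+ n) *: vtop a b = vtop (l + a) (n + b).
Proof.
by rewrite /vtop scalerA -mulrA (mulrA (C ^+ n)) (centralX n CC (E ^+ a)) !mulrA -exprD -mulrA -exprD.
Qed.
End VermaTheory.

(** * Powers of a sum of two commuting shifts *)

Section MonomialEntry.
Variable k : fieldType.
Implicit Types (x y : k).

(* The coefficient of the monomial (a', b') in (x X + y Y)^j X^a Y^b. *)
Definition mono_entry j x y a b a' b' : k :=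
  if [&& a <= a', b <= b' & a' + b' == a + b + j]%N then
    'C(j, a' - a)%:R * x ^+ (a' - a) * y ^+ (b' - b) else 0.

Lemma mono_entryP j x y a b a' b' : mono_entry j x y a b a' b' != 0 ->
  [/\ a <= a', b <= b' & a' + b' = a + b + j]%N.
Proof. by rewrite /mono_entry; case: and3P => [[-> -> /eqP]|]; rewrite ?eqxx. Qed.

Lemma mono_entry_sym j x y a b a' b' :
  mono_entry j x y a b a' b' = mono_entry j y x b a b' a'.
Proof.
rewrite /mono_entry andbCA (addnC a' b') (addnC a b); case: and3P => // -[h1 h2 /eqP h3].
rewrite mulrAC; congr (_%:R * _ * _); rewrite -bin_sub; last by lia.
by congr 'C(_, _); lia.
Qed.

Lemma mono_entry_rel p j x y a b a' b' : p \in [pchar k] -> (j <= p)%N ->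
    (p <= b + j)%N -> (a' < p)%N -> (b' < p)%N ->
  \sum_(l < (p - j).+1) 'C(p - j, l)%:R * x ^+ l * y ^+ (p - j - l) *
     mono_entry j x y (a + l) (b - l) a' b' = 0.
Proof.
move=> hp jp pb a'p b'p.
have [h|h] := boolP ((a <= a')%N && (a' + b' == a + b + j)%N); last first.
  rewrite big1 // => l _; suff -> : mono_entry j x y (a + l) (b - l) a' b' = 0 by rewrite mulr0.
  apply/eqP; apply: contraNT h => /mono_entryP[h1 h2 h3].
  by apply/andP; split; [lia | apply/eqP; have := ltn_ord l; lia].
have /andP[aa /eqP ab] := h; set D := (a' - a)%N.
have E (l : 'I_(p - j).+1) : 'C(p - j, l)%:R * x ^+ l * y ^+ (p - j - l) *
     mono_entry j x y (a + l) (b - l) a' b' =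
   ('C(p - j, l) * 'C(j, D - l))%:R * (x ^+ D * y ^+ (p - D)) *+ (l <= D)%N.
  have lp := ltn_ord l; rewrite /mono_entry; case: ifPn => [/and3P[h1 h2 _]|h'].
    have -> : (l <= D)%N by rewrite /D; lia.
    have -> : (a' - (a + l) = D - l)%N by rewrite /D; lia.
    have lD : (l <= D)%N by rewrite /D; lia.
    have eD : x ^+ D = x ^+ l * x ^+ (D - l) by rewrite -exprD subnKC.
    have -> : y ^+ (p - D) = y ^+ (p - j - l) * y ^+ (b' - (b - l)).
      by rewrite -exprD; congr (_ ^+ _); rewrite /D; lia.
    by rewrite eD natrM mulr1n; ring.
  rewrite mulr0; case: (leqP l D) => lD; last by rewrite mulr0n.
  have bz : (j < D - l)%N by move: h'; rewrite /D; lia.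
  by rewrite (bin_small bz) muln0 mul0r mul0rn.
rewrite (eq_bigr _ (fun l _ => E l)).
have -> : \sum_(l < (p - j).+1) ('C(p - j, l) * 'C(j, D - l))%:R * (x ^+ D *
  y ^+ (p - D)) *+ (l <= D)%N
   = \sum_(l < D.+1) ('C(p - j, l) * 'C(j, D - l))%:R * (x ^+ D * y ^+ (p - D)).
  rewrite (big_ord_widen_cond (maxn (p - j).+1 D.+1) xpredT (fun l => ('C(p - j, l) * 'C(j,
    D - l))%:R * (x ^+ D * y ^+ (p - D)) *+ (l <= D)%N)) ?leq_maxl //.
  rewrite [RHS](big_ord_widen_cond (maxn (p - j).+1 D.+1) xpredT (fun l => ('C(p - j, l) * 'C(j,
    D - l))%:R * (x ^+ D * y ^+ (p - D)))) ?leq_maxr //.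
  rewrite big_mkcond [RHS]big_mkcond; apply: eq_bigr => l _ /=; rewrite !ltnS.
  case: (leqP l D) => lD; rewrite ?mulr1n ?mulr0n; last by case: ifP.
  by case: leqP => // pl; rewrite (bin_small pl) mul0n mul0r.
rewrite -mulr_suml -natr_sum binomial.Vandermonde subnK //.
rewrite (bin_lt_pcharf_0 hp) ?mul0r //.
by rewrite /D; lia.
Qed.
End MonomialEntry.

(** With the pivot columns t the rows form a triangular matrix for the order by h; the coefficients
    of a vanishing combination are eliminated from the smallest h on. *)
Lemma row_free_tri (k : fieldType) (n r m : nat) (W : 'M[k]_(n, m)) (f : 'I_r -> 'I_n)
    (t : 'I_r -> 'I_m) (h : 'I_r -> nat) :
    (forall i, W (f i) (t i) != 0) ->
    (forall i i', i' != i -> W (f i') (t i) != 0 -> (h i' < h i)%N) ->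
  row_free (rowsub f W).
Proof.
move=> Wn0 Wlt.
apply: inj_row_free => v vW; apply/rowP=> i; rewrite mxE.
have [N hN] := ubnP (h i); elim: N i hN => // N IH i; rewrite ltnS => hi.
have := congr1 (fun u : 'rV_m => u ord0 (t i)) vW; rewrite !mxE (bigD1 i) //= big1.
  by rewrite addr0 mxE => /eqP; rewrite mulf_eq0 (negPf (Wn0 i)) orbF => /eqP.
move=> i' ii; rewrite mxE; have [->|/Wlt lt] := eqVneq (W (f i') (t i)) 0; first by rewrite mulr0.
by rewrite IH ?mul0r // (leq_trans (lt _)).
Qed.

(** The relation is solved for its term l = 0, which lowers b until b + j < p; the terms pushed to
    first index p or beyond are zero rows. *)
Lemma span_by_relation (k : fieldType) (p j n m : nat) (S : nat -> nat -> bool)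
    (R : nat -> nat -> 'rV[k]_n) (V : 'M[k]_(m, n)) (c : nat -> k) :
    c 0 != 0 -> (forall a b, S a b -> (b + j < p)%N -> (R a b <= V)%MS) ->
    (forall a b, (p <= a)%N -> R a b = 0) ->
    (forall a b l, S a b -> (p <= b + j)%N -> (0 < l <= p - j)%N -> (a + l < p)%N ->
      S (a + l)%N (b - l)%N) ->
    (forall a b, (p <= b + j)%N -> \sum_(l < (p - j).+1) c l *: R (a + l)%N (b - l)%N = 0) ->
  forall a b, S a b -> (R a b <= V)%MS.
Proof.
move=> c0 RV R0 hop rel a b; have [N hN] := ubnP b; elim: N a b hN => // N IH a b bN Sab.
have [/RV|pb] := ltnP (b + j) p; first exact.
have := rel a b pb; rewrite big_ord_recl /= addn0 subn0 => /eqP; rewrite addr_eq0 => /eqP E.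
have -> : R a b = (c 0)^-1 *: (c 0 *: R a b) by rewrite scalerA mulVf // scale1r.
rewrite E scalemx_sub // -sumrN summx_sub // => l _; rewrite -scalerN scalemx_sub //.
rewrite (eqmx_opp _); have [h|h] := leqP p (a + bump 0 l).
  by rewrite R0 // sub0mx.
have lp := ltn_ord l; apply: IH; first by rewrite /bump /=; lia.
by apply: hop => //; rewrite /bump /=; lia.
Qed.

Section MonomialMatrix.
Variables (k : fieldType) (n j r : nat) (ra rb : 'I_n -> nat).

Definition mono_mx (x y : k) : 'M[k]_n :=
  \matrix_(s, t) mono_entry j x y (ra s) (rb s) (ra t) (rb t).

Variable f : 'I_r -> 'I_n.

Definition mono_minor (T : r.-tuple 'I_n) := minor (rowsub f (mono_mx 1 1)) T.

Lemma mono_minor_support T : mono_minor T != 0 ->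
  [/\ \sum_a ra (f a) <= \sum_c ra (tnth T c), \sum_a rb (f a) <= \sum_c rb (tnth T c) &
   \sum_c ra (tnth T c) + \sum_c rb (tnth T c) = \sum_a ra (f a) + \sum_a rb (f a) + j * r]%N.
Proof.
rewrite /mono_minor /minor /determinant => /eqP h.
have [s hs] : exists s : 'S_r, forall a, mono_mx 1 1 (f a) (tnth T (s a)) != 0.
  apply: contra_notP h => /forallNP h; rewrite big1 // => s _.
  have /existsNP[a /negP] := h s; rewrite negbK => /eqP h0.
  by rewrite (bigD1 a) //= !mxE in h0 *; rewrite h0 mul0r mulr0.
have re (g : 'I_n -> nat) : (\sum_c g (tnth T c) = \sum_a g (tnth T (s a)))%N.
  by rewrite (reindex_inj (@perm_inj _ s)).
have P a : [/\ ra (f a) <= ra (tnth T (s a)), rb (f a) <= rb (tnth T (s a)) &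
   ra (tnth T (s a)) + rb (tnth T (s a)) = ra (f a) + rb (f a) + j]%N.
  by have := hs a; rewrite mxE => /mono_entryP.
rewrite !re; split; try by apply: leq_sum => a _; case: (P a).
rewrite -!big_split /= (eq_bigr (fun a => ra (f a) + rb (f a) + j)%N); last by move=> a _;
  case: (P a).
by rewrite big_split /= sum_nat_const card_ord mulnC.
Qed.

(** Every nonzero term of the determinant has the same monomial: the exponents in an entry are
    differences between the labels of its column and of its row, and their sum does not depend on
    the permutation. *)
Lemma mono_minorE x y T : minor (rowsub f (mono_mx x y)) T =
  mono_minor T * x ^+ (\sum_c ra (tnth T c) - \sum_a ra (f a))
               * y ^+ (\sum_c rb (tnth T c) - \sum_a rb (f a)).
Proof.
rewrite /mono_minor /minor /determinant !mulr_suml; apply: eq_bigr => s _.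
rewrite -!mulrA; congr (_ * _).
have [h|h] := boolP [forall a, mono_mx 1 1 (f a) (tnth T (s a)) != 0]; last first.
  have /existsP[a] : [exists a, ~~ (mono_mx 1 1 (f a) (tnth T (s a)) != 0)] by rewrite -negb_forall.
  rewrite negbK mxE => /eqP h0; have h1 : mono_entry j x y (ra (f a)) (rb (f a)) (ra (tnth T (s a))) (rb (tnth T (s a))) = 0.
    by move: h0; rewrite /mono_entry; case: ifP => // _; rewrite !expr1n !mulr1 => ->;
      rewrite !mul0r.
  by rewrite (bigD1 a) //= [in RHS](bigD1 a) //= !mxE h0 h1 !mul0r.
have {h} P a : [&& ra (f a) <= ra (tnth T (s a)), rb (f a) <= rb (tnth T (s a)) &
   ra (tnth T (s a)) + rb (tnth T (s a)) == ra (f a) + rb (f a) + j]%N.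
  have := forallP h a; rewrite mxE => /mono_entryP[-> -> ->]; exact: eqxx.
have re (g : 'I_n -> nat) : (forall a, g (f a) <= g (tnth T (s a)))%N ->
   (\sum_c g (tnth T c) - \sum_a g (f a) = \sum_a (g (tnth T (s a)) - g (f a)))%N.
  by move=> gle; rewrite (reindex_inj (@perm_inj _ s)) /= sumnB.
rewrite !re; try by move=> a; case/and3P: (P a).
rewrite !expr_sum -!big_split /=; apply: eq_bigr => a _.
by rewrite !mxE /mono_entry P !expr1n !mulr1 mulrA.
Qed.
End MonomialMatrix.

(** The Pluecker coordinates in [jdegree] are indexed by increasing tuples, so a family of pivot
    columns has to be sorted. *)
Lemma increasing_enum n r (t : 'I_r -> 'I_n) : injective t ->
  exists (T : r.-tuple 'I_n) (s : 'S_r), increasing T /\ forall c, tnth T c = t (s c).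
Proof.
move=> t_inj; pose L := sort (fun a b : 'I_n => a <= b)%N (codom t).
have sL : size L == r by rewrite size_sort size_codom card_ord.
pose T := Tuple sL.
have uL : uniq L by rewrite sort_uniq; apply/injectiveP.
have incT : increasing T.
  rewrite /increasing ltn_sorted_uniq_leq (map_inj_uniq val_inj) uL sorted_map.
  by apply: sort_sorted => a b; apply: leq_total.
have : perm_eq T [tuple t c | c < r].
  by rewrite /= perm_sort codomE.
move=> /tuple_permP[s Es]; exists T, s; split=> // c.
by rewrite (tnth_nth (t c)) Es nth_mktuple tnth_mktuple.
Qed.

(** * The degree of the Plucker map *)

Section Degree.
Variables (k : fieldType) (p : nat) (g : pLie k p) (N : lmodType (U0 g)).
Local Notation s := (scal g).
Local Notation m := (\dim {:g}).
Variables (al be : {linear g -> k^o}) (x1 x2 : g).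
Hypotheses (coordE : forall x, x = al x *: x1 + be x *: x2).
Hypotheses (al1 : al x1 = 1) (al2 : al x2 = 0) (be1 : be x1 = 0) (be2 : be x2 = 1).

Definition lform (l : g -> k) : {mpoly k[m]} := \sum_(i < m) l ((vbasis {:g})`_i) *: 'X_i.

Lemma lform_eval (l : {linear g -> k^o}) x :
  (lform l).@[fun i => coord (vbasis {:g}) i x] = l x.
Proof.
rewrite [x in RHS](coord_vbasis (memvf x)) linear_sum /lform raddf_sum /=.
by apply: eq_bigr => i _; rewrite mevalZ mevalXU linearZ /= mulrC.
Qed.

Lemma lform_homog l : lform l \is 1.-homog.
Proof.
rewrite /lform; apply: rpred_sum => i _; apply: rpredZ.
by rewrite dhomogX; apply/eqP/mdeg1.
Qed.

(* Substituting X x1 + Y x2 for the point of g turns al and be into the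
   variables X and Y of k[X][Y]; [lform_back] inverts this substitution. *)
Definition lform_subst : {rmorphism {mpoly k[m]} -> {poly {poly k}}} :=
  mmap (polyC \o polyC)
    (fun i => (coord (vbasis {:g}) i x1 *: 'X)%:P + (coord (vbasis {:g}) i x2)%:P *: 'X).

Definition lform_back : {rmorphism {poly {poly k}} -> {mpoly k[m]}} :=
  horner_eval (lform be) \o map_poly (horner_eval (lform al) \o map_poly (@mpolyC m k)).

Lemma lform_substK P : lform_back (lform_subst P) = P.
Proof.
have backC q : lform_back q%:P = (map_poly (@mpolyC m k) q).[lform al].
  by rewrite /lform_back /= map_polyC /= /horner_eval hornerC.
have backX : lform_back 'X = lform be by rewrite /lform_back /= map_polyX /horner_eval hornerX.
have backCC c : lform_back c%:P%:P = c%:MP by rewrite backC map_polyC hornerC.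
rewrite [RHS]mpolyE /lform_subst /mmap raddf_sum; apply: eq_bigr => u _.
rewrite [LHS](rmorphM lform_back)
  -[X in X * _]/(lform_back (P@_u)%:P%:P) backCC mul_mpolyC mpolyXE_id; congr (_ *: _).
rewrite [LHS](rmorph_prod lform_back); apply: eq_bigr => i _; rewrite [LHS](rmorphXn lform_back);
  congr (_ ^+ _).
set c1 := coord _ i x1; set c2 := coord _ i x2.
transitivity (c1 *: lform al + c2 *: lform be).
  rewrite [LHS](rmorphD lform_back) backC -[_ *: 'X in X in _ + X]mul_polyC.
  rewrite [X in _ + X](rmorphM lform_back) backX backC map_polyC hornerC mul_mpolyC.
  by rewrite -mul_polyC rmorphM /= map_polyX map_polyC hornerM hornerC hornerX mul_mpolyC.
have key l : c1 * al ((vbasis {:g})`_l) + c2 * be ((vbasis {:g})`_l) =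
    coord (vbasis {:g}) i (vbasis {:g})`_l.
  by rewrite [in RHS](coordE (vbasis _)`_l) linearD !linearZ /= mulrC [c2 * _]mulrC.
rewrite /lform !scaler_sumr -big_split /=.
under eq_bigr do rewrite !scalerA -scalerDl key (coord_free _ _ (basis_free (vbasisP _))).
by rewrite (bigD1 i) //= eqxx scale1r big1 ?addr0 // => l /negPf; rewrite -val_eqE eq_sym => ->;
  rewrite scale0r.
Qed.

Lemma lform_substE (l : {linear g -> k^o}) :
  lform_subst (lform l) = (l x1 *: 'X)%:P + (l x2)%:P *: 'X.
Proof.
have lE x : l x = \sum_(i < m) l ((vbasis {:g})`_i) * coord (vbasis {:g}) i x.
  rewrite {1}[x](coord_vbasis (memvf x)) linear_sum /=; apply: eq_bigr => i _.
  by rewrite linearZ /= mulrC.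
rewrite {1}/lform (raddf_sum lform_subst) [in RHS](lE x1) [in RHS](lE x2).
rewrite scaler_suml !rmorph_sum scaler_suml -big_split; apply: eq_bigr => i _ /=.
rewrite mmapZ mmapX mmap1U /= mulrDr; congr (_ + _).
  by rewrite -polyCM mul_polyC scalerA.
by rewrite -scalerAr mul_polyC scalerA polyCM mulrC.
Qed.

(** After the substitution D divides c X^d and c' Y^d in k[X][Y]: by the first it has degree 0 in Y,
    and by the coefficient of Y^d in the second it is then a nonzero constant. *)
Lemma lform_coprime (D Q Q' : {mpoly k[m]}) (c c' : k) d : c != 0 -> c' != 0 ->
    c *: lform al ^+ d = D * Q -> c' *: lform be ^+ d = D * Q' ->
  exists2 e : k, e != 0 & D = e%:MP.
Proof.
move=> c0 c0' DQ DQ'.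
have sC u : lform_subst u%:MP = u%:P%:P by exact: mmapC.
have {DQ} hA : c%:P%:P * ('X^d)%:P = lform_subst D * lform_subst Q.
  rewrite -(rmorphM lform_subst) -DQ -mul_mpolyC (rmorphM lform_subst) sC.
  rewrite (rmorphXn lform_subst) lform_substE al1 al2 scale1r scale0r addr0.
  by rewrite -rmorphXn.
have {DQ'} hB : c'%:P%:P * 'X^d = lform_subst D * lform_subst Q'.
  rewrite -(rmorphM lform_subst) -DQ' -mul_mpolyC (rmorphM lform_subst) sC.
  by rewrite (rmorphXn lform_subst) lform_substE be1 be2 scale1r scale0r add0r.
have cX0 : c%:P%:P * ('X^d)%:P != 0 :> {poly {poly k}}.
  by rewrite mulf_neq0 ?polyC_eq0 // -size_poly_eq0 size_polyXn.
have D0 : lform_subst D != 0 by apply: contraNneq cX0 => D0; rewrite hA D0 mul0r.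
have Q0 : lform_subst Q != 0 by apply: contraNneq cX0 => Q0; rewrite hA Q0 mulr0.
have sD : size (lform_subst D) = 1%N.
  have := size_mul D0 Q0; rewrite -hA -polyCM size_polyC.
  move: (size_poly_gt0 (lform_subst D)) (size_poly_gt0 (lform_subst Q)).
  rewrite D0 Q0 -polyC_eq0 polyCM cX0.
  by move: (size (lform_subst D)) (size (lform_subst Q)) => [|a] [|b] //= _ _; lia.
have /size_poly1P[a a0 Da] : size (lform_subst D) == 1%N by rewrite sD.
have := congr1 (fun P : {poly {poly k}} => P`_d) hB.
rewrite Da !coefCM coefXn eqxx mulr1 => ac.
have sa : size a == 1%N.
  have Qd0 : (lform_subst Q')`_d != 0.
    by apply: contraNneq c0' => Q'0; rewrite -polyC_eq0 ac Q'0 mulr0.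
  have := size_mul a0 Qd0; rewrite -ac size_polyC c0'.
  by move: a0 Qd0; rewrite -!size_poly_gt0; move: (size a) (size (lform_subst Q')`_d) =>
    [|u] [|v] //= _ _; lia.
have /size_poly1P[e e0 ae] := sa.
exists e => //; apply: (can_inj lform_substK); by rewrite Da ae sC.
Qed.
End Degree.

(** * Bases over k and images in modules over a k-ring *)

Section ScalarCombination.
Variables (k : fieldType) (U : pzRingType) (s : {rmorphism k -> U}) (N : lmodType U).
Hypothesis sC : forall a, central (s a).

(** This and [sbasis] repeat [lincomb] and [kbasis] for an arbitrary ring over k, so that a basis
    found over $U_0(\mathfrak{sl}(2)_s)$ can be carried to a restriction. *)
Definition scomb n (b : 'I_n -> N) (a : 'rV[k]_n) : N := \sum_i s (a 0 i) *: b i.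

Definition sbasis (P : N -> Prop) n (b : 'I_n -> N) :=
  [/\ forall i, P (b i), forall v, P v -> exists a, v = scomb b a &
      forall a, scomb b a = 0 -> a = 0].

Lemma scomb_mul m n (b : 'I_n -> N) (A : 'M[k]_(m, n)) (u : 'rV[k]_m) :
  scomb (fun i => scomb b (row i A)) u = scomb b (u *m A).
Proof.
rewrite /scomb; under eq_bigr do rewrite scaler_sumr.
rewrite exchange_big; apply: eq_bigr => j _; rewrite mxE rmorph_sum scaler_suml.
by apply: eq_bigr => i _; rewrite scalerA mxE -rmorphM.
Qed.

Lemma scomb_act n (b : 'I_n -> N) (z : U) (A : 'M[k]_n) u :
  (forall i, z *: b i = scomb b (row i A)) -> z *: scomb b u = scomb b (u *m A).
Proof.
move=> zb; rewrite -scomb_mul /scomb scaler_sumr; apply: eq_bigr => i _.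
by rewrite scalerA -sC -scalerA zb.
Qed.

Lemma scomb_delta n (b : 'I_n -> N) i : scomb b (delta_mx 0 i) = b i.
Proof.
rewrite /scomb (bigD1 i) //= mxE !eqxx rmorph1 scale1r big1 ?addr0 // => j /negPf ji.
by rewrite mxE ji andbF rmorph0 scale0r.
Qed.

Lemma scombB n (b : 'I_n -> N) u v : scomb b (u - v) = scomb b u - scomb b v.
Proof.
by rewrite -sumrB; apply: eq_bigr => i _; rewrite !mxE rmorphB scalerBl.
Qed.

Lemma sbasis_inj P n (b : 'I_n -> N) u v : sbasis P b -> scomb b u = scomb b v -> u = v.
Proof.
move=> [_ _ bI] uv; apply/eqP; rewrite -subr_eq0; apply/eqP/bI.
by rewrite scombB uv subrr.
Qed.

(** The base change matrices satisfy MA MB = 1, so MB has rank at least n >= m and its m rows are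
    independent. *)
Lemma sbasis_span n m P (b : 'I_n -> N) (c : 'I_m -> N) : sbasis P b -> (m <= n)%N ->
  (forall i, P (c i)) -> (forall v, P v -> exists a, v = scomb c a) -> sbasis P c.
Proof.
move=> bP mn cP cS; have [bP' bS bI] := bP; split=> // a a0.
have /fin_all_exists[A hA] : forall i, exists u, b i = scomb c u by move=> i; apply/cS/bP'.
have /fin_all_exists[B hB] : forall i, exists u, c i = scomb b u by move=> i; apply/bS/cP.
pose MA := \matrix_i A i; pose MB := \matrix_i B i.
have cE u : scomb c u = scomb b (u *m MB).
  rewrite -scomb_mul; apply: eq_bigr => i _; by rewrite rowK -hB.
have AB : MA *m MB = 1%:M.
  apply/row_matrixP=> i; rewrite row_mul rowK rowE mulmx1; apply: (sbasis_inj bP).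
  by rewrite -cE -hA scomb_delta.
have /row_freeP[D BD] : row_free MB.
  rewrite -row_leq_rank; apply: leq_trans mn _.
  have := mulmx1_min AB; move: (mxrankM_maxr MA MB); rewrite AB mxrank1 => h _; exact: h.
have : a *m MB = 0 by apply: bI; rewrite -cE.
by move=> /(congr1 (mulmx^~ D)); rewrite -mulmxA BD mulmx1 mul0mx.
Qed.

Lemma sbasis_image n r (b : 'I_n -> N) (z : U) (W : 'M[k]_n) (f : 'I_r -> 'I_n) :
    sbasis (fun=> True) b -> (forall i, z *: b i = scomb b (row i W)) ->
    row_free (rowsub f W) -> (W <= rowsub f W)%MS ->
  sbasis (fun v => exists w, v = z *: w) (fun a => scomb b (row a (rowsub f W))).
Proof.
move=> bB zb fW Wf; have [_ bS bI] := bB; split=> [i|v [w ->]|a].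
- by exists (b (f i)); rewrite zb row_rowsub.
- have [u ->] := bS w I; rewrite (scomb_act _ zb).
  have /submxP[D ->] : (u *m W <= rowsub f W)%MS by apply: submx_trans Wf; apply: submxMl.
  by exists D; rewrite scomb_mul.
rewrite scomb_mul => /bI/eqP; rewrite mulmx_free_eq0 // => /eqP //.
Qed.

Variables (n : nat) (ra rb : 'I_n -> nat) (b : 'I_n -> N) (X Y : U).
Hypothesis XY : GRing.comm X Y.
(** When the labels separate the basis, the sum has one term, or none if the shift leaves the index
    set. *)
Hypothesis hact : forall t l m, (X ^+ l * Y ^+ m) *: b t =
  \sum_(t' | (ra t' == ra t + l)%N && (rb t' == rb t + m)%N) b t'.

Lemma monomial_action j x y t :
  (s x * X + s y * Y) ^+ j *: b t = scomb b (row t (mono_mx j ra rb x y)).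
Proof.
have cXY : GRing.comm (s x * X) (s y * Y).
  have cz c z : GRing.comm (s c) z by exact: sC.
  apply: commrM; apply: commr_sym; first exact: cz.
  by apply: commrM; apply: commr_sym; [exact: cz | exact: XY].
rewrite exprDn_comm // scaler_suml.
have E (i : 'I_j.+1) : ((s x * X) ^+ (j - i) * (s y * Y) ^+ i *+ 'C(j, i)) *: b t =
   \sum_t' s (if (ra t' == ra t + (j - i))%N && (rb t' == rb t + i)%N then
      'C(j, i)%:R * x ^+ (j - i) * y ^+ i else 0) *: b t'.
  have -> : (s x * X) ^+ (j - i) * (s y * Y) ^+ i *+ 'C(j, i) =
     s ('C(j, i)%:R * x ^+ (j - i) * y ^+ i) * (X ^+ (j - i) * Y ^+ i).
    rewrite !exprMn_comm; try exact: sC.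
    rewrite -[LHS]mulr_natl !rmorphM rmorph_nat !rmorphXn -!mulrA; congr (_ * (_ * _)).
    by rewrite !mulrA -!rmorphXn (sC (y ^+ i)).
  rewrite -scalerA hact scaler_sumr [LHS]big_mkcond; apply: eq_bigr => t' _.
  by case: ifP => // _; rewrite rmorph0 scale0r.
rewrite (eq_bigr _ (fun i _ => E i)) exchange_big; apply: eq_bigr => t' _.
rewrite -scaler_suml -rmorph_sum; congr (s _ *: _); rewrite !mxE /mono_entry.
case: ifPn => [/and3P[h1 h2 /eqP h3]|h].
  have ij : (rb t' - rb t < j.+1)%N by lia.
  rewrite (bigD1 (Ordinal ij)) //= big1 ?addr0 => [|i]; last first.
    rewrite -val_eqE /= => /eqP ni; case: ifP => // /andP[/eqP e1 /eqP e2]; lia.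
  rewrite ifT; last by apply/andP; split; apply/eqP; lia.
  have -> : (j - (rb t' - rb t) = ra t' - ra t)%N by lia.
  by congr (_%:R * _ * _); rewrite -bin_sub; [congr 'C(_, _); lia | lia].
rewrite big1 // => i _; case: ifP => // /andP[/eqP e1 /eqP e2]; case/negP: h.
by have := ltn_ord i; lia.
Qed.
End ScalarCombination.

Lemma exp_shift (k : fieldType) (y : k) a b t : y != 0 -> (b <= t)%N -> (a <= t)%N ->
  y ^+ (t - b) = y ^+ a / y ^+ b * y ^+ (t - a).
Proof.
move=> y0 bt at_; apply: (mulIf (expf_neq0 b y0)); rewrite -exprD subnK //.
by rewrite mulrAC divfK ?expf_neq0 // -exprD subnKC.
Qed.

(* In mono_mx, tc i is the column of the pivot y^j of the row fc i, and tf i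
   that of the pivot x^j of the row ff i. *)
Record mono_data (k : fieldType) (j r n : nat) (ra rb : 'I_n -> nat)
    (fc tc ff tf : 'I_r -> 'I_n) : Prop := MonoData {
  md_inj : forall t t', ra t = ra t' -> rb t = rb t' -> t = t';
  md_fc : injective fc; md_ff : injective ff;
  md_tca : forall i, ra (tc i) = ra (fc i);
  md_tcb : forall i, rb (tc i) = (rb (fc i) + j)%N;
  md_tfa : forall i, ra (tf i) = (ra (ff i) + j)%N;
  md_tfb : forall i, rb (tf i) = rb (ff i);
  md_rank : forall x y : k, (x != 0) || (y != 0) -> (\rank (mono_mx j ra rb x y) <= r)%N
}.

Section MonomialRank.
Variables (k : fieldType) (j r n : nat) (ra rb : 'I_n -> nat) (fc tc ff tf : 'I_r -> 'I_n).
Hypothesis md : mono_data k j ra rb fc tc ff tf.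
Let rab_inj := md_inj md.
Let fc_inj := md_fc md.
Let ff_inj := md_ff md.
Let tca := md_tca md.
Let tcb := md_tcb md.
Let tfa := md_tfa md.
Let tfb := md_tfb md.
Let rankW := md_rank md.
Local Notation W := (@mono_mx k n j ra rb).

(** Triangular in ra: a row with a nonzero entry in the column tc i has label ra at most that of fc
    i, and equality forces equal rb, hence the same row. *)
Lemma mono_row_free_c (x y : k) : y != 0 -> row_free (rowsub fc (W x y)).
Proof.
move=> y0; apply: (@row_free_tri _ _ _ _ _ _ tc (fun i => ra (fc i))) => [i|i i' ii].
  rewrite mxE /mono_entry tca tcb !leqnn leq_addr addnA eqxx subnn bin0 mul1r mul1r.
  by rewrite expf_neq0.
rewrite mxE => /mono_entryP[]; rewrite tca tcb ltn_neqAle => le1 _ e; rewrite le1 andbT.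
apply: contra_neqN ii => /eqP e1; apply/fc_inj/rab_inj; first exact: e1.
by move: e; rewrite e1 addnA => /addIn/addnI/esym.
Qed.

Lemma mono_row_free_f (x y : k) : x != 0 -> row_free (rowsub ff (W x y)).
Proof.
move=> x0; apply: (@row_free_tri _ _ _ _ _ _ tf (fun i => rb (ff i))) => [i|i i' ii].
  rewrite mxE /mono_entry tfa tfb !leqnn leq_addr addnAC eqxx subnn mulr1 addKn binn mul1r.
  by rewrite expf_neq0.
rewrite mxE => /mono_entryP[]; rewrite tfa tfb ltn_neqAle => _ le1 e; rewrite le1 andbT.
apply: contra_neqN ii => /eqP e1; apply/ff_inj/rab_inj; last exact: e1.
by move: e; rewrite e1 addnAC => /addIn/addIn/esym.
Qed.

Lemma mono_row_full (f : 'I_r -> 'I_n) (x y : k) : (x != 0) || (y != 0) ->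
  row_free (rowsub f (W x y)) -> (W x y <= rowsub f (W x y))%MS.
Proof.
move=> /rankW rW /eqP rf; rewrite -(geq_leqif (mxrank_leqif_sup (rowsub_sub f _))).
by rewrite rf.
Qed.

Local Notation mm f := (@mono_minor k n j r ra rb f).

(** Both families of rows are bases of the row space at x = y = 1, so their minors differ by the
    determinant of the base change. As the exponents are fixed by the labels, this one point
    compares the two charts everywhere. *)
Lemma mono_minor_change : exists2 u : k, u != 0 & forall T : r.-tuple 'I_n,
  mm ff T = u * mm fc T.
Proof.
have n0 : ((1 : k) != 0) || ((1 : k) != 0) by rewrite oner_neq0.
have Fc := mono_row_free_c 1 (oner_neq0 k); have Ff := mono_row_free_f 1 (oner_neq0 k).
have /submxP[G hG] : (rowsub ff (W 1 1) <= rowsub fc (W 1 1))%MS.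
  exact: submx_trans (rowsub_sub _ _) (mono_row_full n0 Fc).
exists (\det G) => [|T].
  rewrite -unitfE -[_ \is a _]/(G \in unitmx) -row_free_unit -row_leq_rank.
  by rewrite -{1}(eqP Ff) hG mxrankM_maxl.
rewrite /mono_minor /minor -det_mulmx; congr (\det _); apply/matrixP=> a c.
rewrite mxE hG !mxE; apply: eq_bigr => e _; congr (_ * _).
by rewrite [RHS]mxE.
Qed.

Lemma mono_minor_top (f t : 'I_r -> 'I_n) (x y : k) : injective t ->
    (forall a c, W x y (f a) (t c) = (a == c)%:R) ->
  exists2 T : r.-tuple 'I_n, increasing T & minor (rowsub f (W x y)) T != 0 /\
    forall h : 'I_n -> nat, (\sum_c h (tnth T c) = \sum_c h (t c))%N.
Proof.
move=> t_inj Wt; have [T [u [incT Tu]]] := increasing_enum t_inj; exists T => //; split.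
  rewrite /minor (_ : \matrix_(_, _) _ = perm_mx (u^-1)%g).
    by rewrite det_perm signr_eq0.
  apply/matrixP=> a c; rewrite 2![LHS]mxE Tu Wt 2![RHS]mxE; congr (_%:R).
  by rewrite -[in RHS](inj_eq (@perm_inj _ u)) permKV.
by move=> h; rewrite [RHS](reindex_inj (@perm_inj _ u)); apply: eq_bigr => c _; rewrite Tu.
Qed.

(* The Pluecker coordinates of the image, as monomials without common factor:
   the exponents are those of the minors for the rows fc in x and for the rows
   ff in y. *)
Definition pl_a (T : r.-tuple 'I_n) := (\sum_c ra (tnth T c) - \sum_a ra (fc a))%N.
Definition pl_b (T : r.-tuple 'I_n) := (\sum_c rb (tnth T c) - \sum_a rb (ff a))%N.
Definition pl_val (x y : k) T : k := mm fc T * x ^+ pl_a T * y ^+ pl_b T.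

Lemma mm_ff_neq0 T : mm fc T != 0 -> mm ff T != 0.
Proof. by have [u u0 ->] := mono_minor_change; rewrite mulf_eq0 negb_or u0. Qed.

(** The exponent of y is counted from the rows ff in [pl_val] and from the rows fc in the minor; the
    difference, of either sign, does not depend on T and is absorbed in c. *)
Lemma pl_val_c x y : y != 0 -> exists2 c, c != 0 &
  forall T, pl_val x y T = c * minor (rowsub fc (W x y)) T.
Proof.
move=> y0; exists (y ^+ (\sum_a rb (fc a)) / y ^+ (\sum_a rb (ff a))).
  by rewrite mulf_neq0 ?invr_eq0 ?expf_neq0.
move=> T; rewrite mono_minorE /pl_val; have [->|T0] := eqVneq (mm fc T) 0.
  by rewrite !mul0r mulr0.
have [_ h1 _] := mono_minor_support T0; have [_ h2 _] := mono_minor_support (mm_ff_neq0 T0).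
by rewrite /pl_b (exp_shift y0 h2 h1); ring.
Qed.

Lemma pl_val_f x y : x != 0 -> exists2 c, c != 0 &
  forall T, pl_val x y T = c * minor (rowsub ff (W x y)) T.
Proof.
move=> x0; have [u u0 hu] := mono_minor_change.
exists (x ^+ (\sum_a ra (ff a)) / x ^+ (\sum_a ra (fc a)) / u).
  by rewrite !mulf_neq0 ?invr_eq0 ?expf_neq0.
move=> T; rewrite mono_minorE /pl_val hu; have [->|T0] := eqVneq (mm fc T) 0.
  by rewrite mulr0 !mul0r mulr0.
have [h1 _ _] := mono_minor_support T0; have [h2 _ _] := mono_minor_support (mm_ff_neq0 T0).
rewrite /pl_a /pl_b (exp_shift x0 h1 h2); field; by rewrite ?u0 ?expf_neq0.
Qed.

Variable d : nat.
Hypothesis dE : (d + \sum_a rb (ff a) = j * r + \sum_a rb (fc a))%N.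

(** The labels of T exceed those of the rows fc by j r in total; counting the y-part from the rows
    ff instead changes this by the difference of the two sums of rb. *)
Lemma pl_degree T : mm fc T != 0 -> (pl_a T + pl_b T = d)%N.
Proof.
move=> T0; have [h1 _ h3] := mono_minor_support T0.
have [_ h2 _] := mono_minor_support (mm_ff_neq0 T0).
rewrite /pl_a /pl_b; lia.
Qed.

Lemma tc_inj : injective tc.
Proof.
move=> i i' e; apply/fc_inj/rab_inj; first by rewrite -!tca e.
by apply: (@addIn j); rewrite -!tcb e.
Qed.

Lemma tf_inj : injective tf.
Proof.
move=> i i' e; apply/ff_inj/rab_inj; last by rewrite -!tfb e.
by apply: (@addIn j); rewrite -!tfa e.
Qed.

(** At (x, y) = (0, 1) the rows fc and the columns tc meet in the identity matrix, so the coordinate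
    of these columns is a nonzero multiple of y^d. *)
Lemma pl_top_c : exists2 T, increasing T & mm fc T != 0 /\ pl_a T = 0%N /\ pl_b T = d.
Proof.
have Wt a c : W 0 1 (fc a) (tc c) = (a == c)%:R.
  rewrite mxE /mono_entry tca tcb; have [->|ac] := eqVneq a c.
    by rewrite !leqnn leq_addr addnA eqxx subnn bin0 expr0 expr1n !mulr1.
  case: ifP => // /and3P[h1 _ /eqP h3]; rewrite expr0n subn_eq0.
  case: leqP => h2; last by rewrite mulr0 mul0r.
  case/eqP: ac; apply/fc_inj/rab_inj; lia.
have [T incT [T0 Ts]] := mono_minor_top tc_inj Wt.
have Tn0 : mm fc T != 0.
  by apply: contraNneq T0 => T0; rewrite mono_minorE T0 !mul0r.
exists T => //; split=> //; have pa : pl_a T = 0%N.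
  by rewrite /pl_a Ts (eq_bigr (fun a => ra (fc a))) ?subnn.
by split=> //; have := pl_degree Tn0; rewrite pa.
Qed.

Lemma pl_top_f : exists2 T, increasing T & mm fc T != 0 /\ pl_a T = d /\ pl_b T = 0%N.
Proof.
have Wt a c : W 1 0 (ff a) (tf c) = (a == c)%:R.
  rewrite mxE /mono_entry tfa tfb; have [->|ac] := eqVneq a c.
    by rewrite !leqnn leq_addr addnAC eqxx subnn addKn binn expr0 expr1n !mulr1.
  case: ifP => // /and3P[_ h1 /eqP h3]; rewrite [0 ^+ _]expr0n subn_eq0.
  case: leqP => h2; last by rewrite mulr0.
  case/eqP: ac; apply/ff_inj/rab_inj; lia.
have [T incT [T0 Ts]] := mono_minor_top tf_inj Wt.
have Tn0 : mm fc T != 0.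
  have [u u0 hu] := mono_minor_change.
  by apply: contraNneq T0 => T0; rewrite mono_minorE hu T0 mulr0 !mul0r.
exists T => //; split=> //; have pb : pl_b T = 0%N.
  by rewrite /pl_b Ts (eq_bigr (fun a => rb (ff a))) ?subnn.
by split=> //; have := pl_degree Tn0; rewrite pb addn0.
Qed.
End MonomialRank.

Section MonomialModule.
Variables (k : fieldType) (p : nat) (g : pLie k p) (N : lmodType (U0 g)).
Variables (al be : {linear g -> k^o}) (x1 x2 : g).
Hypotheses (coordE : forall x, x = al x *: x1 + be x *: x2).
Hypotheses (al1 : al x1 = 1) (al2 : al x2 = 0) (be1 : be x1 = 0) (be2 : be x2 = 1).
Variables (X Y : U0 g) (j n r : nat) (ra rb : 'I_n -> nat) (b : 'I_n -> N).
Hypothesis iotaE : forall x, Defs.iota x = scal g (al x) * X + scal g (be x) * Y.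
Hypothesis XY : GRing.comm X Y.
Hypothesis hact : forall t l m, (X ^+ l * Y ^+ m) *: b t =
  \sum_(t' | (ra t' == ra t + l)%N && (rb t' == rb t + m)%N) b t'.
Hypothesis bB : sbasis (scal g) (fun=> True) b.
Variables fc tc ff tf : 'I_r -> 'I_n.
Hypothesis md : mono_data k j ra rb fc tc ff tf.
Local Notation W := (@mono_mx k n j ra rb).

Lemma coord_neq0 x : x != 0 -> (al x != 0) || (be x != 0).
Proof.
by move=> x0; rewrite -negb_and; apply: contraNN x0 => /andP[/eqP a0 /eqP b0];
  rewrite [x]coordE a0 b0 !scale0r addr0.
Qed.

Lemma mono_kbasis (f : 'I_r -> 'I_n) x : x != 0 -> row_free (rowsub f (W (al x) (be x))) ->
  kbasis (im_pow x j) (fun a => lincomb b (row a (rowsub f (W (al x) (be x))))).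
Proof.
move=> x0 ff'; have sC a : central (scal g a) by move=> u; exact: scal_comm.
have zb t : Defs.iota x ^+ j *: b t = scomb (scal g) b (row t (W (al x) (be x))).
  by rewrite (iotaE x); apply: (monomial_action sC XY hact).
exact: (sbasis_image sC bB zb ff' (mono_row_full md (coord_neq0 x0) ff')).
Qed.

Lemma mono_constant_jrank : constant_jrank_eq N j r.
Proof.
move=> x x0; case/orP: (coord_neq0 x0) => h.
  by eexists; apply: mono_kbasis x0 (mono_row_free_f md _ h).
by eexists; apply: mono_kbasis x0 (mono_row_free_c md _ h).
Qed.

Lemma jdegree_monomial d :
    (d + \sum_a rb (ff a) = j * r + \sum_a rb (fc a))%N -> jdegree N j d.
Proof.
move=> dE; pose F (T : r.-tuple 'I_n) : {mpoly k[\dim {:g}]} :=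
  mono_minor k j ra rb fc T *: (lform al ^+ pl_a ra fc T * lform be ^+ pl_b rb ff T).
have FE x T : (F T).@[fun i => coord (vbasis {:g}) i x] =
  pl_val j ra rb fc ff (al x : k) (be x : k) T.
  rewrite /F mevalZ rmorphM !rmorphXn /= !lform_eval /pl_val mulrA; exact: erefl.
exists r, n, b, F; split.
- exact: mono_constant_jrank.
- exact: bB.
- move=> T _; rewrite /F; have [->|T0] := eqVneq (mono_minor k j ra rb fc T) 0.
    by rewrite scale0r; apply: dhomog0.
  apply: dhomogZ; rewrite -(pl_degree md dE T0).
  have hX (l : g -> k) e : lform l ^+ e \is e.-homog.
    by have := dhomogMn e (lform_homog l); rewrite mul1n.
  by apply: dhomogM; apply: hX.
- move=> D hD; have [T incT [T0 [Ta Tb]]] := pl_top_c md dE.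
  have [T' incT' [T0' [Ta' Tb']]] := pl_top_f md dE.
  have [Q hQ] := hD T incT; have [Q' hQ'] := hD T' incT'.
  apply: (lform_coprime coordE al1 al2 be1 be2 T0' T0 (Q := Q') (Q' := Q) (d := d)).
    by rewrite -hQ' /F Ta' Tb' expr0 mulr1.
  by rewrite -hQ /F Ta Tb expr0 mul1r.
(* Where be x = 0 the other coordinate is nonzero and the rows ff give a basis of the image;
   elsewhere the rows fc do. *)
move=> x x0; have [b0|b0] := eqVneq (be x : k) 0.
  have a0 : (al x : k) != 0 by have := coord_neq0 x0; rewrite [be x == _](introT eqP b0) orbF.
  exists (rowsub ff (W (al x) (be x))); first exact: mono_kbasis x0 (mono_row_free_f md _ a0).
  have [c c0 hc] := pl_val_f md (be x : k) a0.
  exists c; first exact: c0.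
  by move=> T _; rewrite FE; apply: hc.
exists (rowsub fc (W (al x) (be x))); first exact: mono_kbasis x0 (mono_row_free_c md _ b0).
have [c c0 hc] := pl_val_c md (al x : k) b0.
exists c; first exact: c0.
by move=> T _; rewrite FE; apply: hc.
Qed.
End MonomialModule.

Lemma mono_entry_rev (k : fieldType) p j (x y : k) a b a' b' :
    (a < p)%N -> (b < p)%N -> (a' < p)%N -> (b' < p)%N ->
  mono_entry j x y (p.-1 - a') (p.-1 - b') (p.-1 - a) (p.-1 - b) = mono_entry j x y a b a' b'.
Proof.
move=> h1 h2 h3 h4; rewrite /mono_entry.
have -> : (p.-1 - a' <= p.-1 - a)%N = (a <= a')%N by lia.
have -> : (p.-1 - b' <= p.-1 - b)%N = (b <= b')%N by lia.
have -> : (p.-1 - a - (p.-1 - a') = a' - a)%N by lia.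
have -> : (p.-1 - b - (p.-1 - b') = b' - b)%N by lia.
by congr (if [&& _, _ & _] then _ else _); apply/eqP/eqP; lia.
Qed.

(** * Ranks and degrees for the two shapes *)

Section Shapes.
Variable p : nat.

Definition region (S : nat -> nat -> bool) : {set 'I_p * 'I_p} := [set z : 'I_p * 'I_p | S z.1 z.2].
Definition shape_a S (t : 'I_#|region S|) : nat := (enum_val t).1.
Definition shape_b S (t : 'I_#|region S|) : nat := (enum_val t).2.

Lemma shape_in S (t : 'I_#|region S|) : S (shape_a t) (shape_b t).
Proof. by have := enum_valP t; rewrite inE. Qed.

Lemma shape_ap S (t : 'I_#|region S|) : (shape_a t < p)%N.
Proof. exact: ltn_ord. Qed.

Lemma shape_bp S (t : 'I_#|region S|) : (shape_b t < p)%N.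
Proof. exact: ltn_ord. Qed.

Lemma shape_inj S (t t' : 'I_#|region S|) :
  shape_a t = shape_a t' -> shape_b t = shape_b t' -> t = t'.
Proof.
move=> ha hb; apply: enum_val_inj; move: ha hb; rewrite /shape_a /shape_b.
by case: (enum_val t) (enum_val t') => a b [a' b'] /= /val_inj -> /val_inj ->.
Qed.

Lemma shape_ex (S : nat -> nat -> bool) a b : S a b -> (a < p)%N -> (b < p)%N ->
  exists t : 'I_#|region S|, shape_a t = a /\ shape_b t = b.
Proof.
move=> Sab ap bp; have zS : (Ordinal ap, Ordinal bp) \in region S by rewrite inE.
by exists (enum_rank_in zS (Ordinal ap, Ordinal bp)); rewrite /shape_a /shape_b enum_rankK_in.
Qed.

Lemma sum_shape S (Q : nat -> nat -> bool) (h : nat -> nat -> nat) :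
  (\sum_(t : 'I_#|region S| | Q (shape_a t) (shape_b t)) h (shape_a t) (shape_b t) =
   \sum_(a < p) \sum_(b < p | S a b && Q a b) h a b)%N.
Proof.
rewrite pair_big_dep /= (eq_bigl (fun z => (z \in region S) && Q z.1 z.2)); last by move=> z;
  rewrite inE.
by rewrite [RHS]big_enum_val_cond.
Qed.

Lemma set_enum n r (K : {set 'I_n}) : #|K| = r -> exists f : 'I_r -> 'I_n,
  [/\ injective f, forall c, f c \in K, forall t, t \in K -> exists c, t = f c &
   forall h : 'I_n -> nat, (\sum_c h (f c) = \sum_(t in K) h t)%N].
Proof.
move=> <-; exists enum_val; split.
- exact: enum_val_inj.
- exact: enum_valP.
- by move=> t tK; exists (enum_rank_in tK t); rewrite enum_rankK_in.
by move=> h; rewrite [RHS]big_enum_val.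
Qed.

Lemma sum_interval (P : nat -> bool) lo hi (h : nat -> nat) : (hi <= p)%N ->
    (forall b, (b < p)%N -> P b = (lo <= b < hi)%N) ->
  (\sum_(b < p | P b) h b = \sum_(lo <= b < hi) h b)%N.
Proof.
move=> hip hP; rewrite (big_nat_widenl _ 0%N) // (big_nat_widen _ _ p) // big_mkord.
by apply: eq_bigl => b; rewrite hP.
Qed.

Lemma sum_steps (G : nat -> nat) c1 c2 v u : (c1 <= c2)%N -> (c2 <= p)%N ->
    (forall a, (a < c1)%N -> G a = v) -> (forall a, (c1 <= a < c2)%N -> G a = u) ->
    (forall a, (c2 <= a < p)%N -> G a = 0)%N ->
  (\sum_(a < p) G a = c1 * v + (c2 - c1) * u)%N.
Proof.
move=> c12 c2p h1 h2 h3; rewrite -(big_mkord xpredT G).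
rewrite (big_cat_nat (leq0n c1) (leq_trans c12 c2p)) (big_cat_nat c12 c2p) /=.
rewrite [X in (_ + (_ + X))%N]big_nat [X in (_ + (_ + X))%N]big1 ?addn0 => [|a /h3 //].
rewrite big_nat (eq_bigr (fun=> v)) => [|a /h1 //]; rewrite -big_nat sum_nat_const_nat subn0.
by rewrite big_nat (eq_bigr (fun=> u)) => [|a /h2 //]; rewrite -big_nat sum_nat_const_nat.
Qed.

(** The index sets used below are staircases with two steps in the direction of a; h = 1 gives their
    cardinality and the identity the sum of b. *)
Lemma sum_steps2 S (Q : nat -> nat -> bool) h c1 c2 lo1 hi1 lo2 hi2 :
    (c1 <= c2)%N -> (c2 <= p)%N -> (hi1 <= p)%N -> (hi2 <= p)%N ->
    (forall a b, (a < p)%N -> (b < p)%N -> S a b && Q a b =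
      if (a < c1)%N then (lo1 <= b < hi1)%N else (a < c2)%N && (lo2 <= b < hi2)%N) ->
  (\sum_(t : 'I_#|region S| | Q (shape_a t) (shape_b t)) h (shape_b t) =
   c1 * (\sum_(lo1 <= b < hi1) h b) + (c2 - c1) * (\sum_(lo2 <= b < hi2) h b))%N.
Proof.
move=> c12 c2p h1p h2p SQ; rewrite (sum_shape S Q (fun _ b => h b)).
apply: (@sum_steps (fun a => \sum_(b < p | S a b && Q a b) h b)%N) => // a ha.
- by apply: (@sum_interval (fun b => S a b && Q a b)) => // b bp; rewrite SQ ?ha //; lia.
- have /andP[a1 a2] := ha; apply: (@sum_interval (fun b => S a b && Q a b)) => // b bp;
  rewrite SQ ?a2 //; last by lia.
  by rewrite ltnNge a1.
- rewrite big1 // => b /idP; rewrite SQ //; last by lia.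
  by case: ifP => [|_]; lia.
Qed.

Lemma sum_iota m lo : (lo <= 1)%N -> (\sum_(lo <= b < m) b = 'C(m, 2))%N.
Proof.
case: lo => [|[|//]] _; first by rewrite -triangular_sum; apply: eq_bigr.
by case: m => [|m]; [rewrite big_geq // | rewrite -bin2_sum [RHS]big_ltn //].
Qed.
End Shapes.

Section ShapeRanks.
Variables (k : fieldType) (p i j : nat).
Hypotheses (hp : p \in [pchar k]) (p3 : (3 <= p)%N) (hi : (i <= p - 2)%N)
  (hj : (1 <= j <= p - i - 1)%N).

Definition pl_rank := (p * (p - j) - i.+1)%N.

(* The rows fc (ff) of the matrix of the j-th power of x X + y Y give a basis
   of its image where y (x) is invertible. *)
Lemma shape_rows S :
    (#|[set t : 'I_#|region p S| | S (shape_a t) (shape_b t + j)%N && (shape_b t + j < p)%N]|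
      = pl_rank) ->
    (#|[set t : 'I_#|region p S| | S (shape_a t + j)%N (shape_b t) && (shape_a t + j < p)%N]|
      = pl_rank) ->
  exists fc tc ff tf : 'I_pl_rank -> 'I_#|region p S|,
  [/\ injective fc /\ injective ff,
    (forall c, shape_a (tc c) = shape_a (fc c) /\ shape_b (tc c) = (shape_b (fc c) + j)%N) /\
    (forall c, shape_a (tf c) = (shape_a (ff c) + j)%N /\ shape_b (tf c) = shape_b (ff c)),
    (forall t, S (shape_a t) (shape_b t + j)%N -> (shape_b t + j < p)%N -> exists c, t = fc c),
    (forall t, S (shape_a t + j)%N (shape_b t) -> (shape_a t + j < p)%N -> exists c, t = ff c) &
    (\sum_c shape_b (fc c) =
     \sum_(t : 'I_#|region p S| | S (shape_a t) (shape_b t + j) && (shape_b t + j < p)) shape_b t)%N /\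
    (\sum_c shape_b (ff c) =
     \sum_(t : 'I_#|region p S| | S (shape_a t + j) (shape_b t) && (shape_a t + j < p)) shape_b t)%N].
Proof.
move=> /set_enum[fc [fcI fcK fcS fch]] /set_enum[ff [ffI ffK ffS ffh]].
have /fin_all_exists[tc htc] : forall c, exists t : 'I_#|region p S|,
    shape_a t = shape_a (fc c) /\ shape_b t = (shape_b (fc c) + j)%N.
  by move=> c; have := fcK c; rewrite inE => /andP[h1 h2]; apply: shape_ex => //; apply: shape_ap.
have /fin_all_exists[tf htf] : forall c, exists t : 'I_#|region p S|,
    shape_a t = (shape_a (ff c) + j)%N /\ shape_b t = shape_b (ff c).
  by move=> c; have := ffK c; rewrite inE => /andP[h1 h2]; apply: shape_ex => //; apply: shape_bp.
exists fc, tc, ff, tf; split=> //.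
- by move=> t h1 h2; apply: fcS; rewrite inE h1.
- by move=> t h1 h2; apply: ffS; rewrite inE h1.
by rewrite fch ffh; split; apply: eq_bigl => t; rewrite inE.
Qed.

Let S1 := in_rad i.
Let S3 := in_dual p i.

Lemma card_set_sum n (P : pred 'I_n) : #|[set t | P t]| = (\sum_(t | P t) 1)%N.
Proof. by rewrite sum1dep_card. Qed.

Lemma rad_sum_c h : (\sum_(t : 'I_#|region p S1| |
  S1 (shape_a t) (shape_b t + j) && (shape_b t + j < p)) h (shape_b t)
  = i.+1 * (\sum_(1 <= b < p - j) h b) + (p - i.+1) * (\sum_(0 <= b < p - j) h b))%N.
Proof.
apply: (sum_steps2 (Q := fun a b => S1 a (b + j)%N && (b + j < p)%N)); rewrite ?leq_subr //;
  first by lia.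
by move=> a b ap bp; rewrite /S1 /in_rad; case: ifP; lia.
Qed.

Lemma rad_sum_f h : (\sum_(t : 'I_#|region p S1| |
  S1 (shape_a t + j) (shape_b t) && (shape_a t + j < p)) h (shape_b t)
  = i.+1 * (\sum_(1 <= b < p) h b) + (p - j - i.+1) * (\sum_(0 <= b < p) h b))%N.
Proof.
apply: (sum_steps2 (Q := fun a b => S1 (a + j)%N b && (a + j < p)%N)); rewrite ?leq_subr //;
  first by lia.
by move=> a b ap bp; rewrite /S1 /in_rad; case: ifP; lia.
Qed.

Lemma dual_sum_c h : (\sum_(t : 'I_#|region p S3| |
  S3 (shape_a t) (shape_b t + j) && (shape_b t + j < p)) h (shape_b t)
  = (p.-1 - i) * (\sum_(0 <= b < p - j) h b) + (p - (p.-1 - i)) * (\sum_(0 <= b < p.-1 - j) h b))%N.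
Proof.
apply: (sum_steps2 (Q := fun a b => S3 a (b + j)%N && (b + j < p)%N)); rewrite ?leq_subr //;
  try by lia.
by move=> a b ap bp; rewrite /S3 /in_dual; case: ifP; lia.
Qed.

Lemma dual_sum_f h : (\sum_(t : 'I_#|region p S3| |
  S3 (shape_a t + j) (shape_b t) && (shape_a t + j < p)) h (shape_b t)
  = (p.-1 - i - j) * (\sum_(0 <= b < p) h b) + (p - j - (p.-1 - i - j)) *
    (\sum_(0 <= b < p.-1) h b))%N.
Proof.
apply: (sum_steps2 (Q := fun a b => S3 (a + j)%N b && (a + j < p)%N)); rewrite ?leq_subr //;
  try by lia.
by move=> a b ap bp; rewrite /S3 /in_dual; case: ifP; lia.
Qed.

Lemma sum1_nat lo m : (\sum_(lo <= b < m) 1 = m - lo)%N.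
Proof. by rewrite sum_nat_const_nat muln1. Qed.

(** The relation [mono_entry_rel] has the leading coefficient y^(p-j); for y = 0 the same argument
    is run with the two variables exchanged. *)
Lemma rad_rank (fc ff : 'I_pl_rank -> 'I_#|region p S1|) (x y : k) :
    (forall t, S1 (shape_a t) (shape_b t + j)%N -> (shape_b t + j < p)%N -> exists c, t = fc c) ->
    (forall t, S1 (shape_a t + j)%N (shape_b t) -> (shape_a t + j < p)%N -> exists c, t = ff c) ->
  (x != 0) || (y != 0) -> (\rank (mono_mx j (@shape_a p S1) (@shape_b p S1) x y) <= pl_rank)%N.
Proof.
have jp : (j <= p)%N by lia.
move=> hfc hff xy; set W := mono_mx _ _ _ _ _.
suff [V WV] : exists V : 'M[k]_(pl_rank, #|region p S1|), (W <= V)%MS.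
  exact: leq_trans (mxrankS WV) (rank_leq_row V).
have [y0|y0] := eqVneq y 0.
  have x0 : x != 0 by rewrite y0 eqxx orbF in xy.
  exists (rowsub ff W); apply/row_subP => t.
  pose R b a : 'rV[k]_#|region p S1| := \row_t mono_entry j x y a b (shape_a t) (shape_b t).
  have -> : row t W = R (shape_b t) (shape_a t) by apply/rowP=> u; rewrite !mxE.
  apply: (@span_by_relation k p j _ _ (fun b a => [&& S1 a b, a < p & b < p]%N) R (rowsub ff W)
     (fun l => 'C(p - j, l)%:R * y ^+ l * x ^+ (p - j - l))).
  - by rewrite bin0 expr0 !mul1r subn0 expf_neq0.
  - move=> b a /and3P[Sab ap bp] aj; have [u [ua ub]] := shape_ex Sab ap bp.
    have [||c uc] := hff u; [by move: Sab; rewrite ua ub /S1 /in_rad; lia | by rewrite ua | ].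
    have -> : R b a = row c (rowsub ff W) by apply/rowP=> v; rewrite !mxE -uc ua ub.
    exact: row_sub.
  - move=> b a pb; apply/rowP=> u; rewrite !mxE; apply/eqP;
    apply: contraTT pb => /mono_entryP[_ h _].
    by rewrite -ltnNge; apply: leq_ltn_trans h (shape_bp u).
  - move=> b a l; rewrite /S1 /in_rad; lia.
  - move=> b a pa; apply/rowP=> u; rewrite summxE mxE.
    rewrite -[RHS](@mono_entry_rel k p j y x b a (shape_b u) (shape_a u) hp jp pa (shape_bp u) (shape_ap u)).
    by apply: eq_bigr => l _; rewrite !mxE mono_entry_sym.
  by rewrite shape_in shape_ap shape_bp.
exists (rowsub fc W); apply/row_subP => t.
pose R a b : 'rV[k]_#|region p S1| := \row_t mono_entry j x y a b (shape_a t) (shape_b t).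
have -> : row t W = R (shape_a t) (shape_b t) by apply/rowP=> u; rewrite !mxE.
apply: (@span_by_relation k p j _ _ (fun a b => [&& S1 a b, a < p & b < p]%N) R (rowsub fc W)
   (fun l => 'C(p - j, l)%:R * x ^+ l * y ^+ (p - j - l))).
- by rewrite bin0 expr0 !mul1r subn0 expf_neq0.
- move=> a b /and3P[Sab ap bp] bj; have [u [ua ub]] := shape_ex Sab ap bp.
  have [||c uc] := hfc u; [by move: Sab; rewrite ua ub /S1 /in_rad; lia | by rewrite ub | ].
  have -> : R a b = row c (rowsub fc W) by apply/rowP=> v; rewrite !mxE -uc ua ub.
  exact: row_sub.
- move=> a b pa; apply/rowP=> u; rewrite !mxE; apply/eqP; apply: contraTT pa => /mono_entryP[h _ _].
  by rewrite -ltnNge; apply: leq_ltn_trans h (shape_ap u).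
(* If b - l = 0, then l = b = p - j >= i + 1, so the shifted pair meets the condition on the first
   index. Here j <= p - i - 1 enters. *)
- move=> a b l; rewrite /S1 /in_rad; lia.
- move=> a b pb; apply/rowP=> u; rewrite summxE mxE.
  rewrite -[RHS](@mono_entry_rel k p j x y a b (shape_a u) (shape_b u) hp jp pb (shape_ap u) (shape_bp u)).
  by apply: eq_bigr => l _; rewrite !mxE.
by rewrite shape_in shape_ap shape_bp.
Qed.

Lemma bin2_double m : (2 * 'C(m, 2) = m * m.-1)%N.
Proof. by case: m => [|m] //; rewrite -mul_bin_diag bin1. Qed.

Lemma pl_rankE : (pl_rank + i.+1 = p * (p - j))%N.
Proof. by rewrite /pl_rank subnK //; nia. Qed.

(** On the full square the sums of b over the two families of rows would be p 'C(p - j, 2) and (p -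
    j) 'C(p, 2); the identity compares their difference with j r. *)
Lemma pl_degree_id : (2 * (j * pl_rank + p * 'C(p - j, 2)) + 2 * (j * i.+1) =
  2 * ((p - j) * 'C(p, 2)) + j * (p * (p - j)))%N.
Proof.
have [m mE] : exists m, p = (m.+1 + j)%N by exists (p - j).-1; lia.
have mE' : (p - j = m.+1)%N by lia.
have := pl_rankE; have := bin2_double m.+1; have := bin2_double p; rewrite mE'.
set u := 'C(m.+1, 2); set v := 'C(p, 2) => hv hu rE.
have -> : (2 * (j * pl_rank + p * u) + 2 * (j * i.+1) = 2 * (j * (pl_rank + i.+1)) +
  p * (2 * u))%N by ring.
by rewrite rE hu (mulnCA 2 m.+1 v) hv mE addSn /=; ring.
Qed.

(** The i + 1 pairs missing from each family of rows have b = 0, so the sums of b are those of the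
    full square and only j r drops, by j (i + 1). *)
Lemma rad_shape : exists fc tc ff tf,
  @mono_data k j pl_rank _ (@shape_a p S1) (@shape_b p S1) fc tc ff tf /\
  exists d, (d + \sum_c shape_b (ff c) = j * pl_rank + \sum_c shape_b (fc c))%N /\
    (2 * d + 2 * (j * i.+1) = j * (p * (p - j)))%N.
Proof.
have rE := pl_rankE.
have [m [mE im]] : exists m, (p = m + j)%N /\ (i.+1 <= m)%N by exists (p - j)%N; lia.
have mE' : (p - j = m)%N by lia.
have kc : #|[set t : 'I_#|region p S1| |
  S1 (shape_a t) (shape_b t + j)%N && (shape_b t + j < p)%N]| = pl_rank.
  rewrite card_set_sum (rad_sum_c (fun=> 1%N)) !sum1_nat subn0; nia.
have kf : #|[set t : 'I_#|region p S1| |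
  S1 (shape_a t + j)%N (shape_b t) && (shape_a t + j < p)%N]| = pl_rank.
  rewrite card_set_sum (rad_sum_f (fun=> 1%N)) !sum1_nat subn0; nia.
have [fc [tc [ff [tf [[fcI ffI] [htc htf] hfc hff [sc sf]]]]]] := shape_rows kc kf.
exists fc, tc, ff, tf; split.
  split=> //.
  - exact: shape_inj.
  - by move=> c; case: (htc c).
  - by move=> c; case: (htc c).
  - by move=> c; case: (htf c).
  - by move=> c; case: (htf c).
  by move=> x y xy; apply: (rad_rank hfc hff xy).
rewrite sc sf (rad_sum_c id) (rad_sum_f id) !sum_iota // mE'.
have E : (2 * (j * pl_rank + p * 'C(m, 2)) + 2 * (j * i.+1) = 2 * (m * 'C(p, 2)) + j * (p * m))%N.
  by have := pl_degree_id; rewrite mE'.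
exists (j * pl_rank + (i.+1 * 'C(m, 2) + (p - i.+1) * 'C(m, 2)) -
  (i.+1 * 'C(p, 2) + (m - i.+1) * 'C(p, 2)))%N.
rewrite -!mulnDl !subnKC //; last by lia.
have F : (2 * (j * i.+1) <= j * (p * m))%N.
  by rewrite mulnCA leq_mul2l leq_mul ?orbT //; lia.
move: (j * pl_rank)%N (p * _)%N (m * _)%N (j * i.+1)%N (j * (p * m))%N E F => *; lia.
Qed.

(** Reflecting the square turns the matrix into the transpose of a submatrix of the one for
    [in_rad]. *)
Lemma dual_rank (x y : k) : (x != 0) || (y != 0) ->
  (\rank (mono_mx j (@shape_a p S3) (@shape_b p S3) x y) <= pl_rank)%N.
Proof.
move=> xy; have [fc [tc [ff [tf [/md_rank/(_ x y xy) rk _]]]]] := rad_shape.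
have /fin_all_exists[th hth] : forall t : 'I_#|region p S3|, exists u : 'I_#|region p S1|,
    shape_a u = (p.-1 - shape_a t)%N /\ shape_b u = (p.-1 - shape_b t)%N.
  move=> t; have := shape_in t; have := shape_ap t; have := shape_bp t => hb ha hS.
  by apply: shape_ex; [move: hS; rewrite /S1 /S3 /in_rad /in_dual; lia | lia | lia].
set W1 := mono_mx _ _ _ _ _ in rk; set W3 := mono_mx _ _ _ _ _.
have -> : W3 = (colsub th (rowsub th W1))^T.
  apply/matrixP=> u v; rewrite !mxE; have [au bu] := hth u; have [av bv] := hth v.
  by rewrite au bu av bv mono_entry_rev ?shape_ap ?shape_bp.
rewrite mxrank_tr; apply: leq_trans rk.
rewrite -mxrank_tr trmx_mxsub; apply: leq_trans (mxrankS (rowsub_sub _ _)) _.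
by rewrite mxrank_tr mxrankS // rowsub_sub.
Qed.

(** Here the i + 1 missing pairs have b = p - 1 - j in the family fc and b = p - 1 in the family ff;
    the resulting change j (i + 1) in the difference of the sums makes up for the drop of j r. *)
Lemma dual_shape : exists fc tc ff tf,
  @mono_data k j pl_rank _ (@shape_a p S3) (@shape_b p S3) fc tc ff tf /\
  exists d, (d + \sum_c shape_b (ff c) = j * pl_rank + \sum_c shape_b (fc c))%N /\
    (2 * d = j * (p * (p - j)))%N.
Proof.
have rE := pl_rankE.
have [m [mE im]] : exists m, (p = m + j)%N /\ (i.+1 <= m)%N by exists (p - j)%N; lia.
have mE' : (p - j = m)%N by lia.
have kc : #|[set t : 'I_#|region p S3| |
  S3 (shape_a t) (shape_b t + j)%N && (shape_b t + j < p)%N]| = pl_rank.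
  rewrite card_set_sum (dual_sum_c (fun=> 1%N)) !sum1_nat !subn0; nia.
have kf : #|[set t : 'I_#|region p S3| |
  S3 (shape_a t + j)%N (shape_b t) && (shape_a t + j < p)%N]| = pl_rank.
  rewrite card_set_sum (dual_sum_f (fun=> 1%N)) !sum1_nat !subn0; nia.
have [fc [tc [ff [tf [[fcI ffI] [htc htf] hfc hff [sc sf]]]]]] := shape_rows kc kf.
exists fc, tc, ff, tf; split.
  split=> //.
  - exact: shape_inj.
  - by move=> c; case: (htc c).
  - by move=> c; case: (htc c).
  - by move=> c; case: (htf c).
  - by move=> c; case: (htf c).
  exact: dual_rank.
rewrite sc sf (dual_sum_c id) (dual_sum_f id) !sum_iota // mE'.
have E : (2 * (j * pl_rank + p * 'C(m, 2)) + 2 * (j * i.+1) = 2 * (m * 'C(p, 2)) + j * (p * m))%N.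
  by have := pl_degree_id; rewrite mE'.
have binP l : (0 < l)%N -> ('C(l, 2) = 'C(l.-1, 2) + l.-1)%N.
  by case: l => // l _; rewrite binS bin1.
have c1 : (p - (p.-1 - i) = i.+1)%N by lia.
have c2 : (m - (p.-1 - i - j) = i.+1)%N by lia.
have c3 : (p.-1 - j = m.-1)%N by lia.
rewrite c1 c2 c3; set A := (_ * _ + _ * 'C(m.-1, 2))%N; set B := (_ * _ + _ * 'C(p.-1, 2))%N.
have hA : (A + i.+1 * m.-1 = p * 'C(m, 2))%N.
  rewrite /A -addnA -mulnDr -binP; last by lia.
  by rewrite -mulnDl; congr (_ * _)%N; lia.
have hB : (B + i.+1 * m.-1 + j * i.+1 = m * 'C(p, 2))%N.
  have -> : (B + i.+1 * m.-1 + j * i.+1 = B + i.+1 * p.-1)%N.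
    by rewrite -addnA mulnC -mulnDl mulnC; congr (_ + _ * _)%N; lia.
  rewrite /B -addnA -mulnDr -binP; last by lia.
  by rewrite -mulnDl; congr (_ * _)%N; lia.
exists (j * pl_rank + A - B)%N.
move: E hA hB; clear; move: (j * pl_rank)%N (p * _)%N (m * _)%N (j * i.+1)%N
  (j * (p * m))%N (i.+1 * _)%N => *; lia.
Qed.
End ShapeRanks.

(** * The modules Z(i) and Z'(i) *)

Section InducedModule.
Variables (k : fieldType) (B A : pzRingType) (phi : {rmorphism B -> A}).
Variables (w : {rmorphism B -> k}) (sB : {rmorphism k -> B}).
Hypothesis wK : forall a, w (sB a) = a.
Local Notation L := (restr_mod w k^o).
Local Notation ind := (tens phi L).

Definition ind_vec : ind := tens_pi phi [:: (1, 1 : L)].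

Lemma ind_scaleE u : u *: ind_vec = tens_pi phi [:: (u, 1 : L)].
Proof.
rewrite -[u *: _]/(tens_scale u (tens_pi phi [:: (1, 1 : L)])).
by rewrite -tens_pi_scale /tens_map /= mulr1.
Qed.

Lemma ind_scalar (m : L) : m = sB (m : k) *: (1 : L).
Proof. by rewrite -[RHS]/(w (sB (m : k)) * 1) wK mulr1. Qed.

Lemma ind_pi1 a (m : L) : tens_pi phi [:: (a, m)] = (a * phi (sB (m : k))) *: ind_vec.
Proof.
rewrite ind_scaleE {1}[m]ind_scalar; apply/tens_piE/tens_sym; exact: tens_bal.
Qed.

Lemma ind_gen (x : ind) : exists u, x = u *: ind_vec.
Proof.
rewrite -[x]tens_reprK; elim: (tens_repr x) => [|[a m] l [u hu]].
  by exists 0; rewrite scale0r.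
exists (a * phi (sB (m : k)) + u); rewrite scalerDl -ind_pi1 -hu.
exact: (tens_pi_add phi [:: (a, m)] l).
Qed.

Lemma ind_weight b : phi b *: ind_vec = phi (sB (w b)) *: ind_vec.
Proof.
rewrite !ind_scaleE -[phi b]mul1r -[phi (sB _)]mul1r; apply/tens_piE.
apply: tens_trans (tens_sym (tens_bal _ _ _ _)); apply: tens_trans (tens_bal _ _ _ _) _.
by rewrite -[sB (w b) *: _]/(w (sB (w b)) * 1) wK; apply: tens_refl.
Qed.

Section Faithful.
Variables (R : pzRingType) (rho : {rmorphism A -> R}) (v : R).
Hypothesis rho_w : forall b, rho (phi b) * v = rho (phi (sB (w b))) * v.

Definition ind_eval (l : seq (A * L)) : R :=
  \sum_(x <- l) rho x.1 * (rho (phi (sB (x.2 : k))) * v).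

Lemma ind_eval_rel l l' : tens_rel phi l l' -> ind_eval l = ind_eval l'.
Proof.
rewrite /ind_eval; elim=> {l l'} [//|l l' _ -> //|l l' l'' _ -> _ ->
  //|s s' t t' _ h1 _ h2|s t|m|a a' m|a m m'|a b m].
- by rewrite !big_cat /= h1 h2.
- by rewrite !big_cat /= addrC.
- by rewrite big_seq1 big_nil rmorph0 mul0r.
- by rewrite !big_cons !big_nil !addr0 rmorphD mulrDl.
- by rewrite !big_cons !big_nil !addr0 -mulrDr -mulrDl -!rmorphD.
rewrite !big_seq1 /= rmorphM -mulrA; congr (_ * _).
rewrite mulrA -!rmorphM rho_w; congr (rho (phi (sB _)) * v).
by rewrite rmorphM wK.
Qed.

(** Frobenius reciprocity: v is an eigenvector of B with character w, so sending a tensor m to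
    rho(a) m v is well defined on the induced module. *)
Lemma ind_faithful u : u *: ind_vec = 0 -> rho u * v = 0.
Proof.
rewrite ind_scaleE => /tens_piE/ind_eval_rel.
by rewrite /ind_eval big_nil big_seq1 /= !rmorph1 mul1r.
Qed.
End Faithful.
End InducedModule.

Lemma restr_sbasis (k : fieldType) (B A : pzRingType) (phi : {rmorphism B -> A})
    (sB : {rmorphism k -> B}) (s : {rmorphism k -> A}) (M : lmodType A) n (b : 'I_n -> M) :
    (forall a, phi (sB a) = s a) -> sbasis s (fun=> True) b ->
  sbasis (N := restr_mod phi M) sB (fun=> True) b.
Proof.
move=> phis [_ bS bI].
have E a : scomb (N := restr_mod phi M) sB b a = scomb s b a.
  by apply: eq_bigr => i _; rewrite -phis.
split=> // [v _|a]; last by rewrite E; apply: bI.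
by have [a ->] := bS v I; exists a.
Qed.

(** * Bases of the three modules indexed by shapes *)

Section ShapeBasis.
Variables (k : fieldType) (p : nat) (U : pzRingType) (s : {rmorphism k -> U}) (M : lmodType U).
Variables (S : nat -> nat -> bool) (v : nat -> nat -> M).
Definition shape_vec (t : 'I_#|region p S|) : M := v (shape_a t) (shape_b t).

Lemma shape_act (X Y : U) :
    (forall a b l m, S a b -> (X ^+ l * Y ^+ m) *: v a b = v (a + l)%N (b + m)%N) ->
    (forall a b l m, S a b -> ~~ [&& S (a + l) (b + m), a + l < p & b + m < p]%N ->
       v (a + l)%N (b + m)%N = 0) ->
  forall t l m, (X ^+ l * Y ^+ m) *: shape_vec t =
    \sum_(t' | (shape_a t' == shape_a t + l)%N && (shape_b t' == shape_b t + m)%N) shape_vec t'.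
Proof.
move=> act out t l m; rewrite act ?shape_in //.
have [/and3P[h1 h2 h3]|h] := boolP [&& S (shape_a t + l) (shape_b t + m),
  shape_a t + l < p & shape_b t + m < p]%N.
  have [u [ua ub]] := shape_ex h1 h2 h3; rewrite (big_pred1 u) ?/shape_vec ?ua ?ub // => t'.
  rewrite /= -ua -ub; apply/andP/eqP => [[/eqP e1 /eqP e2]|-> //]; exact: shape_inj.
rewrite out ?shape_in // big_pred0 // => t'; apply: contraNF h => /andP[/eqP <- /eqP <-].
by rewrite shape_in shape_ap shape_bp.
Qed.

Lemma shape_kspan x : (forall a b, S a b -> ~~ (a < p)%N || ~~ (b < p)%N -> v a b = 0) ->
    kspan s (fun y => exists a b, S a b /\ y = v a b) x ->
  exists u, x = scomb s shape_vec u.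
Proof.
move=> out; elim=> [|c _ y [a [b [Sab ->]]] _ [u ->]].
  by exists 0; rewrite /scomb big1 // => i _; rewrite mxE rmorph0 scale0r.
have [/andP[ap bp]|h] := boolP ((a < p) && (b < p))%N; last first.
  by exists u; rewrite out ?scaler0 ?add0r //; move: h; rewrite negb_and.
have [t [ta tb]] := shape_ex Sab ap bp; exists (c *: delta_mx 0 t + u).
have -> : scomb s shape_vec (c *: delta_mx 0 t + u) =
  s c *: scomb s shape_vec (delta_mx 0 t) + scomb s shape_vec u.
  rewrite /scomb scaler_sumr -big_split; apply: eq_bigr => i _.
  by rewrite !mxE rmorphD rmorphM scalerDl scalerA.
by rewrite scomb_delta /shape_vec ta tb.
Qed.
End ShapeBasis.

Section VermaBases.
Variables (k : fieldType) (p : nat) (U : pzRingType) (s : {rmorphism k -> U}).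
Variables (E F T C : U) (M : lmodType U) (v0 : M) (i : nat).
Hypotheses (hp : p \in [pchar k]) (hi : (i <= p - 2)%N) (p3 : (3 <= p)%N).
Hypothesis V : verma p s E F T C v0 i.
Local Notation vm := (vm F C v0).
Local Notation vtop := (vtop p E F C v0).

Lemma vm_shape_indep (S : nat -> nat -> bool) u : scomb s (@shape_vec p U M S vm) u = 0 -> u = 0.
Proof.
pose x a b := \sum_t (if (shape_a t == a) && (shape_b t == b) then u 0 t else 0).
have -> : scomb s (@shape_vec p U M S vm) u = vcomb p s F C v0 x.
  rewrite /vcomb pair_bigA /=; under [RHS]eq_bigr do rewrite /x rmorph_sum scaler_suml.
  rewrite exchange_big; apply: eq_bigr => t _.
  rewrite (bigD1 (enum_val t)) //= !eqxx big1 ?addr0 // => z zt.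
  case: ifP => [/andP[/eqP h1 /eqP h2]|]; last by rewrite rmorph0 scale0r.
  case/eqP: zt; move: h1 h2; rewrite /shape_a /shape_b.
  by case: z (enum_val t) => a b [a' b'] /= /val_inj -> /val_inj ->.
move=> /(vcomb_indep hp hi p3 V) x0; apply/rowP=> t; rewrite mxE.
rewrite -(x0 _ _ (shape_ap t) (shape_bp t)) /x (bigD1 t) //= !eqxx big1 ?addr0 // => t' tt'.
case: ifP => // /andP[/eqP h1 /eqP h2]; case/eqP: tt'; exact: shape_inj.
Qed.

(** The value 0 outside the radical is a default; the vectors used below all lie in the radical. *)
Definition rad_vec (x : M) : rad_mod M := insubd (0 : rad_mod M) x.

Lemma val_rad_vec x : kspan s (vgen F C v0 (in_rad i)) x -> val (rad_vec x) = x.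
Proof.
move=> hx; apply: insubdK; rewrite (Rad_verma hp hi p3 V); exact/rad_predP.
Qed.

Definition rad_vm a b := rad_vec (vm a b).
Definition rad_vtop a b := rad_vec (vtop a b).

Let in_radS a b : in_rad i a b -> val (rad_vm a b) = vm a b.
Proof. by move=> h; apply/val_rad_vec/vgen_in. Qed.

Let val_scomb n (b : 'I_n -> rad_mod M) u : val (scomb s b u) = scomb s (fun t => val (b t)) u.
Proof.
rewrite /scomb (raddf_sum (\val : rad_mod M -> M)); apply: eq_bigr => t _.
exact: linearZ.
Qed.

Lemma rad_vm_basis : sbasis s (fun=> True) (@shape_vec p U (rad_mod M) (in_rad i) rad_vm).
Proof.
have valE u : val (scomb s (@shape_vec p U (rad_mod M) (in_rad i) rad_vm) u) =
    scomb s (@shape_vec p U M (in_rad i) vm) u.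
  rewrite val_scomb; apply: eq_bigr => t _; congr (_ *: _); apply: in_radS; exact: shape_in.
split=> // [v _|u u0].
  have : kspan s (vgen F C v0 (in_rad i)) (val v).
    by apply/rad_predP; rewrite -(Rad_verma hp hi p3 V); apply: valP.
  move=> /(@shape_kspan k p U s M (in_rad i) vm)[|u hu]; last by exists u; apply: val_inj;
    rewrite valE.
  by move=> a b _ ab; rewrite (vm_out V) // negb_and.
by apply: (@vm_shape_indep (in_rad i)); rewrite -valE u0.
Qed.

Lemma rad_vm_act t l m : (F ^+ l * C ^+ m) *: @shape_vec p U (rad_mod M) (in_rad i) rad_vm t =
  \sum_(t' : 'I_#|region p (in_rad i)| |
    (shape_a t' == shape_a t + l)%N && (shape_b t' == shape_b t + m)%N)
     shape_vec rad_vm t'.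
Proof.
apply: shape_act => a b {}l {}m hab.
  apply: val_inj; rewrite [LHS]linearZ /= !in_radS ?(vm_fc V) 1?addnC 1?(addnC m) //.
  by move: hab; rewrite /in_rad; lia.
move=> h; apply: val_inj; rewrite in_radS; last by move: hab; rewrite /in_rad; lia.
by rewrite (vm_out V) //; move: h hab; rewrite /in_rad; lia.
Qed.

Lemma card_dual : (#|region p (in_dual p i)| <= #|region p (in_rad i)|)%N.
Proof.
rewrite -(card_imset _ (f := fun z : 'I_p * 'I_p => (rev_ord z.1, rev_ord z.2))).
  apply/subset_leq_card/subsetP => z /imsetP[y]; rewrite !inE => hy ->; move: hy.
  by rewrite /in_dual /in_rad /=; have := ltn_ord y.1; have := ltn_ord y.2; lia.
by move=> [a b] [a' b'] [] h1 h2; congr (_, _); apply: rev_ord_inj; apply: val_inj.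
Qed.

(** The family spans by [vtop_span] and is no larger than the monomial basis by [card_dual]; this
    forces independence. *)
Lemma rad_vtop_basis : sbasis s (fun=> True) (@shape_vec p U (rad_mod M) (in_dual p i) rad_vtop).
Proof.
have vE a b : val (rad_vtop a b) = vtop a b by apply/val_rad_vec/(vtop_rad hp hi p3 V).
apply: (sbasis_span rad_vm_basis card_dual) => // v _.
have : kspan s (vgen F C v0 (in_rad i)) (val v).
  by apply/rad_predP; rewrite -(Rad_verma hp hi p3 V); apply: valP.
move=> /(vtop_span hp hi p3 V) /(@shape_kspan k p U s M (in_dual p i) vtop)[|u hu].
  by move=> a b hab; move: hab; rewrite /in_dual; lia.
exists u; apply: val_inj; rewrite hu val_scomb; apply: eq_bigr => t _; congr (_ *: _).
by rewrite /shape_vec vE.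
Qed.

Lemma rad_vtop_act t l m :
  (E ^+ l * C ^+ m) *: @shape_vec p U (rad_mod M) (in_dual p i) rad_vtop t =
  \sum_(t' : 'I_#|region p (in_dual p i)| |
    (shape_a t' == shape_a t + l)%N && (shape_b t' == shape_b t + m)%N)
     shape_vec rad_vtop t'.
Proof.
have vE a b : val (rad_vtop a b) = vtop a b by apply/val_rad_vec/(vtop_rad hp hi p3 V).
apply: shape_act => a b {}l {}m _.
  by apply: val_inj; rewrite [LHS]linearZ /= !vE (vtop_act V) addnC (addnC m).
move=> h; apply: val_inj; rewrite vE (vtop_out hp hi p3 V) //.
by move: h; rewrite /in_dual; lia.
Qed.

Definition soc_pi (x : M) : soc_quot M := qm_pi (@Soc U M) x.
Definition soc_vm a b := soc_pi (vm a b).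

Let soc_piZ u x : soc_pi (u *: x) = u *: soc_pi x.
Proof. exact: qm_piZ. Qed.

Let soc_piD x y : soc_pi (x + y) = soc_pi x + soc_pi y.
Proof. exact: qm_piD. Qed.

Let soc_pi0 x : soc_pi x = 0 <-> kspan s (vgen F C v0 (in_soc p i)) x.
Proof.
have pi0 : soc_pi 0 = 0 by rewrite -(scale0r (0 : M)) soc_piZ scale0r.
rewrite -pi0 /soc_pi (qm_piE _ x 0) subr0 -[x \in _]/(x \in @Soc U M) (Soc_verma hp hi p3 V).
by split=> /soc_predP.
Qed.

Let soc_scomb n (b : 'I_n -> M) u : soc_pi (scomb s b u) = scomb s (fun t => soc_pi (b t)) u.
Proof.
rewrite /scomb; have pi0 : soc_pi 0 = 0 by rewrite -(scale0r (0 : M)) soc_piZ scale0r.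
by rewrite (big_morph soc_pi soc_piD pi0); apply: eq_bigr => t _; rewrite soc_piZ.
Qed.

(** With the parameter p - 2 - i, [in_dual] removes the pairs with a >= i + 1 and b >= p - 1, which
    is [in_soc] inside the square. *)
Lemma soc_vm_out a b : ~~ in_dual p (p - 2 - i) a b -> soc_vm a b = 0.
Proof.
move=> h; rewrite /soc_vm; have [ab|ab] := boolP ((a < p)%N && (b < p)%N); last first.
  by rewrite (vm_out V) //; apply/soc_pi0/kspan_0.
by apply/soc_pi0/vgen_in; move: h; rewrite /in_dual /in_soc; lia.
Qed.

Lemma soc_vm_basis :
  sbasis s (fun=> True) (@shape_vec p U (soc_quot M) (in_dual p (p - 2 - i)) soc_vm).
Proof.
split=> // [v _|u].
  have [x ->] : exists x, v = soc_pi x by exists (qm_repr v); rewrite /soc_pi qm_reprK.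
  apply: (@shape_kspan k p U s (soc_quot M) (in_dual p (p - 2 - i)) soc_vm).
    by move=> a b hab; move: hab; rewrite /in_dual; lia.
  elim: (vm_span V x) => [|c _ z [a [b [_ ->]]] _ IH].
    by rewrite -(scale0r (0 : M)) soc_piZ scale0r; apply: kspan_0.
  rewrite soc_piD soc_piZ; apply: kspanD => //; apply: kspanZ.
  have [h|h] := boolP (in_dual p (p - 2 - i) a b); first by apply: kspan_in; exists a, b.
  by have := soc_vm_out h; rewrite /soc_vm => ->; apply: kspan_0.
have -> : scomb s (@shape_vec p U (soc_quot M) (in_dual p (p - 2 - i)) soc_vm) u =
   soc_pi (scomb s (@shape_vec p U M (in_dual p (p - 2 - i)) vm) u) by rewrite soc_scomb.
move=> /soc_pi0 h; apply: (@vm_shape_indep (in_dual p (p - 2 - i))).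
apply: (kspan_disjoint hp hi p3 V (P := in_dual p (p - 2 - i)) (Q := in_soc p i)) => //.
  by move=> a b _ _; rewrite /in_dual /in_soc; lia.
rewrite /scomb; elim/big_rec: _ => [|t z _ hz]; first exact: kspan_0.
apply: kspanD hz; apply/kspanZ/vgen_in; exact: shape_in.
Qed.

Lemma soc_vm_act t l m :
  (F ^+ l * C ^+ m) *: @shape_vec p U (soc_quot M) (in_dual p (p - 2 - i)) soc_vm t =
  \sum_(t' : 'I_#|region p (in_dual p (p - 2 - i))| |
    (shape_a t' == shape_a t + l)%N && (shape_b t' == shape_b t + m)%N)
     shape_vec soc_vm t'.
Proof.
apply: shape_act => a b {}l {}m _.
  by rewrite /soc_vm -soc_piZ (vm_fc V) addnC (addnC m).
by move=> h; apply: soc_vm_out; move: h; rewrite /in_dual; lia.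
Qed.
End VermaBases.

Section Eigenvector.
Variables (k : fieldType) (B A : pzRingType) (s : {rmorphism k -> A}) (v : A).
Variables (f : {rmorphism B -> A}) (w : {rmorphism B -> k}).
Hypothesis sC : forall a, central (s a).

Lemma eigenD x y : f x * v = s (w x) * v -> f y * v = s (w y) * v ->
  f (x + y) * v = s (w (x + y)) * v.
Proof. by move=> hx hy; rewrite !rmorphD !mulrDl hx hy. Qed.

Lemma eigenM x y : f x * v = s (w x) * v -> f y * v = s (w y) * v ->
  f (x * y) * v = s (w (x * y)) * v.
Proof.
move=> hx hy; rewrite !rmorphM -mulrA hy (mulrA (f x)) -sC -mulrA hx mulrA.
by rewrite (sC (w y)).
Qed.
End Eigenvector.

Section Induced.
Variables (k : fieldType) (p : nat) (V : {vspace sl2s k p}).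
Hypotheses (hp : p \in [pchar k]) (hV : psubalgebra V).
Hypothesis psiV : forall x : sl2s k p, x \in V -> psi x.1 = x.2.
Variable i : nat.
Local Notation g := (sl2s k p).
Local Notation w := (weight_hom hp hV psiV i).
Local Notation phi := (U0_incl hV).
Local Notation sB := (scal (sub_pLie V)).

Definition hw_vec : tens phi (one_dim hp hV psiV i) := ind_vec phi w.

Lemma weight_scal a : w (sB a) = a.
Proof. exact: U0_lift_scal. Qed.

Lemma incl_scal a : phi (sB a) = scal g a.
Proof. exact: U0_lift_scal. Qed.

Lemma incl_iota (x : sub_pLie V) : phi (Defs.iota x) = Defs.iota (vsval x).
Proof. exact: U0_lift_iota. Qed.

Lemma hw_vec_gen (m : tens phi (one_dim hp hV psiV i)) : exists u, m = u *: hw_vec.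
Proof. exact: (ind_gen weight_scal m). Qed.

Lemma hw_vec_weight (x : g) : x \in V ->
  Defs.iota x *: hw_vec = scal g (i%:R * (x.2 : k)) *: hw_vec.
Proof.
move=> xV; have E := ind_weight phi weight_scal (Defs.iota (vsproj V x : sub_pLie V)).
have wE : w (Defs.iota (vsproj V x : sub_pLie V)) = i%:R * (x.2 : k).
  by apply: etrans (U0_lift_iota _ _ _ _ _) _; rewrite /weight vsprojK.
rewrite wE incl_scal incl_iota vsprojK // in E; exact: E.
Qed.

Lemma hw_vec_faithful (A : nzRingType) (s : {rmorphism k -> A}) (rho : {rmorphism U0 g -> A}) v :
    (forall a, central (s a)) -> (forall a, rho (scal g a) = s a) ->
    (forall x, x \in V -> rho (Defs.iota x) * v = s (i%:R * (x.2 : k)) * v) ->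
  forall u, u *: hw_vec = 0 -> rho u * v = 0.
Proof.
move=> sC rs rV; apply: (ind_faithful weight_scal) => b.
rewrite (incl_scal (w b)) rs; elim/U0_ind: b => [a|x|x y hx hy|x y hx hy].
- by rewrite incl_scal rs weight_scal.
- rewrite incl_iota rV ?subvsP //; congr (s _ * _).
  by apply/esym; apply: etrans (U0_lift_iota _ _ _ _ _) _.
- exact: (@eigenD _ _ _ s v (rho \o phi) w _ _ hx hy).
exact: (@eigenM _ _ _ s v (rho \o phi) w sC _ _ hx hy).
Qed.

Lemma hw_vec_top (A : nzRingType) (s : {rmorphism k -> A}) (rho : {rmorphism U0 g -> A}) v X Y n :
    (forall a, central (s a)) -> (forall a, rho (scal g a) = s a) ->
    (forall x, x \in V -> rho (Defs.iota x) * v = s (i%:R * (x.2 : k)) * v) ->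
  rho X ^+ n * (rho Y ^+ n * v) <> 0 -> X ^+ n *: (Y ^+ n *: hw_vec) <> 0.
Proof.
move=> sC rs rV h e; apply: h; rewrite mulrA -(rmorphXn rho) -(rmorphXn rho) -(rmorphM rho).
by apply: (hw_vec_faithful sC rs rV); rewrite -scalerA.
Qed.
End Induced.

Section RepValues.
Variables (k : fieldType) (p : nat) (A : nzRingType) (s : {rmorphism k -> A}) (e f h c : A).
Local Notation rep := (@sl2s_rep k p A s e f h c).

Lemma rep_sl2s_of (m : 'M[k]_2) : \tr m = 0 ->
  rep (sl2s_of p m) = s (m 0 0) * h + s (m 0 1) * e + s (m 1 0) * f.
Proof. by move=> hm; rewrite /sl2s_rep /= sl2_ofK // rmorph0 mul0r addr0. Qed.

Lemma rep_e : rep (elt_e k p) = e.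
Proof. by rewrite rep_sl2s_of ?tr_mxe // !mxE /= !(rmorph0, rmorph1, mul0r, mul1r, add0r,
  addr0). Qed.

Lemma rep_f : rep (elt_f k p) = f.
Proof. by rewrite rep_sl2s_of ?tr_mxf // !mxE /= !(rmorph0, rmorph1, mul0r, mul1r, add0r,
  addr0). Qed.

Lemma rep_h : rep (elt_h k p) = h.
Proof.
by rewrite rep_sl2s_of ?tr_mxh // !mxE /= !(subr0, rmorph0, rmorph1, mul0r, mul1r, add0r, addr0).
Qed.

Lemma rep_c : rep (elt_c0 k p) = c.
Proof.
have z : mx_of (0 : sl2 k p) = 0 by exact: linear0.
by rewrite /sl2s_rep -[(elt_c0 k p).1]/(0 : sl2 k p) z !mxE !(rmorph0, rmorph1, mul0r, mul1r,
  add0r, addr0).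
Qed.

Lemma rep_borel (m : 'M[k]_2) a b : rep (a *: (elt_h k p + elt_c0 k p) + b *: sl2s_of p m) =
  s a * (h + c) + s b * rep (sl2s_of p m).
Proof.
have rep0 : rep 0 = 0.
  apply: (addrI (rep 0)); rewrite addr0 -[in RHS](scale1r (0 : sl2s k p)) -[in RHS](addr0 (1 *: 0)).
  by rewrite sl2s_rep_lin rmorph1 mul1r.
have repD x y : rep (x + y) = rep x + rep y.
  by rewrite -{1}(scale1r x) sl2s_rep_lin rmorph1 mul1r.
have repZ d x : rep (d *: x) = s d * rep x by rewrite -[d *: x]addr0 sl2s_rep_lin rep0 addr0.
by rewrite repD !repZ repD rep_h rep_c.
Qed.

Lemma rep_borel_weight (m : 'M[k]_2) (i : nat) v x : (h + c) * v = s i%:R * v ->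
    rep (sl2s_of p m) * v = 0 -> (forall a, central (s a)) ->
    x \in <<[:: (elt_h k p + elt_c0 k p)%R; sl2s_of p m]>>%VS ->
  rep x * v = s (i%:R * (x.2 : k)) * v.
Proof.
move=> hv ev sC /span2P[a [b ->]]; rewrite rep_borel borelE mulrDl -!mulrA hv ev mulr0 addr0.
by rewrite mulrA -rmorphM mulrC.
Qed.
End RepValues.

Lemma ad_add_central (U : pzRingType) (x y c : U) : central c -> ad (x + c) y = ad x y.
Proof. by move=> cC; rewrite ad_linDl (ad_central _ cC) addr0. Qed.

Lemma ad_opp_l (U : pzRingType) (x y : U) : ad (- x) y = - ad x y.
Proof. by rewrite ad_anti ad_linNr -ad_anti. Qed.

Lemma central_opp (U : pzRingType) (c : U) : central c -> central (- c).
Proof. by move=> cC x; rewrite mulNr mulrN cC. Qed.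

Lemma opp_addK (U : pzRingType) (h c : U) : - h = - (h + c) - - c.
Proof. by rewrite opprK opprD subrK. Qed.

Lemma add_scalarK (k : fieldType) (U : pzRingType) (s : {rmorphism k -> U}) (x c : U) :
  x = (x + c) + s (-1) * c.
Proof. by rewrite rmorphN1 mulN1r addrK. Qed.

Section VermaZ.
Variables (k : fieldType) (p : nat).
Hypotheses (hp : p \in [pchar k]) (p3 : (3 <= p)%N).
Local Notation g := (sl2s k p).
Local Notation E := (Defs.iota (elt_e k p)).
Local Notation H := (Defs.iota (elt_h k p)).
Local Notation F := (Defs.iota (elt_f k p)).
Local Notation C := (Defs.iota (elt_c0 k p)).
Let p_odd := pchar_odd hp p3.

Definition Z_vec i : Z hp p3 i := hw_vec hp (b_s_psub k p_odd) (@b_s_psi k p) i.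
Definition Z'_vec i : Z' hp p3 i := hw_vec hp (b_sm_psub k p_odd) (@b_sm_psi k p) i.

Lemma sl2s_scal_central a : central (scal g a).
Proof. by move=> u; exact: scal_comm. Qed.

(** The torus element is h + c_0, which acts on the generator by the scalar i, while h acts by i -
    c_0. *)
Lemma Z_verma i : verma p (scal g) E F (H + C) C (Z_vec i) i.
Proof.
have CC := U0_c_central hp p3.
have e_in : elt_e k p \in b_s k p by apply: memv_span; rewrite !inE eqxx orbT.
have t_in : (elt_h k p + elt_c0 k p : g) \in b_s k p by apply: memv_span; rewrite !inE eqxx.
split.
- exact: sl2s_scal_central.
- exact: CC.
- exact: etrans (ad_add_central _ _ CC) (U0_hf hp p3).
- exact: etrans (U0_ef hp p3) (esym (addrK _ _)).
- exact: (U0_f_pow hp p3).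
- exact: (U0_c_pow hp p3).
- move=> P Ps PE PF PT PC PD PM; apply: (sl2s_ind p3 Ps PE PF _ PC PD PM).
  rewrite (add_scalarK (scal g) H C); exact: (PD _ _ PT (PM _ _ (Ps (-1)) PC)).
- have h := hw_vec_weight hp (b_s_psub k p_odd) (@b_s_psi k p) i e_in.
  have w0 : scal g (i%:R * ((elt_e k p).2 : k)) = 0 by rewrite mulr0 rmorph0.
  exact: etrans h (etrans (congr1 (fun a => a *: Z_vec i) w0) (scale0r _)).
- have h := hw_vec_weight hp (b_s_psub k p_odd) (@b_s_psi k p) i t_in.
  have w1 : i%:R * ((elt_h k p + elt_c0 k p : g).2 : k) = i%:R.
    by rewrite -[(elt_h k p + elt_c0 k p).2]/(0 + 1 : k) add0r mulr1.
  exact: etrans (congr1 (fun u => u *: Z_vec i) (esym (@U0_iotaD k p g _ _)))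
    (etrans h (congr1 (fun a => scal g a *: Z_vec i) w1)).
- exact: hw_vec_gen.
have [A [s [e [f [h [c [v [[sC he hf ef] [[e0 f0 c0 h0 cC] [ev tv top]]]]]]]]]] :=
  highest_weight_model i hp p3.
have ce := ad_central e cC; have cf := ad_central f cC; have ch := ad_central h cC.
pose rho := U0_rep hp p3 sC he hf ef e0 f0 c0 h0 ce cf ch.
have rhoE x : rho (Defs.iota x) = sl2s_rep s e f h c x by exact: U0_lift_iota.
apply: (hw_vec_top (rho := rho) (v := v) sC) => [a|x xb|]; first exact: U0_lift_scal.
  by rewrite rhoE (@rep_borel_weight k p A s e f h c (mxe k) i v) // rep_e.
by rewrite !rhoE rep_f rep_c.
Qed.

(* The isomorphism of sl(2) exchanging e and f and changing the signs of h and
   c_0 turns Z' (i + 2) into Z (p - 2 - i). *)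
Lemma Z'_verma i : (i <= p - 2)%N ->
  verma p (scal g) F E (- (H + C)) (- C) (Z'_vec (i + 2)) (p - 2 - i).
Proof.
move=> hi; have CC := U0_c_central hp p3; have CN := central_opp CC.
(* The element - (h + c_0) acts on the generator by - (i + 2), which is p - 2 - i in k; for i = p -
   2 both are 0. *)
have iE : (p - 2 - i)%:R = - (i + 2)%:R :> k.
  apply/eqP; rewrite -addr_eq0 -natrD; have -> : (p - 2 - i + (i + 2) = p)%N by lia.
  by rewrite (pcharf0 hp).
have f_in : elt_f k p \in b_sm k p by apply: memv_span; rewrite !inE eqxx orbT.
have t_in : (elt_h k p + elt_c0 k p : g) \in b_sm k p by apply: memv_span; rewrite !inE eqxx.
split.
- exact: sl2s_scal_central.
- exact: CN.
- exact: etrans (ad_opp_l _ _) (congr1 -%R (etrans (ad_add_central _ _ CC) (U0_he hp p3))).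
- exact: etrans (ad_anti _ _) (etrans (congr1 -%R (U0_ef hp p3)) (opp_addK _ _)).
- exact: (U0_e_pow hp p3).
- by rewrite exprNn (U0_c_pow hp p3) mulr0.
- move=> P Ps PF PE PT PC PD PM.
  have N1 u : P (- u) -> P u.
    by move=> Pu; rewrite -[u]opprK -mulN1r -(rmorphN1 (scal g)); exact: (PM _ _ (Ps (-1)) Pu).
  apply: (sl2s_ind p3 Ps PE PF _ (N1 _ PC) PD PM).
  rewrite (add_scalarK (scal g) H C).
  exact: (PD _ _ (N1 _ PT) (PM _ _ (Ps (-1)) (N1 _ PC))).
- have h := hw_vec_weight hp (b_sm_psub k p_odd) (@b_sm_psi k p) (i + 2) f_in.
  have w0 : scal g ((i + 2)%:R * ((elt_f k p).2 : k)) = 0 by rewrite mulr0 rmorph0.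
  exact: etrans h (etrans (congr1 (fun a => a *: Z'_vec (i + 2)) w0) (scale0r _)).
- have h := hw_vec_weight hp (b_sm_psub k p_odd) (@b_sm_psi k p) (i + 2) t_in.
  have w1 : (i + 2)%:R * ((elt_h k p + elt_c0 k p : g).2 : k) = (i + 2)%:R.
    by rewrite -[(elt_h k p + elt_c0 k p).2]/(0 + 1 : k) add0r mulr1.
  have sE : scal g (p - 2 - i)%:R = - scal g (i + 2)%:R by rewrite iE rmorphN.
  have h' := etrans (congr1 (fun u => u *: Z'_vec (i + 2)) (esym (@U0_iotaD k p g _ _)))
    (etrans h (congr1 (fun a => scal g a *: Z'_vec (i + 2)) w1)).
  exact: etrans (scaleNr _ _) (etrans (congr1 -%R h')
    (esym (etrans (congr1 (fun a => a *: Z'_vec (i + 2)) sE) (scaleNr _ _)))).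
- exact: hw_vec_gen.
have [A [s [e [f [h [c [v [[sC he hf ef] [[e0 f0 c0 h0 cC] [ev tv top]]]]]]]]]] :=
  highest_weight_model (p - 2 - i) hp p3.
have cC' := central_opp cC.
have he' : ad (- h) f = 2%:R * f by rewrite ad_opp_l hf opprK.
have hf' : ad (- h) e = - (2%:R * e) by rewrite ad_opp_l he.
have ef' : ad f e = - h by rewrite ad_anti ef.
have c0' : (- c) ^+ p = 0 by rewrite exprNn c0 mulr0.
have h0' : (- h) ^+ p = - h + - c.
  by rewrite exprNn -signr_odd p_odd expr1 h0 mulN1r opprD.
pose rho := U0_rep hp p3 sC he' hf' ef' f0 e0 c0' h0' (ad_central f cC') (ad_central e cC') (ad_central (- h) cC').
have rhoE x : rho (Defs.iota x) = sl2s_rep s f e (- h) (- c) x by exact: U0_lift_iota.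
apply: (hw_vec_top (rho := rho) (v := v) sC) => [a|x xb|]; first exact: U0_lift_scal.
  rewrite rhoE (@rep_borel_weight k p A s f e (- h) (- c) (mxf k) (i + 2) v) // ?rep_f //.
  by rewrite -opprD mulNr tv iE rmorphN mulNr opprK.
by rewrite (rmorphN rho) !rhoE rep_e rep_c opprK.
Qed.
End VermaZ.

(** * Restriction to the elementary subalgebras *)

Section Forms.
Variables (k : fieldType) (p : nat) (V : {vspace sl2s k p}).

Definition entry_form (u v : 'I_2) (x : sub_pLie V) : k^o := mx_of (vsval x).1 u v.

Lemma entry_form_linear u v : linear (entry_form u v).
Proof.
move=> a x y; rewrite /entry_form.
have -> : (vsval (a *: x + y)).1 = a *: (vsval x).1 + (vsval y).1 by rewrite linearP.
by rewrite mx_of_lin !mxE.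
Qed.

HB.instance Definition _ u v :=
  GRing.isLinear.Build k (sub_pLie V) k^o _ (entry_form u v) (entry_form_linear u v).

(** With eps = 1 or - 1 this is the coordinate along eps c_0; the sign - 1 serves Z'(i + 2), whose
    basis is shifted by - c_0. *)
Definition c0_form (eps : k) (x : sub_pLie V) : k^o := eps * ((vsval x).2 : k).

Lemma c0_form_linear eps : linear (c0_form eps).
Proof.
move=> a x y; rewrite /c0_form.
have -> : ((vsval (a *: x + y)).2 : k) = a * ((vsval x).2 : k) + (vsval y).2 by rewrite linearP.
by rewrite mulrDr mulrCA.
Qed.

HB.instance Definition _ eps :=
  GRing.isLinear.Build k (sub_pLie V) k^o _ (c0_form eps) (c0_form_linear eps).
End Forms.

Section Elementary.
Variables (k : fieldType) (p : nat) (A : 'M[k]_2) (u v : 'I_2) (eps : k).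
Local Notation g := (sl2s k p).
Local Notation V := <<[:: sl2s_of p A; elt_c0 k p]>>%VS.
Hypotheses (hp : p \in [pchar k]) (p3 : (3 <= p)%N) (hV : psubalgebra V)
  (trA : \tr A = 0) (Auv : A u v = 1) (eps2 : eps * eps = 1).
Local Notation phi := (U0_incl hV).

Let x1 : sub_pLie V := vsproj V (sl2s_of p A).
Let x2 : sub_pLie V := vsproj V (eps *: elt_c0 k p).

Let x1E : vsval x1 = sl2s_of p A.
Proof. by apply: vsprojK; apply: memv_span; rewrite !inE eqxx. Qed.

Let x2E : vsval x2 = eps *: elt_c0 k p.
Proof. by apply: vsprojK; apply: memvZ; apply: memv_span; rewrite !inE eqxx orbT. Qed.

Let al : {linear sub_pLie V -> k^o} := @entry_form k p V u v.
Let be : {linear sub_pLie V -> k^o} := @c0_form k p V eps.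

Let coordE x : x = al x *: x1 + be x *: x2.
Proof.
have /span2P[a [b xE]] := subvsP x.
have xE' : vsval x = (a *: sl2_of p A, b) by rewrite xE nil_c0E.
have alE : al x = a.
  by rewrite -[al x]/(mx_of (vsval x).1 u v) xE' -[(_,
    b).1]/(a *: sl2_of p A) sl2_ofZ // mxE Auv mulr1.
have beE : be x = eps * b by rewrite -[be x]/(eps * ((vsval x).2 : k)) xE'.
have E y z : vsval (a *: y + (eps * b) *: z : sub_pLie V) =
    a *: (vsval y : g) + (eps * b) *: (vsval z : g) by rewrite linearP linearZ.
apply: val_inj; rewrite alE beE; apply: etrans xE _; apply: etrans _ (esym (E x1 x2)).
by rewrite x1E x2E scalerA mulrAC eps2 mul1r.
Qed.

Let al1 : al x1 = 1.
Proof. by rewrite -[al x1]/(mx_of (vsval x1).1 u v) x1E sl2_ofK. Qed.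

Let al2 : al x2 = 0.
Proof.
rewrite -[al x2]/(mx_of (vsval x2).1 u v) x2E -[(_ *: _).1]/(eps *: (0 : sl2 k p)) scaler0.
by rewrite [mx_of 0]linear0 mxE.
Qed.

Let be1 : be x1 = 0.
Proof. by rewrite -[be x1]/(eps * ((vsval x1).2 : k)) x1E mulr0. Qed.

Let be2 : be x2 = 1.
Proof. by rewrite -[be x2]/(eps * ((vsval x2).2 : k)) x2E -[(_ *: _).2]/(eps * 1) mulr1. Qed.

Let X := Defs.iota x1.
Let Y := Defs.iota x2.

Let iotaE x : Defs.iota x = scal (sub_pLie V) (al x) * X + scal (sub_pLie V) (be x) * Y.
Proof.
apply: etrans (congr1 (@Defs.iota k p (sub_pLie V)) (coordE x)) _.
exact: etrans (U0_iotaD _ _) (congr2 +%R (U0_iotaZ _ _) (U0_iotaZ _ _)).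
Qed.

Let XY : GRing.comm X Y.
Proof.
have e : X * Y - Y * X = 0.
  apply: etrans (esym (iota_br x1 x2)) _.
  suff -> : br x1 x2 = 0 by exact: U0_iota0.
  rewrite -[br x1 x2]/(vsproj V (br (vsval x1) (vsval x2))) x1E x2E.
  have z0 : mx_of (eps *: 0 : sl2 k p) = 0 by rewrite scaler0; exact: linear0.
  have -> : br (sl2s_of p A : g) (eps *: elt_c0 k p : g) = 0; last exact: linear0.
  apply: sl2s_eq; last by [].
  rewrite -[(br (sl2s_of p A : g) _).1]/(br (sl2_of p A) (eps *: (0 : sl2 k p))).
  rewrite (mx_of_br (pchar_odd hp p3)) z0 mulmx0 mul0mx subrr.
  exact/esym/linear0.
by apply/eqP; rewrite -subr_eq0; apply/eqP.
Qed.

Variables (M : lmodType (U0 g)) (j n r : nat) (ra rb : 'I_n -> nat) (b : 'I_n -> M).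
Local Notation N := (restr_mod phi M).
Hypothesis bB : sbasis (scal g) (fun=> True) b.
Variable C' : U0 g.
Hypothesis C'E : scal g eps * Defs.iota (elt_c0 k p) = C'.
Hypothesis hact : forall t l m,
  (Defs.iota (sl2s_of p A : g) ^+ l * C' ^+ m) *: b t =
  \sum_(t' | (ra t' == ra t + l)%N && (rb t' == rb t + m)%N) b t'.
Variables fc tc ff tf : 'I_r -> 'I_n.
Hypothesis md : mono_data k j ra rb fc tc ff tf.

Let hact' t l m : (X ^+ l * Y ^+ m) *: (b t : N) =
  \sum_(t' | (ra t' == ra t + l)%N && (rb t' == rb t + m)%N) (b t' : N).
Proof.
have phiX : phi X = Defs.iota (sl2s_of p A : g).
  by apply: etrans (incl_iota hV x1) _; rewrite x1E.
have phiY : phi Y = C'.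
  by apply: etrans (incl_iota hV x2) _; rewrite x2E; exact: etrans (U0_iotaZ _ _) C'E.
rewrite -[LHS]/(phi (X ^+ l * Y ^+ m) *: (b t : M)).
rewrite (rmorphM phi) (rmorphXn phi) (rmorphXn phi) phiX phiY; exact: hact.
Qed.

Let bB' : sbasis (N := N) (scal (sub_pLie V)) (fun=> True) b.
Proof. exact: (restr_sbasis (phi := phi) (incl_scal hV) bB). Qed.

Lemma elementary_constant_jrank : constant_jrank_eq N j r.
Proof. exact: (mono_constant_jrank coordE iotaE XY hact' bB' md). Qed.

Lemma elementary_jdegree d :
  (d + \sum_a rb (ff a) = j * r + \sum_a rb (fc a))%N -> jdegree N j d.
Proof. exact: (jdegree_monomial coordE al1 al2 be1 be2 iotaE XY hact' bB' md). Qed.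
End Elementary.

Lemma rat_degree (p j d c : nat) : (j <= p)%N -> (2 * d + 2 * (j * c) = j * (p * (p - j)))%N ->
  d%:R = j%:R * (p%:R * (p%:R - j%:R) / 2%:R - c%:R) :> rat.
Proof.
move=> jp /(congr1 (fun x => x%:R : rat)); rewrite natrD !natrM natrB // => h.
have : 2%:R * (d%:R : rat) = j%:R * (p%:R * (p%:R - j%:R)) - 2%:R * (j%:R * c%:R) by
  rewrite -h addrK.
by move=> h2; apply: (mulfI (_ : 2%:R != 0 :> rat)) => //; rewrite h2; field.
Qed.

(** The second claim is over $\mathfrak e_e$, not $\mathfrak e_f$: the quotient is isomorphic to
    Rad(Z(i)), so over $\mathfrak e_f$ it has the degree of the first claim, which is smaller by j
    (i + 1). *)
Theorem proposition4p3p5 (k : closedFieldType) (p : nat)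
    (hp : p \in [pchar k]) (p3 : (3 <= p)%N) (i j : nat)
    (hi : (i <= p - 2)%N) (hj : (1 <= j <= p - i - 1)%N) :
  [/\ constant_jrank (res_f hp p3 (rad_mod (Z hp p3 i))) j /\
      exists2 d : nat, jdegree (res_f hp p3 (rad_mod (Z hp p3 i))) j d &
        d%:R = j%:R * (p%:R * (p%:R - j%:R) / 2%:R - i%:R - 1) :> rat,
      constant_jrank (res_e hp p3 (soc_quot (Z' hp p3 (i + 2)))) j /\
      exists2 d : nat, jdegree (res_e hp p3 (soc_quot (Z' hp p3 (i + 2)))) j d &
        d%:R = j%:R * (p%:R * (p%:R - j%:R) / 2%:R) :> rat &
      constant_jrank (res_e hp p3 (rad_mod (Z hp p3 i))) j /\
      exists2 d : nat, jdegree (res_e hp p3 (rad_mod (Z hp p3 i))) j d &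
        d%:R = j%:R * (p%:R * (p%:R - j%:R) / 2%:R) :> rat].
Proof.
have p_odd := pchar_odd hp p3; have jp : (j <= p)%N by lia.
have one2 : 1 * 1 = 1 :> k by rewrite mulr1.
have mone2 : -1 * -1 = 1 :> k by rewrite mulrNN mulr1.
have f10 : mxf k 1 0 = 1 by rewrite mxE.
have e01 : mxe k 0 1 = 1 by rewrite mxE.
have C1 : scal (sl2s k p) 1 * Defs.iota (elt_c0 k p) = Defs.iota (elt_c0 k p).
  by rewrite rmorph1 mul1r.
have CN1 : scal (sl2s k p) (-1) * Defs.iota (elt_c0 k p) = - Defs.iota (elt_c0 k p).
  by rewrite rmorphN1 mulN1r.
have VZ := Z_verma hp p3 i; have VZ' := Z'_verma hp p3 hi.
split.
- have [fc [tc [ff [tf [md [d [dE d2]]]]]]] := rad_shape hp p3 hi hj.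
  have act t l m := rad_vm_act hp hi p3 VZ t l m.
  have B := rad_vm_basis hp hi p3 VZ.
  split.
    exists (pl_rank p i j).
    exact: (elementary_constant_jrank hp p3 (e_f_psub k p_odd p3) (tr_mxf k) f10 one2 B C1 act md).
  exists d; first exact: (elementary_jdegree hp p3 (e_f_psub k p_odd p3) (tr_mxf k) f10 one2 B C1 act md dE).
  by rewrite (rat_degree jp d2) -[i.+1%:R]natr1 opprD addrA.
(* As Z'(i + 2) is a Verma module of parameter p - 2 - i, its quotient by the socle has the shape
   [in_dual] of parameter p - 2 - (p - 2 - i) = i, as Rad(Z(i)) has over e_e. The parameter stays
   unreduced because the index types of the bases depend on it. *)
- have iE : (p - 2 - (p - 2 - i) = i)%N by lia.
  have hi' : (p - 2 - i <= p - 2)%N by lia.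
  have hi2 : (p - 2 - (p - 2 - i) <= p - 2)%N by lia.
  have hj2 : (1 <= j <= p - (p - 2 - (p - 2 - i)) - 1)%N by rewrite iE.
  have [fc [tc [ff [tf [md [d [dE d2]]]]]]] := dual_shape hp p3 hi2 hj2.
  have act t l m := soc_vm_act hp hi' p3 VZ' t l m.
  have B := soc_vm_basis hp hi' p3 VZ'.
  split.
    exists (pl_rank p (p - 2 - (p - 2 - i)) j).
    exact: (elementary_constant_jrank hp p3 (e_e_psub k p_odd p3) (tr_mxe k) e01 mone2 B CN1 act md).
  exists d; first exact: (elementary_jdegree hp p3 (e_e_psub k p_odd p3) (tr_mxe k) e01 mone2 B CN1 act md dE).
  by rewrite (@rat_degree p j d 0) ?muln0 ?addn0 // subr0.
have [fc [tc [ff [tf [md [d [dE d2]]]]]]] := dual_shape hp p3 hi hj.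
have act t l m := rad_vtop_act hp hi p3 VZ t l m.
have B := rad_vtop_basis hp hi p3 VZ.
split.
  exists (pl_rank p i j).
  exact: (elementary_constant_jrank hp p3 (e_e_psub k p_odd p3) (tr_mxe k) e01 one2 B C1 act md).
exists d; first exact: (elementary_jdegree hp p3 (e_e_psub k p_odd p3) (tr_mxe k) e01 one2 B C1 act md dE).
by rewrite (@rat_degree p j d 0) ?muln0 ?addn0 // subr0.
Qed.
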